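(* For each $n\in\mathbb{N}_0$ let $\{P^{(j)}_n: 1\le j\le \binom{n+d-2}{n}\}$ be an orthonormal basis of $M_n$ in the sense $\frac{1}{|S^{d-1}|}\int_{S^{d-1}}\overline{P^{(i)}_n(\omega)}P^{(j)}_n(\omega)h_\kappa^2(\omega)\,d\Sigma(\omega)=\delta_{ij}$, where $|S^{d-1}|=2\pi^{d/2}/\Gamma(d/2)$. Then the set $\Big\{\frac{H_{s,\mu,P^{(j)}_n}}{\sqrt{\gamma_{s,\mu,n}}}: s,n\in\mathbb{N}_0,\ 1\le j\le\binom{n+d-2}{n}\Big\}$ is an orthonormal basis of the right Hilbert module $L^2(\mathbb{R}^d;e^{x^2})$, where $\gamma_{s,\mu,n}=(H_{s,\mu,P^{(j)}_n},H_{s,\mu,P^{(j)}_n})_H=4^s(\tfrac{s}{2})!\,\pi^{d/2}\frac{\Gamma(\frac{s+\mu}{2}+n)}{\Gamma(\frac d2)}$ if $s$ is even, and $\gamma_{s,\mu,n}=4^s(\tfrac{s-1}{2})!\,\pi^{d/2}\frac{\Gamma(\frac{s+\mu+1}{2}+n)}{\Gamma(\frac d2)}$ if $s$ is odd.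
   Context: Let $d\ge 2$. $\mathbb{R}_{0,d}$ is the real Clifford algebra generated by $e_1,\dots,e_d$ with $e_ie_j+e_je_i=-2\delta_{ij}$; vectors $x$ are identified with $\sum_ix_ie_i$, so $x^2=-|x|^2$. Conjugation on $\mathbb{C}\otimes\mathbb{R}_{0,d}$ is the conjugate-linear anti-involution with $\bar e_i=-e_i$, $\overline{ab}=\bar b\bar a$. $R$ is a root system with reflection group $W$, positive subsystem $R_+$, $\kappa:R\to[0,\infty)$ a $W$-invariant multiplicity function with $\gamma_\kappa=\sum_{\alpha\in R_+}\kappa(\alpha)>0$, $\mu=2\gamma_\kappa+d$, $h_\kappa(x)=\prod_{\alpha\in R_+}|\langle\alpha,x\rangle|^{\kappa(\alpha)}$. Dunkl operators $T_if(x)=\partial_{x_i}f(x)+\sum_{\alpha\in R_+}\kappa(\alpha)\frac{f(x)-f(\sigma_\alpha x)}{\langle\alpha,x\rangle}\alpha_i$ ($\sigma_\alpha$ the reflection orthogonal to $\alpha$); Dunkl–Dirac operator $D_h=\sum_ie_iT_i$. $M_n$: $\mathbb{C}\otimes\mathbb{R}_{0,d}$-valued homogeneous polynomials of degree $n$ with $D_hP=0$ (a right module over $\mathbb{C}\otimes\mathbb{R}_{0,d}$). $D_+f=D_hf-2xf$, and $H_{s,\mu,P_n}=(D_+)^sP_n$. $L^2(\mathbb{R}^d;e^{x^2})$ is the right Hilbert module over $\mathbb{C}\otimes\mathbb{R}_{0,d}$ of $\mathbb{C}\otimes\mathbb{R}_{0,d}$-valued measurable functions with the Clifford-valued inner product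 $(f,g)_H=\int_{\mathbb{R}^d}\overline{f(x)}g(x)e^{x^2}h_\kappa^2(x)\,dx$, where $e^{x^2}=e^{-|x|^2}$. *)

(* Defs.v *)
From HB Require Import structures.
From mathcomp Require Import all_boot all_order all_algebra.
From mathcomp Require Import all_classical all_reals all_analysis.
From mathcomp Require Import complex.
Set Implicit Arguments. Unset Strict Implicit. Unset Printing Implicit Defensive.
Import Order.TTheory GRing.Theory Num.Theory.
Local Open Scope ring_scope.

Section CliffordDunkl.
Context (R : realType) (d : nat).

Definition dotv (a x : 'rV[R]_d) : R := \sum_i a 0 i * x 0 i.
Definition norm2 (x : 'rV[R]_d) : R := dotv x x.
Definition refl (a x : 'rV[R]_d) : 'rV[R]_d := x - (2 * dotv a x / dotv a a) *: a.
Definition unitv (i : 'I_d) : 'rV[R]_d := delta_mx 0 i.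

(* ---------- the complexified Clifford algebra C (x) R_{0,d} ----------
   element = complex coefficients on the basis e_A, A ⊆ {1..d}
   (e_A = e_{a1} ... e_{ak}, a1 < ... < ak). *)
Definition Cl := {ffun {set 'I_d} -> R[i]}.

(* e_A e_B = clsign A B * e_{A Δ B}, using e_i e_j = - e_j e_i (i<>j), e_i^2 = -1 *)
Definition clsign (A B : {set 'I_d}) : R :=
  (-1) ^+ (#|[set p : 'I_d * 'I_d | ([&& p.1 \in A, p.2 \in B & (p.2 < p.1)%N])]|
           + #|A :&: B|)%N.

Definition clmul (a b : Cl) : Cl :=
  [ffun C => \sum_(A : {set 'I_d}) \sum_(B : {set 'I_d} | (A :|: B) :\: (A :&: B) == C)
               ((clsign A B)%:C)%C * a A * b B].

Definition cl1 : Cl := [ffun A : {set 'I_d} => if #|A| == 0%N then 1 else 0].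
Definition clbasis (i : 'I_d) : Cl := [ffun A : {set 'I_d} => if A == [set i] then 1 else 0].
Definition clvec (x : 'rV[R]_d) : Cl := \sum_i ((x 0 i)%:C)%C *: clbasis i.

(* conjugation: conjugate-linear anti-involution with bar e_i = - e_i,
   hence bar e_A = (-1)^(|A|(|A|+1)/2) e_A *)
Definition clconj (a : Cl) : Cl :=
  [ffun A : {set 'I_d} => (((-1) ^+ (#|A| * #|A|.+1)./2 : R)%:C)%C * conjc (a A)].

(* squared Clifford norm = scalar part of bar(a) a *)
Definition clnorm2 (a : Cl) : R := \sum_A (complex.Re (a A) ^+ 2 + complex.Im (a A) ^+ 2).

Definition Fn := 'rV[R]_d -> Cl.

Definition dirder (v : 'rV[R]_d) (f : Fn) (x : 'rV[R]_d) : Cl :=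
  [ffun A : {set 'I_d} => ('D_v (fun y => complex.Re (f y A)) x +i* 'D_v (fun y => complex.Im (f y A)) x)%C].

(* the difference quotient (f(x) - f(sigma_a x)) / <a,x>, extended by
   continuity (value 2/|a|^2 * d_a f(x)) on the hyperplane <a,x> = 0 *)
Definition dquot (a : 'rV[R]_d) (f : Fn) (x : 'rV[R]_d) : Cl :=
  if dotv a x != 0 then (((dotv a x)^-1)%:C)%C *: (f x - f (refl a x))
  else ((2 / dotv a a)%:C)%C *: dirder a f x.

Section Dunkl.
Context (Rp : seq 'rV[R]_d) (kappa : 'rV[R]_d -> R).

Definition dunklT (i : 'I_d) (f : Fn) (x : 'rV[R]_d) : Cl :=
  dirder (unitv i) f x + \sum_(a <- Rp) ((kappa a * a 0 i)%:C)%C *: dquot a f x.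

Definition dunkl_dirac (f : Fn) (x : 'rV[R]_d) : Cl :=
  \sum_i clmul (clbasis i) (dunklT i f x).

Definition Dplus (f : Fn) (x : 'rV[R]_d) : Cl :=
  dunkl_dirac f x - 2 *: clmul (clvec x) (f x).

Definition Hfun (s : nat) (P : Fn) : Fn := iter s Dplus P.

Definition hom_poly (n : nat) (P : Fn) : Prop :=
  exists c : {ffun 'I_d -> 'I_n.+1} -> Cl, forall x,
    P x = \sum_(al : {ffun 'I_d -> 'I_n.+1} | (\sum_i (al i : nat))%N == n)
            ((\prod_i x 0 i ^+ al i)%:C)%C *: c al.

Definition Mn (n : nat) (P : Fn) : Prop :=
  hom_poly n P /\ forall x, dunkl_dirac P x = 0.

Definition gamma_k : R := \sum_(a <- Rp) kappa a.
Definition mu : R := 2 * gamma_k + d%:R.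

Definition h_k (x : 'rV[R]_d) : R := \prod_(a <- Rp) (`|dotv a x| `^ kappa a).
(* weight h_k^2(x) e^{x^2} = h_k^2(x) e^{-|x|^2} *)
Definition weight (x : 'rV[R]_d) : R := h_k x ^+ 2 * expR (- norm2 x).

End Dunkl.

(* ---------- Lebesgue integration over R^d (iterated, Fubini/Tonelli) ---- *)
Definition upd (x : nat -> R) (k : nat) (t : R) : nat -> R :=
  fun j => if j == k then t else x j.

Fixpoint iint (k : nat) (G : (nat -> R) -> \bar R) (x : nat -> R) : \bar R :=
  match k with
  | 0 => G x
  | k'.+1 => (\int[@lebesgue_measure R]_t iint k' G (upd x k' t))%E
  end.

Definition rv_of (x : nat -> R) : 'rV[R]_d := \row_i x i.

Definition intRd (g : 'rV[R]_d -> \bar R) : \bar R :=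
  iint d (fun x => g (rv_of x)) (fun _ => 0).

Definition cl_int (f : Fn) : Cl :=
  [ffun A : {set 'I_d} => (fine (intRd (fun x => (complex.Re (f x A))%:E))
              +i* fine (intRd (fun x => (complex.Im (f x A))%:E)))%C].

(* surface measure on S^{d-1}, via the cone (polar-coordinate) formula
   \int_{S^{d-1}} F dSigma = d * \int_{0<|x|<=1} F(x/|x|) dx *)
Definition sph_int (F : Fn) : Cl :=
  (d%:R%:C)%C *: cl_int (fun x => if (0 < norm2 x <= 1) then
                                   F ((Num.sqrt (norm2 x))^-1 *: x) else 0).

Definition Gamma (x : R) : R :=
  fine (\int[@lebesgue_measure R]_(t in [set t : R | (0 < t)%R])
          ((t `^ (x - 1)) * expR (- t))%R%:E)%E.

Definition sphere_area : R := 2 * pi `^ (d%:R / 2) / Gamma (d%:R / 2).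

Section Spaces.
Context (Rp : seq 'rV[R]_d) (kappa : 'rV[R]_d -> R).

Definition sph_ip (f g : Fn) : Cl :=
  ((sphere_area^-1)%:C)%C *:
    sph_int (fun w => ((h_k Rp kappa w ^+ 2)%:C)%C *: clmul (clconj (f w)) (g w)).

Definition ipH (f g : Fn) : Cl :=
  cl_int (fun x => ((weight Rp kappa x)%:C)%C *: clmul (clconj (f x)) (g x)).

Definition L2norm2 (f : Fn) : \bar R :=
  intRd (fun x => (weight Rp kappa x * clnorm2 (f x))%:E).

(* Borel measurability on R^d (product sigma-algebra on d-tuples) *)
Definition cl_measurable (f : Fn) : Prop :=
  forall A : {set 'I_d},
    measurable_fun setT (fun t : d.-tuple R => complex.Re (f (\row_i tnth t i) A)) /\
    measurable_fun setT (fun t : d.-tuple R => complex.Im (f (\row_i tnth t i) A)).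

Definition inL2 (f : Fn) : Prop := cl_measurable f /\ (L2norm2 f < +oo)%E.

Definition gamma_smn (s n : nat) : R :=
  let m := mu Rp kappa in
  if odd s then
    4 ^+ s * (s.-1./2)`!%:R * pi `^ (d%:R / 2)
      * Gamma ((s%:R + m + 1) / 2 + n%:R) / Gamma (d%:R / 2)
  else
    4 ^+ s * (s./2)`!%:R * pi `^ (d%:R / 2)
      * Gamma ((s%:R + m) / 2 + n%:R) / Gamma (d%:R / 2).

End Spaces.

Definition root_system (Rs : seq 'rV[R]_d) : Prop :=
  [/\ uniq Rs, 0 \notin Rs,
      (forall a b, a \in Rs -> b \in Rs -> refl a b \in Rs) &
      (forall a (c : R), a \in Rs -> c *: a \in Rs -> c = 1 \/ c = -1)].

Definition positive_subsystem (Rs Rp : seq 'rV[R]_d) : Prop :=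
  exists beta : 'rV[R]_d,
    [/\ forall a, a \in Rs -> dotv a beta != 0, uniq Rp &
        forall a, (a \in Rp) = (a \in Rs) && (0 < dotv a beta)].

(* the element sigma_{b1} o ... o sigma_{bk} of the reflection group W *)
Definition refl_word (bs : seq 'rV[R]_d) (x : 'rV[R]_d) : 'rV[R]_d :=
  foldr refl x bs.

Definition multiplicity (Rs : seq 'rV[R]_d) (kappa : 'rV[R]_d -> R) : Prop :=
  (forall a, a \in Rs -> 0 <= kappa a) /\
  (forall bs a, all (fun b => b \in Rs) bs -> a \in Rs ->
     kappa (refl_word bs a) = kappa a).

End CliffordDunkl.

(* Main.v *)
Require Import Defs.
From HB Require Import structures.
From mathcomp Require Import all_boot all_order all_algebra.
From mathcomp Require Import all_classical all_reals all_analysis.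
From mathcomp Require Import measurable_realfun complex zify ring lra.
Set Implicit Arguments. Unset Strict Implicit. Unset Printing Implicit Defensive.
Import Order.TTheory GRing.Theory Num.Theory numFieldNormedType.Exports.
Local Open Scope classical_set_scope.
Local Open Scope ring_scope.

(* The raising operator D_+ = D - 2x is the adjoint of D for the weight h_k^2 e^{-|x|^2}
   (reflection invariance of the weight and integration by parts), and on polynomials
   Dx + xD = -(2E + mu) with E the Euler operator. Hence [D, D_+^2] = 4 D_+, so that
   D D_+^s P = c_s D_+^(s-1) P on M_n with explicit c_s: this gives orthogonality in s and the
   quotients of consecutive norms. Different degrees n are orthogonal since both (2n + mu)(P, Q)
   and (2m + mu)(P, Q) equal 2 (xP, xQ); within one degree polar coordinates reduce the inner
   product to the one on the sphere. For completeness, every polynomial is a sum of x^s P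
   (Fischer decomposition), hence of D_+^s P, and polynomials are dense in L^2: the bounded
   multipliers of their closure form an algebra closed under bounded limits that contains
   a Gaussian times each coordinate, hence indicators of Borel sets. *)

(** * Iterated Lebesgue integrals *)

(** The weight need not be differentiable on the reflection hyperplanes, as [kappa] takes arbitrary
    nonnegative values. Integration by parts is done with the smooth factors (<a,x>^2 + e)^kappa(a),
    and e tends to 0. Their derivatives bring in <a,x> / (<a,x>^2 + e), which is not uniformly
    bounded in e; but it is odd under the reflection in a, so under the integral the product f g in
    front of it can be replaced by a multiple of <a,x>, and <a,x>^2 / (<a,x>^2 + e) is at most 1.
    This replacement is also what produces the difference quotients of the Dunkl operators. Since
    [intRd] is an iterated integral and [fine] gives infinite values a default, every signed
    integrand is kept under a Gaussian. Reflections and dilations are composed of affine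
    substitutions in one coordinate. The sphere enters through the cone formula only, so polar
    coordinates need no surface measure: dilations determine the mass of all balls from that of the
    unit ball, and exchanging two integrals turns this into both the Gaussian integral and the
    integral over the cone. *)

Section tuple_measure.
Context {R : realType}.
Local Notation leb := (@lebesgue_measure R).

Definition snoc (k : nat) (p : k.-tuple R * measurableTypeR R) : k.+1.-tuple R :=
  [tuple of rcons p.1 p.2].

Lemma tnth_snoc_max k (p : k.-tuple R * measurableTypeR R) : tnth (snoc p) ord_max = p.2.
Proof. by rewrite (tnth_nth 0) /= nth_rcons size_tuple ltnn eqxx. Qed.

Lemma tnth_snoc_widen k (p : k.-tuple R * measurableTypeR R) (i : 'I_k.+1) (ik : (i < k)%N) :
  tnth (snoc p) i = tnth p.1 (Ordinal ik).
Proof. by rewrite !(tnth_nth 0) /= nth_rcons size_tuple ik. Qed.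

Lemma measurable_snoc k : @measurable_fun _ _
  (k.-tuple R * measurableTypeR R)%type (k.+1.-tuple R) setT (@snoc k).
Proof.
apply/measurable_fun_tnthP => i.
have [ik|ki] := ltnP i k.
  rewrite (_ : _ \o _ = (fun t : k.-tuple R => tnth t (Ordinal ik)) \o fst); last first.
    by apply/funext => p /=; rewrite tnth_snoc_widen.
  by apply: measurableT_comp => //; exact: measurable_tnth.
have -> : i = ord_max by apply/val_inj/eqP; rewrite /= eqn_leq ki -ltnS ltn_ord.
rewrite (_ : _ \o _ = snd) //.
by apply/funext => p /=; rewrite tnth_snoc_max.
Qed.

Section step.
Context (k : nat) (m : {sigma_finite_measure set (k.-tuple R) -> \bar R}).

Definition snoc_measure : set (k.+1.-tuple R) -> \bar R :=
  pushforward (m \x leb)%E (@snoc k).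

Let pm : {measure set (k.+1.-tuple R) -> \bar R} :=
  measure_function_pushforward__canonical__measure_function_Measure
    (m \x leb)%E (@measurable_snoc k).

Let snoc0 : snoc_measure set0 = 0%E.
Proof. exact: (measure0 pm). Qed.

Let snoc_ge0 A : (0 <= snoc_measure A)%E.
Proof. exact: (measure_ge0 pm). Qed.

Let snoc_additive : semi_sigma_additive snoc_measure.
Proof. exact: (@measure_semi_sigma_additive _ _ _ pm). Qed.

HB.instance Definition _ := isMeasure.Build _ _ _
  snoc_measure snoc0 snoc_ge0 snoc_additive.

(** The cylinder over A and B pulls back along [snoc] to the rectangle A x B. Rectangles of two
    exhausting sequences then witness sigma-finiteness. *)
Lemma snoc_measure_setX (A : set (k.-tuple R)) (B : set R) :
  measurable A -> measurable B ->
  measurable [set t : k.+1.-tuple R |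
     A [tuple tnth t (widen_ord (leqnSn k) i) | i < k] /\ B (tnth t ord_max)] /\
  snoc_measure [set t : k.+1.-tuple R |
     A [tuple tnth t (widen_ord (leqnSn k) i) | i < k] /\ B (tnth t ord_max)] =
  (m A * leb B)%E.
Proof.
move=> mA mB; split.
  apply: measurableI.
    rewrite -[X in measurable X]setTI.
    have : measurable_fun setT (fun t : k.+1.-tuple R =>
        [tuple tnth t (widen_ord (leqnSn k) i) | i < k]).
      apply/measurable_fun_tnthP => i.
      rewrite (_ : _ \o _ = fun t : k.+1.-tuple R =>
          tnth t (widen_ord (leqnSn k) i)); first exact: measurable_tnth.
      by apply/funext => t /=; rewrite tnth_mktuple.
    by apply.
  rewrite -[X in measurable X]setTI.
  by apply: (@measurable_tnth _ R k.+1 ord_max).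
rewrite -product_measure1E // /snoc_measure /pushforward.
congr (_ _); apply/seteqP; split => [[t x]|[t x]] /=.
  rewrite tnth_snoc_max; set t' := [tuple _ | _ < _].
  suff -> : t' = t by [].
  apply: eq_from_tnth => i; rewrite tnth_mktuple.
  by rewrite (tnth_snoc_widen _ (ltn_ord i : widen_ord _ i < k)%N); congr tnth; apply/val_inj.
rewrite tnth_snoc_max; set t' := [tuple _ | _ < _].
suff -> : t' = t by [].
apply: eq_from_tnth => i; rewrite tnth_mktuple.
by rewrite (tnth_snoc_widen _ (ltn_ord i : widen_ord _ i < k)%N); congr tnth; apply/val_inj.
Qed.

Let snoc_sigma_finite : sigma_finite setT snoc_measure.
Proof.
have /sigma_finiteP[F [UF ndF mF]] := sigma_finiteT m.
have /sigma_finiteP[G [UG ndG mG]] := sigma_finiteT leb.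
exists (fun n => [set t : k.+1.-tuple R |
     F n [tuple tnth t (widen_ord (leqnSn k) i) | i < k] /\ G n (tnth t ord_max)]).
  apply/esym; rewrite -subTset => t _.
  set t' := [tuple tnth t (widen_ord (leqnSn k) i) | i < k].
  have : setT t' by [].
  rewrite UF => -[a _ Fa].
  have : (setT : set R) (tnth t ord_max) by [].
  rewrite UG => -[b _ Gb].
  exists (maxn a b) => //=; split.
    by have /subsetPset := ndF _ _ (leq_maxl a b); apply.
  by have /subsetPset := ndG _ _ (leq_maxr a b); apply.
move=> n; have [mFn Fy] := mF n; have [mGn Gy] := mG n.
have [mFG ->] := snoc_measure_setX mFn mGn; split => //.
by rewrite lte_mul_pinfty // ge0_fin_numE.
Qed.

HB.instance Definition _ := Measure_isSigmaFinite.Build _ _ _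
  snoc_measure snoc_sigma_finite.

End step.

(* The last coordinate is adjoined by [snoc] so as to follow the recursion of [iint]. *)
Fixpoint tuple_measure (k : nat) : {sigma_finite_measure set (k.-tuple R) -> \bar R} :=
  match k with
  | 0 => dirac [tuple]
  | k'.+1 => snoc_measure (tuple_measure k')
  end.

Lemma ge0_integral_tuple0 (f : 0.-tuple R -> \bar R) :
  measurable_fun setT f ->
  (\int[tuple_measure 0]_t f t = f [tuple])%E.
Proof. by move=> mf; rewrite /= integral_dirac // diracT mul1e. Qed.

Lemma ge0_integral_tupleS k (f : k.+1.-tuple R -> \bar R) :
  measurable_fun setT f -> (forall t, 0 <= f t)%E ->
  (\int[tuple_measure k.+1]_t f t =
   \int[leb]_x \int[tuple_measure k]_t f (snoc (t, x)))%E.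
Proof.
move=> mf f0.
rewrite -[LHS]/(\int[pushforward (tuple_measure k \x leb)%E (@snoc k)]_t f t)%E.
rewrite (ge0_integral_pushforward (@measurable_snoc k)) //.
rewrite preimage_setT (fubini_tonelli2 (f \o @snoc k)) //.
  by apply: measurableT_comp => //; exact: measurable_snoc.
by move=> t /=.
Qed.

Lemma measurable_snoc1 k (x : R) : measurable_fun setT (fun t : k.-tuple R => snoc (t, x)).
Proof. by apply: (measurableT_comp (@measurable_snoc k)); exact: pair2_measurable. Qed.

Lemma measurable_snoc2 k (t : k.-tuple R) : measurable_fun setT (fun x : measurableTypeR R => snoc (t, x)).
Proof. by apply: (measurableT_comp (@measurable_snoc k)); exact: pair1_measurable. Qed.

Lemma tnth_snocE k (t : k.-tuple R) x (i : 'I_k) : tnth (snoc (t, x)) (widen_ord (leqnSn k) i) = tnth t i.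
Proof.
rewrite (tnth_snoc_widen _ (ltn_ord i : widen_ord (leqnSn k) i < k)%N) /=.
by congr tnth; apply/val_inj.
Qed.

(** The integral factors over the coordinates. Products of this kind are the majorants for Fubini in
    [iintE]. *)
Lemma ge0_integral_prod_tuple (phi : R -> R) (k : nat) :
  measurable_fun setT phi -> (forall x, 0 <= phi x) ->
  (\int[leb]_x (phi x)%:E < +oo)%E ->
  (\int[tuple_measure k]_t (\prod_(i < k) phi (tnth t i))%:E < +oo)%E.
Proof.
move=> mphi phi0 phioo.
have mprod n : measurable_fun setT (fun t : n.-tuple R => \prod_(i < n) phi (tnth t i)).
  apply: measurable_prod => i _; apply: measurableT_comp => //; exact: measurable_tnth.
have mprodE n : measurable_fun setT (fun t : n.-tuple R => (\prod_(i < n) phi (tnth t i))%:E).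
  by apply/measurable_EFinP; exact: mprod.
elim: k => [|k IH].
  rewrite ge0_integral_tuple0; first by rewrite big_ord0 ltry.
  exact: mprodE.
rewrite ge0_integral_tupleS; last 2 first.
- exact: mprodE.
- by move=> t; rewrite lee_fin prodr_ge0.
under eq_integral.
  move=> x _.
  under eq_integral.
    move=> t _; rewrite big_ord_recr /= tnth_snoc_max /= mulrC EFinM.
    under eq_bigr do rewrite tnth_snocE.
    over.
  rewrite ge0_integralZl_EFin //; last 2 first.
    by move=> t _; rewrite lee_fin prodr_ge0.
    exact: mprodE.
  over.
rewrite ge0_integralZr //; last 3 first.
- exact/measurable_EFinP.
- by move=> x _; rewrite lee_fin.
- by apply: integral_ge0 => t _; rewrite lee_fin prodr_ge0.
rewrite lte_mul_pinfty // ?ge0_fin_numE //;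
  by apply: integral_ge0 => t _; rewrite lee_fin.
Qed.

(** The argument at which [iint k] evaluates its integrand: the integration variables fill the
    places below k, and the default of [nth] keeps the values of x at all other places. *)
Definition overwrite k (t : k.-tuple R) (x : nat -> R) : nat -> R :=
  fun j => nth (x j) t j.

Lemma overwrite_snoc k (t : k.-tuple R) s x :
  overwrite (snoc (t, s)) x = overwrite t (upd x k s).
Proof.
apply/funext => j; rewrite /overwrite /snoc /upd /= nth_rcons size_tuple.
have [jk|jk|->] := ltngtP j k => //.
- by rewrite [in RHS]nth_default // size_tuple ltnW.
- by rewrite [in RHS]nth_default // size_tuple.
Qed.

Lemma ge0_iintE k (G : (nat -> R) -> \bar R) x :
  measurable_fun setT (fun t : k.-tuple R => G (overwrite t x)) ->
  (forall y, 0 <= G y)%E ->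
  iint k G x = (\int[tuple_measure k]_t G (overwrite t x))%E.
Proof.
move=> + G0; elim: k x => [|k IH] x mG.
  rewrite ge0_integral_tuple0 //=; congr G; apply/funext => j.
  by rewrite /overwrite nth_nil.
rewrite /= ge0_integral_tupleS //; apply: eq_integral => s _.
rewrite IH.
  by apply: eq_integral => t _; rewrite overwrite_snoc.
under eq_fun do rewrite -overwrite_snoc.
by apply: (measurableT_comp mG); exact: measurable_snoc1.
Qed.

(** For a signed integrand Fubini needs integrability at every stage of the iteration. A product
    majorant survives freezing the last coordinate at s: the factor [phi s] is absorbed by the
    constant, which is why C is generalized in the induction. *)
Lemma iintE k (phi : R -> R) (C : R) (G : (nat -> R) -> R) x :
  measurable_fun setT phi -> (forall x, 0 <= phi x) ->
  (\int[leb]_x (phi x)%:E < +oo)%E ->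
  measurable_fun setT (fun t : k.-tuple R => G (overwrite t x)) ->
  (forall t : k.-tuple R, `|G (overwrite t x)| <= C * \prod_(i < k) phi (tnth t i)) ->
  iint k (fun y => (G y)%:E) x = (\int[tuple_measure k]_t (G (overwrite t x))%:E)%E.
Proof.
move=> mphi phi0 phioo; elim: k C x => [|k IH] C x mG GC.
  rewrite ge0_integral_tuple0 //=; last exact/measurable_EFinP.
  by congr ((G _)%:E); apply/funext => j; rewrite /overwrite nth_nil.
have intG : (tuple_measure k.+1).-integrable setT
    (fun t : k.+1.-tuple R => (G (overwrite t x))%:E).
  apply: (@le_integrable _ _ _ _ _ _ _
     (fun t : k.+1.-tuple R => (C * \prod_(i < k.+1) phi (tnth t i))%:E)) => //.
  - exact/measurable_EFinP.
  - move=> t _ /=; rewrite lee_fin (le_trans (GC t)) // ler_norm //.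
  under eq_fun do rewrite EFinM.
  apply: integrableZl => //; apply/integrableP; split.
    apply/measurable_EFinP; apply: measurable_prod => i _.
    by apply: measurableT_comp => //; exact: measurable_tnth.
  under eq_integral do rewrite gee0_abs ?lee_fin ?prodr_ge0 //.
  exact: ge0_integral_prod_tuple.
have mGE : measurable_fun setT (fun t : k.+1.-tuple R => (G (overwrite t x))%:E).
  exact/measurable_EFinP.
have intGs : ((tuple_measure k) \x leb)%E.-integrable setT
    (fun p => (G (overwrite (@snoc k p) x))%:E).
  apply/integrableP; split; first exact: (measurableT_comp mGE (@measurable_snoc k)).
  move/integrableP : intG => [_].
  rewrite -[X in (X < _)%E -> _]/(\int[pushforward (tuple_measure k \x leb)%E (@snoc k)]_t _)%E.
  rewrite (ge0_integral_pushforward (@measurable_snoc k)) ?preimage_setT //.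
  exact: measurableT_comp.
rewrite -[RHS]/(\int[pushforward (tuple_measure k \x leb)%E (@snoc k)]_t _)%E.
rewrite integral_pushforward //; last exact: measurable_snoc.
rewrite preimage_setT -integral21_prod_meas1 //=.
apply: eq_integral => s _; rewrite (IH (C * phi s)).
- by apply: eq_integral => t _; rewrite -overwrite_snoc.
- under eq_fun do rewrite -overwrite_snoc.
  by apply: (measurableT_comp mG); exact: measurable_snoc1.
- move=> t; rewrite -overwrite_snoc (le_trans (GC _)) //.
  rewrite big_ord_recr /= tnth_snoc_max /=.
  under eq_bigr do rewrite tnth_snocE.
  by rewrite -mulrA [phi s * _]mulrC.
Qed.

(** The pushforward of Lebesgue measure along the affine map, multiplied by |c|, has the right value
    on half-open intervals, and these determine Lebesgue measure. For c < 0 the preimage is closed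
    at the other end, with the same length. *)
Lemma ge0_integral_affine (c b : R) (f : R -> \bar R) : c != 0 ->
  measurable_fun setT f -> (forall x, 0 <= f x)%E ->
  (\int[leb]_x f x = `|c|%:E * \int[leb]_x f (c * x + b)%R)%E.
Proof.
move=> c0 mf f0.
have maff : measurable_fun setT (fun x : measurableTypeR R => c * x + b : measurableTypeR R).
  by apply: (@measurable_funD _ (measurableTypeR R)) => //; exact: measurable_funM.
have cge0 : 0 <= `|c| by [].
pose pm : {measure set (measurableTypeR R) -> \bar R} :=
   measure_function_pushforward__canonical__measure_function_Measure leb maff.
pose mm : {measure set (measurableTypeR R) -> \bar R} :=
  mscale (NngNum cge0) pm.
rewrite (@eq_measure_integral _ _ _ _ mm) /=; last first.
  move=> A mA _; apply: lebesgue_measure_unique => // _ [[u v] _ <-].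
  rewrite /mm /= /mscale /= /pushforward /=.
  have [cp|cn|c0'] := ltgtP c 0; last by rewrite c0' eqxx in c0.
    have -> : (fun x : measurableTypeR R => (c * x + b)%R) @^-1` `]u, v] =
       `[(v - b) / c, (u - b) / c[%classic.
      apply/seteqP; split => y /=; rewrite !in_itv /=.
        by rewrite ler_ndivrMr // ltr_ndivlMr // lerBrDr ltrBlDr [y * c]mulrC => /andP[-> ->].
      by rewrite ler_ndivrMr // ltr_ndivlMr // lerBrDr ltrBlDr [y * c]mulrC => /andP[-> ->].
    rewrite !lebesgue_measure_itv /= !lte_fin ltr_nM2r ?invr_lt0 // ltrD2r.
    case: ifP => _; last by rewrite mule0.
    rewrite -!EFinD -EFinM ltr0_norm //; congr EFin; field.
    by rewrite lt_eqF.
  have -> : (fun x : measurableTypeR R => (c * x + b)%R) @^-1` `]u, v] =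
     `](u - b) / c, (v - b) / c]%classic.
    apply/seteqP; split => y /=; rewrite !in_itv /=.
      by rewrite ler_pdivlMr // ltr_pdivrMr // lerBrDr ltrBlDr [y * c]mulrC => /andP[-> ->].
    by rewrite ler_pdivlMr // ltr_pdivrMr // lerBrDr ltrBlDr [y * c]mulrC => /andP[-> ->].
  rewrite !lebesgue_measure_itv /= !lte_fin ltr_pM2r ?invr_gt0 // ltrD2r.
  case: ifP => _; last by rewrite mule0.
  rewrite -!EFinD -EFinM gtr0_norm //; congr EFin; field.
  by rewrite gt_eqF.
rewrite ge0_integral_mscale //; congr (_ * _)%E.
by rewrite (ge0_integral_pushforward maff).
Qed.

Definition set_tnth k (i : 'I_k) (t : k.-tuple R) (v : R) : k.-tuple R :=
  [tuple if j == i then v else tnth t j | j < k].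

Lemma measurable_set_tnth d (T : measurableType d) k (i : 'I_k) (f : T -> k.-tuple R) (g : T -> R) :
  measurable_fun setT f -> measurable_fun setT g ->
  measurable_fun setT (fun x => set_tnth i (f x) (g x)).
Proof.
move=> mf mg; apply/measurable_fun_tnthP => j.
rewrite (_ : _ \o _ = if j == i then g else fun x => tnth (f x) j); last first.
  by apply/funext => x /=; rewrite tnth_mktuple; case: eqP.
case: eqP => // _.
by apply: (@measurableT_comp _ _ _ _ _ _ (fun t : k.-tuple R => tnth t j)) => //; exact: measurable_tnth.
Qed.

Lemma set_tnth_max k (t : k.-tuple R) (s v : R) :
  set_tnth ord_max (snoc (t, s)) v = snoc (t, v).
Proof.
apply: eq_from_tnth => j; rewrite tnth_mktuple; case: eqP => [->|jm].
  by rewrite tnth_snoc_max.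
have jk : (j < k)%N.
  rewrite ltn_neqAle -ltnS ltn_ord andbT; apply/eqP => e.
  by apply: jm; apply/val_inj.
by rewrite !(tnth_snoc_widen _ jk).
Qed.

Lemma set_tnth_widen k (i : 'I_k) (t : k.-tuple R) (s v : R) :
  set_tnth (widen_ord (leqnSn k) i) (snoc (t, s)) v = snoc (set_tnth i t v, s).
Proof.
apply: eq_from_tnth => j; rewrite tnth_mktuple.
have [jk|kj] := ltnP j k.
  rewrite !(tnth_snoc_widen _ jk) /= tnth_mktuple.
  by rewrite -(inj_eq val_inj) /= -[in RHS](inj_eq val_inj).
have -> : j = ord_max by apply/val_inj/eqP; rewrite /= eqn_leq kj -ltnS ltn_ord.
rewrite !tnth_snoc_max -(inj_eq val_inj) /= ifN //.
by rewrite gtn_eqF.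
Qed.

(** The shift may depend on the other coordinates, which are frozen when coordinate i is integrated.
    If i is not the last coordinate, the induction hypothesis applies under the outer integral; if
    it is, Tonelli makes it the innermost one. *)
Lemma ge0_integral_tuple_affine k (i : 'I_k) (c : R) (phi : k.-tuple R -> R)
    (f : k.-tuple R -> \bar R) : c != 0 ->
  measurable_fun setT phi -> (forall t v, phi (set_tnth i t v) = phi t) ->
  measurable_fun setT f -> (forall t, 0 <= f t)%E ->
  (\int[tuple_measure k]_t f t =
   `|c|%:E * \int[tuple_measure k]_t f (set_tnth i t (c * tnth t i + phi t)%R))%E.
Proof.
move=> c0; elim: k i phi f => [[]//|k IH] i phi f mphi phii mf f0.
have mfi : measurable_fun setT
    (fun t : k.+1.-tuple R => f (set_tnth i t (c * tnth t i + phi t))).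
  apply: (measurableT_comp mf); apply: measurable_set_tnth => //.
  by apply: measurable_funD => //; apply: measurable_funM => //; exact: measurable_tnth.
rewrite !ge0_integral_tupleS //.
have [ik|ki] := ltnP i k.
  have -> : i = widen_ord (leqnSn k) (Ordinal ik) by exact/val_inj.
  rewrite -ge0_integralZl_EFin //; last 2 first.
  - by move=> s _; exact: integral_ge0.
  - apply: (measurable_fun_fubini_tonelli_G (fun p => f (set_tnth (widen_ord (leqnSn k) (Ordinal ik)) (@snoc k p)
        (c * tnth (@snoc k p) (widen_ord (leqnSn k) (Ordinal ik)) + phi (@snoc k p))))) => //.
    have -> : widen_ord (leqnSn k) (Ordinal ik) = i by exact/val_inj.
    exact: (measurableT_comp mfi (@measurable_snoc k)).
  apply: eq_integral => s _.
  rewrite (IH (Ordinal ik) (fun t => phi (snoc (t, s))) (fun t => f (snoc (t, s)))) //.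
  - by congr (_ * _)%E; apply: eq_integral => t _; rewrite set_tnth_widen tnth_snocE.
  - by apply: (measurableT_comp mphi); exact: measurable_snoc1.
  - move=> t v; rewrite -set_tnth_widen (_ : widen_ord _ _ = i) //; exact/val_inj.
  - by apply: (measurableT_comp mf); exact: measurable_snoc1.
have -> : i = ord_max by apply/val_inj/eqP; rewrite /= eqn_leq ki -ltnS ltn_ord.
rewrite -(fubini_tonelli (fun p => f (@snoc k p))) //; last first.
  exact: (measurableT_comp mf (@measurable_snoc k)).
rewrite -(fubini_tonelli (fun p => f (set_tnth ord_max (@snoc k p) (c * tnth (@snoc k p) ord_max + phi (@snoc k p))))) //; last first.
  have <- : i = ord_max by apply/val_inj/eqP; rewrite /= eqn_leq ki -ltnS ltn_ord.
  exact: (measurableT_comp mfi (@measurable_snoc k)).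
rewrite -ge0_integralZl_EFin //; last 2 first.
- by move=> s _; exact: integral_ge0.
- apply: (measurable_fun_fubini_tonelli_F (fun p => f (set_tnth ord_max (@snoc k p) (c * tnth (@snoc k p) ord_max + phi (@snoc k p))))) => //.
  have <- : i = ord_max by apply/val_inj/eqP; rewrite /= eqn_leq ki -ltnS ltn_ord.
  exact: (measurableT_comp mfi (@measurable_snoc k)).
apply: eq_integral => t _.
rewrite (ge0_integral_affine (phi (snoc (t, 0))) c0) //; last first.
  by apply: (measurableT_comp mf); exact: measurable_snoc2.
congr (_ * _)%E; apply: eq_integral => s _; rewrite tnth_snoc_max set_tnth_max /=.
rewrite (_ : phi (snoc (t, s)) = phi (snoc (t, 0))) //.
rewrite -(phii _ 0) (_ : i = ord_max) ?set_tnth_max //.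
by apply/val_inj/eqP; rewrite /= eqn_leq ki -ltnS ltn_ord.
Qed.

End tuple_measure.

(** * Integrals of functions of row vectors and changes of variables *)

Section rv_integral.
Context {R : realType} {d : nat}.
Local Notation V := 'rV[R]_d.
Local Notation leb := (@lebesgue_measure R).
Local Notation mu := (@tuple_measure R d).

Definition tv (t : d.-tuple R) : V := \row_i tnth t i.

Definition vt (x : V) : d.-tuple R := [tuple x 0 i | i < d].

Lemma vtK : cancel vt tv.
Proof. by move=> x; apply/rowP => i; rewrite mxE tnth_mktuple. Qed.

Lemma rv_of_overwrite (t : d.-tuple R) x : rv_of d (overwrite t x) = tv t.
Proof.
apply/rowP => i; rewrite !mxE /overwrite (tnth_nth (x i)) //.
Qed.

(** Measurability is read through [tv], on the tuples where [tuple_measure] lives; this is also the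
    form of [cl_measurable]. *)
Definition vmeas (f : V -> R) := measurable_fun setT (fun t => f (tv t)).
Lemma eq_vmeas f g : f =1 g -> vmeas f -> vmeas g.
Proof. by move=> /funext ->. Qed.

Definition vemeas (f : V -> \bar R) := measurable_fun setT (fun t => f (tv t)).

Lemma vmeasE f : vmeas f -> vemeas (fun x => (f x)%:E).
Proof. by move=> mf; apply/measurable_EFinP. Qed.

Lemma vmeas_coord i : vmeas (fun x => x 0 i).
Proof.
rewrite /vmeas; under eq_fun do rewrite mxE.
exact: measurable_tnth.
Qed.

Lemma vmeas_cst c : vmeas (fun=> c).
Proof. exact: measurable_cst. Qed.

Lemma vmeasD f g : vmeas f -> vmeas g -> vmeas (fun x => f x + g x).
Proof. by move=> mf mg; apply: measurable_funD. Qed.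

Lemma vmeasB f g : vmeas f -> vmeas g -> vmeas (fun x => f x - g x).
Proof. by move=> mf mg; apply: measurable_funB. Qed.

Lemma vmeasM f g : vmeas f -> vmeas g -> vmeas (fun x => f x * g x).
Proof. by move=> mf mg; apply: measurable_funM. Qed.

Lemma vmeasX f n : vmeas f -> vmeas (fun x => f x ^+ n).
Proof. by move=> mf; apply: measurable_funX. Qed.

Lemma vmeas_sum I (s : seq I) (f : I -> V -> R) :
  (forall i, vmeas (f i)) -> vmeas (fun x => \sum_(i <- s) f i x).
Proof. by move=> mf; apply: measurable_sum. Qed.

Lemma vmeas_comp (g : R -> R) f :
  measurable_fun setT g -> vmeas f -> vmeas (fun x => g (f x)).
Proof. by move=> mg mf; apply: (measurableT_comp mg). Qed.

Lemma vmeas_dotv a : vmeas (dotv a).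
Proof. by apply: vmeas_sum => i; apply: vmeasM; [exact: vmeas_cst|exact: vmeas_coord]. Qed.

Lemma vmeas_norm2 : vmeas (@norm2 R d).
Proof. by apply: vmeas_sum => i; apply: vmeasM; exact: vmeas_coord. Qed.

Lemma measurable_vt (g : V -> V) : (forall i, vmeas (fun x => g x 0 i)) ->
  measurable_fun setT (fun t => vt (g (tv t))).
Proof.
move=> mg; apply/measurable_fun_tnthP => i.
rewrite (_ : _ \o _ = fun t => g (tv t) 0 i); first exact: mg.
by apply/funext => t /=; rewrite tnth_mktuple.
Qed.

Lemma vemeas_compv (f : V -> \bar R) (g : V -> V) :
  vemeas f -> (forall i, vmeas (fun x => g x 0 i)) -> vemeas (fun x => f (g x)).
Proof.
move=> mf /measurable_vt mg.
rewrite /vemeas (_ : (fun t => _) = (fun t => f (tv t)) \o (fun t => vt (g (tv t)))).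
  exact: measurableT_comp.
by apply/funext => t /=; rewrite vtK.
Qed.

Lemma vmeas_compv (f : V -> R) (g : V -> V) :
  vmeas f -> (forall i, vmeas (fun x => g x 0 i)) -> vmeas (fun x => f (g x)).
Proof.
move=> mf /measurable_vt mg.
rewrite /vmeas (_ : (fun t => _) = (fun t => f (tv t)) \o (fun t => vt (g (tv t)))).
  exact: measurableT_comp.
by apply/funext => t /=; rewrite vtK.
Qed.

Definition vint (f : V -> \bar R) : \bar R := (\int[mu]_t f (tv t))%E.

Lemma ge0_intRdE (f : V -> \bar R) : vemeas f -> (forall x, 0 <= f x)%E ->
  intRd f = vint f.
Proof.
move=> mf f0; rewrite /intRd ge0_iintE //.
  by apply: eq_integral => t _; rewrite rv_of_overwrite.
by under eq_fun do rewrite rv_of_overwrite.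
Qed.

(* [jacobian g c]: pushing Lebesgue measure forward along [g] multiplies it by [c]. *)
Definition jacobian (g : V -> V) (c : R) :=
  (forall i, vmeas (fun x => g x 0 i)) /\
  (forall f : V -> \bar R, vemeas f -> (forall x, 0 <= f x)%E ->
     vint (fun x => f (g x)) = (c%:E * vint f)%E).

Lemma jacobian_id : jacobian id 1.
Proof. by split=> [i|f mf f0]; [exact: vmeas_coord|rewrite mul1e]. Qed.

Lemma jacobian_comp g h b c : jacobian g b -> jacobian h c ->
  jacobian (g \o h) (c * b).
Proof.
move=> [mg Jg] [mh Jh]; split.
  by move=> i /=; apply: (@vmeas_compv (fun x => g x 0 i)).
move=> f mf f0 /=; rewrite (Jh (fun x => f (g x))) //; last exact: vemeas_compv.
by rewrite Jg // EFinM muleA.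
Qed.

Definition vset (x : V) (i : 'I_d) (v : R) : V :=
  \row_k if k == i then v else x 0 k.

Lemma vset_tnth i t v : vset (tv t) i v = tv (set_tnth i t v).
Proof. by apply/rowP => k; rewrite !mxE tnth_mktuple; case: eqP => //; rewrite mxE. Qed.

Lemma jacobian_vset i c (phi : V -> R) : c != 0 -> vmeas phi ->
  (forall x v, phi (vset x i v) = phi x) ->
  jacobian (fun x => vset x i (c * x 0 i + phi x)) (`|c|^-1).
Proof.
move=> c0 mphi phii; split.
  move=> k; apply: (@eq_vmeas (fun x => if k == i then c * x 0 i + phi x else x 0 k)).
    by move=> x; rewrite mxE.
  case: eqP => _; last exact: vmeas_coord.
  by apply: vmeasD => //; apply: vmeasM; [exact: vmeas_cst|exact: vmeas_coord].
move=> f mf f0; rewrite /vint.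
rewrite (@ge0_integral_tuple_affine _ _ i c (fun t => phi (tv t)) (fun t => f (tv t))) //.
  rewrite muleA -EFinM mulVf ?normr_eq0 // mul1e.
  by apply: eq_integral => t _; rewrite vset_tnth mxE.
by move=> t v; rewrite -vset_tnth phii.
Qed.

(** The coordinates of s are changed one at a time. The shifts only see coordinates outside s, so
    they do not notice the changes already made, and each change contributes one factor |c|^-1. *)
Lemma jacobian_shear (s : seq 'I_d) (c : R) (phi : 'I_d -> V -> R) :
  uniq s -> c != 0 -> (forall k, vmeas (phi k)) ->
  (forall k (x y : V), (forall l, l \notin s -> x 0 l = y 0 l) -> phi k x = phi k y) ->
  jacobian (fun x : V => \row_k if k \in s then c * x 0 k + phi k x else x 0 k)
           (`|c|^-1 ^+ size s).
Proof.
move=> us c0 mphi phis.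
(* Only the set of changed coordinates shrinks in the induction; the shifts stay independent of all
   of s. *)
suff H s' : uniq s' -> {subset s' <= s} -> jacobian
    (fun x : V => \row_k if k \in s' then c * x 0 k + phi k x else x 0 k) (`|c|^-1 ^+ size s').
  exact: H.
elim: s' => [_ _|k s' IH /= /andP[ks' us'] ss].
  rewrite expr0 (_ : (fun x => _) = id); first exact: jacobian_id.
  by apply/funext => x; apply/rowP => k; rewrite mxE.
have {}IH : jacobian (fun x : V => \row_k if k \in s' then c * x 0 k + phi k x else x 0 k) (`|c|^-1 ^+ size s').
  by apply: IH => // l ls; apply: ss; rewrite inE ls orbT.
have J : jacobian (fun x => vset x k (c * x 0 k + phi k x)) (`|c|^-1).
  apply: jacobian_vset => // x v; apply: phis => l ls; rewrite mxE.
  by case: eqP => // lk; rewrite lk ss ?mem_head in ls.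
have := jacobian_comp J IH; rewrite exprSr; congr (jacobian _ _).
apply/funext => x; apply/rowP => l; rewrite !mxE inE (negbTE ks').
case: eqP => [->|lk] //=; congr (_ + _); apply: phis => m ms; rewrite mxE ifN //.
by apply: contra ms => ms; apply: ss; rewrite inE ms orbT.
Qed.

Lemma jacobian_scale c : c != 0 -> jacobian (fun x => c *: x) (`|c|^-1 ^+ d).
Proof.
move=> c0.
have /(@jacobian_shear _ c (fun _ _ => 0) (enum_uniq 'I_d) c0) :
  (forall k : 'I_d, vmeas (fun _ => 0)) by move=> _; exact: vmeas_cst.
move=> /(_ (fun _ _ _ _ => erefl)); rewrite size_enum_ord; congr (jacobian _ _).
by apply/funext => x; apply/rowP => k; rewrite !mxE mem_enum addr0.
Qed.

Lemma jacobian_translate i (u : R) : jacobian (fun x => x + u *: unitv R i) 1.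
Proof.
have J : jacobian (fun x : V => \row_k if k \in [:: i] then 1 * x 0 k + u else x 0 k)
  (`|1|^-1 ^+ 1).
  by apply: (@jacobian_shear [:: i] 1 (fun _ _ => u)) => //; move=> _; exact: vmeas_cst.
move: J; rewrite normr1 invr1 expr1; congr (jacobian _ _).
apply/funext => x; apply/rowP => k; rewrite !mxE inE eqxx /=.
by case: eqP => [->|_]; rewrite ?mul1r ?mulr1 // mulr0 addr0.
Qed.

(** With a pivot j such that a_j != 0, the map [S] puts <a,x> in place of x_j. In these coordinates
    the reflection adds a multiple of coordinate j to each other coordinate ([N]) and changes the
    sign of coordinate j ([B]); [S'] undoes [S]. All four maps are shears, and the factors |a_j|^-1
    and |a_j| cancel. *)
Lemma jacobian_refl (a : V) : a != 0 -> jacobian (refl a) 1.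
Proof.
move=> a0.
have [j aj] : exists j, a 0 j != 0.
  apply/existsP; apply: contra_neqT a0; rewrite negb_exists => /forallP H.
  by apply/rowP => j; rewrite mxE; apply/eqP; have := H j; rewrite negbK.
have aa : dotv a a != 0.
  rewrite /dotv psumr_eq0; last by move=> i _; rewrite -expr2 sqr_ge0.
  apply/negP => /allP /(_ j); rewrite mem_index_enum => /(_ isT).
  by rewrite /= mulf_eq0 orbb (negbTE aj).
pose rest (x : V) := \sum_(l | l != j) a 0 l * x 0 l.
have mrest : vmeas rest.
  apply: (@eq_vmeas (fun x => dotv a x - a 0 j * x 0 j)).
    by move=> x; rewrite /dotv (bigD1 j) //= addrAC subrr add0r.
  by apply: vmeasB; [exact: vmeas_dotv|apply: vmeasM; [exact: vmeas_cst|exact: vmeas_coord]].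
have dE x : dotv a x = a 0 j * x 0 j + rest x by rewrite /dotv (bigD1 j).
have restE (x y : V) : (forall l, l \notin [:: j] -> x 0 l = y 0 l) -> rest x = rest y.
  by move=> xy; apply: eq_bigr => l lj; rewrite xy // inE.
pose S (x : V) : V := \row_k if k \in [:: j] then a 0 j * x 0 k + rest x else x 0 k.
have JS : jacobian S (`|a 0 j|^-1 ^+ 1).
  by apply: (@jacobian_shear [:: j] (a 0 j) (fun _ => rest)) => // _; exact: restE.
pose S' (x : V) : V := \row_k if k \in [:: j] then (a 0 j)^-1 * x 0 k + (- (a 0 j)^-1 * rest x) else x 0 k.
have JS' : jacobian S' (`|(a 0 j)^-1|^-1 ^+ 1).
  apply: (@jacobian_shear [:: j] (a 0 j)^-1 (fun _ x => - (a 0 j)^-1 * rest x)) => //.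
  - by rewrite invr_eq0.
  - by move=> _; apply: vmeasM => //; exact: vmeas_cst.
  - by move=> _ x y xy; rewrite (restE x y).
pose B (x : V) : V := \row_k if k \in [:: j] then -1 * x 0 k + 0 else x 0 k.
have JB : jacobian B (`|-1|^-1 ^+ 1).
  by apply: (@jacobian_shear [:: j] (-1) (fun _ _ => 0)) => //; move=> _; exact: vmeas_cst.
pose N (x : V) : V := \row_k if k \in [seq l <- enum 'I_d | l != j] then
      1 * x 0 k + (- (2 * a 0 k / dotv a a) * x 0 j) else x 0 k.
have JN : jacobian N (`|1|^-1 ^+ size ([seq l <- enum 'I_d | l != j])).
  apply: (@jacobian_shear _ 1 (fun k x => - (2 * a 0 k / dotv a a) * x 0 j)) => //.
  - by rewrite filter_uniq // enum_uniq.
  - by move=> k; apply: vmeasM; [exact: vmeas_cst|exact: vmeas_coord].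
  - by move=> k x y xy; rewrite xy // mem_filter /= eqxx.
have SK x : S' (S x) = x.
  apply/rowP => k; rewrite /S' mxE inE; have [->|kj] := eqVneq k j; last first.
    by rewrite mxE inE (negbTE kj).
  have -> : rest (S x) = rest x.
    by apply: restE => l lj; rewrite mxE (negbTE lj).
  by rewrite mxE inE eqxx; field.
have Sj x : S x 0 j = dotv a x by rewrite mxE inE eqxx -dE.
have Sk x k : k != j -> S x 0 k = x 0 k by move=> kj; rewrite mxE inE (negbTE kj).
have dr x : dotv a (refl a x) = - dotv a x.
  transitivity (dotv a x - 2 * dotv a x / dotv a a * dotv a a); last by field.
  rewrite /dotv mulr_sumr -sumrB; apply: eq_bigr => l _.
  by rewrite !mxE mulrBr mulrCA.
have BNS x : B (N (S x)) = S (refl a x).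
  apply/rowP => k; rewrite /B mxE inE; have [->|kj] := eqVneq k j.
    by rewrite Sj dr /N mxE mem_filter eqxx /= Sj addr0 mulN1r.
  rewrite Sk // /N mxE mem_filter kj mem_enum /= Sj Sk // !mxE mul1r mulNr; congr (_ - _).
  by ring.
have := jacobian_comp JS' (jacobian_comp JB (jacobian_comp JN JS)).
rewrite !normr1 !normrN1 !invr1 !expr1n !mulr1 !expr1 normfV invrK mulVf ?normr_eq0 //.
by congr (jacobian _ _); apply/funext => x /=; rewrite BNS SK.
Qed.

End rv_integral.

(** * Functions dominated by a Gaussian *)

Section tame.
Context {R : realType} {d : nat}.
Local Notation V := 'rV[R]_d.
Local Notation leb := (@lebesgue_measure R).
Local Notation mu := (@tuple_measure R d).

(** One coordinate of the Gaussian that defines [tame]. The rate 1/16 is what remains of the rate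
    1/8 of [bounded8] after a translation of length at most 1. *)
Definition bump (y : R) : R := expR (- (y ^+ 2 / 16)).

Lemma measurable_bump : measurable_fun setT bump.
Proof.
apply: measurableT_comp; first exact: measurable_expR.
by apply: measurableT_comp => //; apply: measurable_funM => //; exact: measurable_funX.
Qed.

Lemma integral_bump : (\int[leb]_x (bump x)%:E < +oo)%E.
Proof.
have := @integralT_gauss R.
rewrite (@ge0_integral_affine R (4^-1) 0) //=.
- under eq_integral.
    move=> x _.
    rewrite (_ : gauss_fun _ = bump x); last first.
      by rewrite /gauss_fun /bump; congr expR; field.
    over.
  move=> E; rewrite ltey; apply: contra_eqN E => /eqP ->.
  by rewrite gt0_muley // lte_fin normr_gt0.
- by apply/measurable_EFinP; exact: measurable_gauss_fun.
- by move=> x; rewrite lee_fin gauss_fun_ge0.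
Qed.

Lemma prod_bump (x : V) : \prod_(i < d) bump (x 0 i) = expR (- (norm2 x / 16)).
Proof.
rewrite -expR_sum; congr expR; rewrite sumrN /norm2 /dotv mulr_suml.
by congr (- _); apply: eq_bigr => i _; rewrite -expr2.
Qed.

(* Gaussian domination is what Fubini needs to turn the iterated integrals of signed functions
   into integrals over tuples. *)
Definition tame (F : V -> R) :=
  vmeas F /\ exists C, forall x, `|F x| <= C * expR (- (norm2 x / 16)).

Lemma tame_integrable F : tame F -> mu.-integrable setT (fun t => (F (tv t))%:E).
Proof.
move=> [mF [C FC]].
apply: (@le_integrable _ _ _ _ _ _ _
     (fun t : d.-tuple R => (C * \prod_(i < d) bump (tnth t i))%:E)) => //.
- exact/measurable_EFinP.
- move=> t _ /=; rewrite lee_fin (le_trans (FC _)) // (le_trans _ (ler_norm _)) //.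
  by rewrite -prod_bump [in leLHS](eq_bigr (fun i => bump (tnth t i))) // => i _; rewrite mxE.
under eq_fun do rewrite EFinM.
have pr0 (t : d.-tuple R) : 0 <= \prod_(i < d) bump (tnth t i).
  by apply: prodr_ge0 => i _; exact: expR_ge0.
apply: integrableZl => //; apply/integrableP; split.
  apply/measurable_EFinP; apply: measurable_prod => i _.
  by apply: measurableT_comp; [exact: measurable_bump|exact: measurable_tnth].
under eq_integral do rewrite gee0_abs ?lee_fin ?pr0 //.
apply: ge0_integral_prod_tuple; [exact: measurable_bump| |exact: integral_bump].
by move=> x; exact: expR_ge0.
Qed.

Lemma tame_intRdE F : tame F -> intRd (fun x => (F x)%:E) = vint (fun x => (F x)%:E).
Proof.
move=> [mF [C FC]]; rewrite /intRd (@iintE _ d bump C (fun x => F (rv_of d x))).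
- by apply: eq_integral => t _; rewrite rv_of_overwrite.
- exact: measurable_bump.
- by move=> x; exact: expR_ge0.
- exact: integral_bump.
- by under eq_fun do rewrite rv_of_overwrite.
- move=> t; rewrite rv_of_overwrite (le_trans (FC _)) // -prod_bump.
  by under eq_bigr do rewrite mxE.
Qed.

Definition Rv (F : V -> R) : R := fine (vint (fun x => (F x)%:E)).

Lemma tame_intRd F : tame F -> fine (intRd (fun x => (F x)%:E)) = Rv F.
Proof. by move=> tF; rewrite tame_intRdE. Qed.

Lemma vint_tame F : tame F -> vint (fun x => (F x)%:E) = (Rv F)%:E.
Proof.
move=> tF; rewrite fineK //; apply: integrable_fin_num => //; exact: tame_integrable.
Qed.

Lemma eq_Rv F G : F =1 G -> Rv F = Rv G.
Proof. by move=> /funext ->. Qed.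

Lemma eq_tame F G : F =1 G -> tame F -> tame G.
Proof. by move=> /funext ->. Qed.

Lemma le_tame F G : vmeas F -> tame G -> (forall x, `|F x| <= G x) -> tame F.
Proof.
move=> mF [mG [C GC]] FG; split=> //; exists C => x.
by rewrite (le_trans (FG x)) // (le_trans (ler_norm _)).
Qed.

Lemma tame_norm F : tame F -> tame (fun x => `|F x|).
Proof.
move=> [mF [C FC]]; split; first by apply: measurableT_comp.
by exists C => x; rewrite normr_id.
Qed.

Lemma tameD F G : tame F -> tame G -> tame (fun x => F x + G x).
Proof.
move=> [mF [C FC]] [mG [D GD]]; split; first exact: vmeasD.
exists (C + D) => x; rewrite mulrDl (le_trans (ler_normD _ _)) // lerD //.
Qed.

Lemma tameZ c F : tame F -> tame (fun x => c * F x).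
Proof.
move=> [mF [C FC]]; split; first by apply: vmeasM => //; exact: vmeas_cst.
by exists (`|c| * C) => x; rewrite normrM -mulrA ler_wpM2l.
Qed.

Lemma tameN F : tame F -> tame (fun x => - F x).
Proof. by move=> /(tameZ (-1)); apply: eq_tame => x; rewrite mulN1r. Qed.

Lemma tameB F G : tame F -> tame G -> tame (fun x => F x - G x).
Proof. by move=> tF tG; apply: tameD => //; exact: tameN. Qed.

Lemma tame0 : tame (fun=> 0).
Proof.
split; first exact: vmeas_cst.
by exists 0 => x; rewrite normr0 mul0r.
Qed.

Lemma tame_sum I (s : seq I) (F : I -> V -> R) :
  (forall i, tame (F i)) -> tame (fun x => \sum_(i <- s) F i x).
Proof.
move=> tF; elim: s => [|i s IH].
  by apply: eq_tame tame0 => x; rewrite big_nil.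
by apply: eq_tame (tameD (tF i) IH) => x; rewrite big_cons.
Qed.

Lemma RvD F G : tame F -> tame G -> Rv (fun x => F x + G x) = Rv F + Rv G.
Proof.
move=> tF tG; rewrite /Rv /vint.
under eq_integral do rewrite EFinD.
rewrite integralD //; try exact: tame_integrable.
by rewrite fineD //; apply: integrable_fin_num => //; exact: tame_integrable.
Qed.

Lemma RvZ c F : tame F -> Rv (fun x => c * F x) = c * Rv F.
Proof.
move=> tF; rewrite /Rv /vint.
under eq_integral do rewrite EFinM.
rewrite integralZl //; try exact: tame_integrable.
by rewrite fineM //; apply: integrable_fin_num => //; exact: tame_integrable.
Qed.

Lemma RvN F : tame F -> Rv (fun x => - F x) = - Rv F.
Proof. by move=> tF; rewrite -mulN1r -RvZ //; apply: eq_Rv => x; rewrite mulN1r. Qed.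

Lemma RvB F G : tame F -> tame G -> Rv (fun x => F x - G x) = Rv F - Rv G.
Proof. by move=> tF tG; rewrite RvD ?RvN //; exact: tameN. Qed.

Lemma Rv0 : Rv (fun=> 0) = 0.
Proof. by rewrite /Rv /vint integral0. Qed.

Lemma Rv_sum I (s : seq I) (F : I -> V -> R) :
  (forall i, tame (F i)) -> Rv (fun x => \sum_(i <- s) F i x) = \sum_(i <- s) Rv (F i).
Proof.
move=> tF; elim: s => [|i s IH].
  by rewrite big_nil -[RHS]Rv0; apply: eq_Rv => x; rewrite big_nil.
rewrite big_cons -IH -RvD //; last exact: tame_sum.
by apply: eq_Rv => x; rewrite big_cons.
Qed.

Lemma Rv_cvg (F : nat -> V -> R) (G H : V -> R) :
  (forall n, vmeas (F n)) -> tame H -> (forall n x, `|F n x| <= H x) ->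
  (forall x, F ^~ x @ \oo --> G x) -> vmeas G -> Rv \o F @ \oo --> Rv G.
Proof.
move=> mF tH FH FG mG.
have := @dominated_convergence _ _ _ mu setT measurableT (fun n t => (F n (tv t))%:E)
  (fun t => (G (tv t))%:E) (fun t => (H (tv t))%:E).
case.
- by move=> n; apply: vmeasE; exact: mF.
- by apply: vmeasE.
- by apply: aeW => t _; apply: cvg_EFin; [exact: nearW|exact: FG].
- exact: tame_integrable.
- by apply: aeW => t n _; rewrite lee_fin FH.
move=> _ _ cv.
have tG : tame G.
  apply: (le_tame mG tH) => x.
  have cvn : `|F n x| @[n --> \oo] --> `|G x| by apply: cvg_norm; exact: FG.
  apply: (cvgr_to_le cvn).
  by apply: nearW => n; exact: FH.
apply/fine_cvg; rewrite -vint_tame //.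
Qed.

Lemma tame_pos F : tame F -> tame (fun x => Num.max (F x) 0).
Proof.
move=> tF; apply: le_tame (tame_norm tF) _.
  by apply: measurable_maxr => //; exact: tF.1.
move=> x; rewrite ger0_norm ?le_max ?lexx ?orbT //.
by rewrite ge_max normr_ge0 ler_norm.
Qed.

(** [jacobian] speaks of nonnegative functions; the positive and the negative part of a tame
    function are treated separately. *)
Lemma Rv_jacobian g c F : jacobian g c -> 0 <= c -> tame F -> tame (fun x => F (g x)) ->
  Rv (fun x => F (g x)) = c * Rv F.
Proof.
move=> [mg Jg] c0 tF tFg.
have pos G : tame G -> (forall x, 0 <= G x) -> Rv (fun x => G (g x)) = c * Rv G.
  move=> tG G0; rewrite /Rv (Jg (fun x => (G x)%:E)) //.
  - by rewrite vint_tame.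
  - by apply: vmeasE; exact: tG.1.
have E x : F x = Num.max (F x) 0 - Num.max (- F x) 0.
  by case: (lerP (F x) 0) => [Fx|/ltW Fx]; case: (lerP (- F x) 0) => Gx; lra.
have tp := tame_pos tF; have tn := tame_pos (tameN tF).
have tpg := tame_pos tFg; have tng := tame_pos (tameN tFg).
rewrite (eq_Rv E) (eq_Rv (fun x => E (g x))) !RvB //.
rewrite (pos (fun x => Num.max (F x) 0)) // ?(pos (fun x => Num.max (- F x) 0)) //.
- by rewrite mulrBr.
- by move=> x; rewrite le_max lexx orbT.
- by move=> x; rewrite le_max lexx orbT.
Qed.

(* Multiplying a tempered function by a Gaussian makes it tame; polynomials and [h_k ^+ 2]
   are tempered. *)
Definition tempered (F : V -> R) :=
  vmeas F /\ forall e, 0 < e -> exists C, forall x, `|F x| <= C * expR (e * norm2 x).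

Lemma eq_tempered F G : F =1 G -> tempered F -> tempered G.
Proof. by move=> /funext ->. Qed.

Lemma norm2_ge0 (x : V) : 0 <= norm2 x.
Proof. by apply: sumr_ge0 => i _; rewrite -expr2 sqr_ge0. Qed.

Lemma tempered_bounded F c : vmeas F -> (forall x, `|F x| <= c) -> tempered F.
Proof.
move=> mF Fc; split=> // e e0; exists c => x; rewrite (le_trans (Fc x)) // ler_peMr //.
  exact: le_trans (Fc x).
by rewrite -expR0 ler_expR mulr_ge0 ?norm2_ge0 ?ltW.
Qed.

Lemma tempered_cst c : tempered (fun=> c).
Proof. by apply: (@tempered_bounded _ `|c|) => //; exact: vmeas_cst. Qed.

Lemma temperedD F G : tempered F -> tempered G -> tempered (fun x => F x + G x).
Proof.
move=> [mF FC] [mG GC]; split; first exact: vmeasD.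
move=> e e0; have [C {}FC] := FC e e0; have [D {}GC] := GC e e0.
exists (C + D) => x; rewrite mulrDl (le_trans (ler_normD _ _)) // lerD //.
Qed.

Lemma temperedM F G : tempered F -> tempered G -> tempered (fun x => F x * G x).
Proof.
move=> [mF FC] [mG GC]; split; first exact: vmeasM.
move=> e e0; have e2 : 0 < e / 2 by lra.
have [C {}FC] := FC _ e2; have [D {}GC] := GC _ e2.
exists (C * D) => x; rewrite normrM.
have -> : e * norm2 x = e / 2 * norm2 x + e / 2 * norm2 x by lra.
by rewrite expRD mulrACA; apply: ler_pM.
Qed.

Lemma temperedN F : tempered F -> tempered (fun x => - F x).
Proof.
move=> /(temperedM (tempered_cst (-1))); apply: eq_tempered => x.
by rewrite mulN1r.
Qed.

Lemma temperedB F G : tempered F -> tempered G -> tempered (fun x => F x - G x).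
Proof. by move=> tF tG; apply: temperedD => //; exact: temperedN. Qed.

Lemma temperedX F n : tempered F -> tempered (fun x => F x ^+ n).
Proof.
move=> tF; elim: n => [|n IH].
  by apply: eq_tempered (tempered_cst 1) => x; rewrite expr0.
by apply: eq_tempered (temperedM tF IH) => x; rewrite exprS.
Qed.

Lemma tempered_sum I (s : seq I) (F : I -> V -> R) :
  (forall i, tempered (F i)) -> tempered (fun x => \sum_(i <- s) F i x).
Proof.
move=> tF; elim: s => [|i s IH].
  by apply: eq_tempered (tempered_cst 0) => x; rewrite big_nil.
by apply: eq_tempered (temperedD (tF i) IH) => x; rewrite big_cons.
Qed.

Lemma tempered_prod (I : eqType) (s : seq I) (F : I -> V -> R) :
  (forall i, i \in s -> tempered (F i)) -> tempered (fun x => \prod_(i <- s) F i x).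
Proof.
elim: s => [|i s IH] tF.
  by apply: eq_tempered (tempered_cst 1) => x; rewrite big_nil.
have ti : tempered (F i) by apply: tF; rewrite mem_head.
have ts : tempered (fun x => \prod_(i <- s) F i x).
  by apply: IH => j js; apply: tF; rewrite inE js orbT.
by apply: eq_tempered (temperedM ti ts) => x; rewrite big_cons.
Qed.

Lemma le_tempered F G : vmeas F -> tempered G -> (forall x, `|F x| <= G x) -> tempered F.
Proof.
move=> mF [mG GC] FG; split=> // e e0; have [C {}GC] := GC e e0; exists C => x.
by rewrite (le_trans (FG x)) // (le_trans (ler_norm _)).
Qed.

Lemma tempered_norm2 : tempered (@norm2 R d).
Proof.
split; first exact: vmeas_norm2.
move=> e e0; exists e^-1 => x; rewrite ger0_norm ?norm2_ge0 // mulrC ler_pdivlMr //.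
rewrite mulrC (le_trans _ (expR_ge1Dx _)) // lerDr //.
Qed.

Lemma sqr_coord_le (x : V) i : x 0 i ^+ 2 <= norm2 x.
Proof.
rewrite /norm2 /dotv (bigD1 i) //= -expr2 lerDl.
by apply: sumr_ge0 => k _; rewrite -expr2 sqr_ge0.
Qed.

Lemma tempered_coord i : tempered (fun x => x 0 i).
Proof.
apply: (@le_tempered _ (fun x => 1 + norm2 x)); first exact: vmeas_coord.
  by apply: temperedD; [exact: tempered_cst|exact: tempered_norm2].
move=> x; rewrite (le_trans _ (lerD (lexx 1) (sqr_coord_le x i))) //.
rewrite -(real_normK (num_real (x 0 i))).
have : 0 <= (`|x 0 i| - 1) ^+ 2 by exact: sqr_ge0.
have := normr_ge0 (x 0 i); nra.
Qed.

Lemma tempered_dotv a : tempered (dotv a).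
Proof.
by apply: tempered_sum => i; apply: temperedM; [exact: tempered_cst|exact: tempered_coord].
Qed.

Lemma tempered_powR F k : 0 <= k -> (forall x, 0 <= F x) -> tempered F ->
  tempered (fun x => F x `^ k).
Proof.
move=> k0 F0 [mF FC]; split.
  by apply: (vmeas_comp (@measurable_powR R k)).
(* The power k turns the rate e / (k + 1) into e k / (k + 1) <= e; the summand 1 covers k = 0. *)
move=> e e0; have ek : 0 < e / (k + 1) by rewrite divr_gt0 // ltr_wpDl.
have [C {}FC] := FC _ ek; exists (`|C| `^ k) => x.
rewrite ger0_norm ?powR_ge0 //.
apply: (@le_trans _ _ ((`|C| * expR (e / (k + 1) * norm2 x)) `^ k)).
  apply: ge0_ler_powR => //; rewrite ?nnegrE ?mulr_ge0 ?expR_ge0 //.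
  rewrite -(ger0_norm (F0 x)) (le_trans (FC x)) // ler_wpM2r ?expR_ge0 // ler_norm //.
rewrite powRM ?expR_ge0 // -expRM ler_wpM2l ?powR_ge0 // ler_expR.
rewrite mulrAC ler_wpM2r ?norm2_ge0 // -mulrA ler_piMr ?(ltW e0) //.
by rewrite mulrC ler_pdivrMr ?mul1r ?lerDl // ltr_wpDl.
Qed.

(** Half of the rate 1/8 pays for the growth of F, and the other half is the rate 1/16 that [tame]
    asks for. *)
Lemma tempered_tame c F : 8^-1 <= c -> tempered F ->
  tame (fun x => F x * expR (- (c * norm2 x))).
Proof.
move=> c8 [mF FC]; split.
  apply: vmeasM => //; apply: (vmeas_comp (@measurable_expR R)).
  apply: (@eq_vmeas _ _ (fun x => (- c) * norm2 x)); first by move=> x; rewrite mulNr.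
  by apply: vmeasM; [exact: vmeas_cst|exact: vmeas_norm2].
have e0 : (0 : R) < 16^-1 by rewrite invr_gt0.
have [C {}FC] := FC _ e0; exists C => x.
have C0 : 0 <= C.
  by have := le_trans (normr_ge0 _) (FC x); rewrite pmulr_lge0 // expR_gt0.
rewrite normrM (ger0_norm (expR_ge0 _)).
apply: le_trans (ler_wpM2r (expR_ge0 _) (FC x)) _.
rewrite -mulrA -expRD ler_wpM2l // ler_expR.
have := norm2_ge0 x; have : 8^-1 * norm2 x <= c * norm2 x by rewrite ler_wpM2r ?norm2_ge0.
lra.
Qed.

End tame.

(** * Integration by parts for the Dunkl operators *)

Section directional.
Context {R : realType} {V : normedModType R}.

(** Both difference quotients are the same function. This gives access to the chain rule and the
    mean value theorem in one variable. *)
Lemma is_derive_line (F : V -> R) (x v : V) (l : R) :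
  is_derive x v F l <-> is_derive (0 : R) 1 (fun t => F (t *: v + x)) l.
Proof.
have E : (fun h : R => h^-1 *: ((F \o shift x) (h *: v) - F x)) =
    (fun h : R => h^-1 *: (((fun t => F (t *: v + x)) \o shift 0) (h *: (1 : R)) - F (0 *: v + x))).
  by apply/funext => h /=; rewrite scale0r add0r addr0 /GRing.scale /= mulr1.
by split=> -[]; rewrite /derivable /derive ?E => ? ?; split; rewrite /derivable /derive ?E.
Qed.

Lemma is_derive_comp1 (g : R -> R) (F : V -> R) x v l g' :
  is_derive x v F l -> is_derive (F x) 1 g g' -> is_derive x v (fun y => g (F y)) (g' * l).
Proof.
move=> /is_derive_line dF dg; apply/is_derive_line.
have : is_derive (F (0 *: v + x)) 1 g g' by rewrite scale0r add0r.
move=> dg'; have := @is_derive1_comp _ g (fun t => F (t *: v + x)) _ _ _ dg' dF.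
exact.
Qed.

Lemma is_deriveMr (F G : V -> R) x v (f g : R) :
  is_derive x v F f -> is_derive x v G g ->
  is_derive x v (fun y => F y * G y) (f * G x + F x * g).
Proof.
move=> dF dG; have := @is_deriveM _ _ F G x v f g dF dG => D.
by apply: (is_derive_eq D); rewrite /GRing.scale /=; ring.
Qed.

(** Logarithmic differentiation: each derivative is given relative to its factor, so that no factor
    has to be taken out of the product. *)
Lemma is_derive_logprod (I : eqType) (s : seq I) (F : I -> V -> R) (c : I -> R) x v :
  (forall i, i \in s -> is_derive x v (F i) (c i * F i x)) ->
  is_derive x v (fun y => \prod_(i <- s) F i y) ((\sum_(i <- s) c i) * \prod_(i <- s) F i x).
Proof.
elim: s => [|i s IH] dF.
  rewrite (_ : (fun y => _) = cst 1); last by apply/funext => y; rewrite big_nil.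
  by rewrite !big_nil mul0r; exact: is_derive_cst.
rewrite (_ : (fun y => _) = (fun y => F i y * \prod_(i <- s) F i y)); last first.
  by apply/funext => y; rewrite big_cons.
have di : is_derive x v (F i) (c i * F i x) by apply: dF; rewrite mem_head.
have ds : is_derive x v (fun y => \prod_(i <- s) F i y) ((\sum_(i <- s) c i) * \prod_(i <- s) F i x).
  by apply: IH => j js; apply: dF; rewrite inE js orbT.
have := is_deriveMr di ds => D.
by apply: is_derive_eq; rewrite !big_cons; ring.
Qed.

End directional.

Section weight.
Context {R : realType} {d : nat}.
Local Notation V := 'rV[R]_d.

Lemma is_derive_coord (i : 'I_d) (x v : V) : is_derive x v (fun y : V => y 0 i) (v 0 i).
Proof.
apply/is_derive_line.
rewrite (_ : (fun t : R => _) = (fun t => t * v 0 i + x 0 i)); last first.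
  by apply/funext => t; rewrite !mxE.
have D : is_derive (0 : R) 1 (fun t : R => t * v 0 i + x 0 i) (v 0 i *: 1 + 0).
  apply: is_deriveD.
  rewrite (_ : (fun t => _) = v 0 i \*: (id : R -> R)); first exact: is_deriveZ.
  by apply/funext => t /=; rewrite /GRing.scale /= mulrC.
by apply: is_derive_eq; rewrite addr0 /GRing.scale /= mulr1.
Qed.

Lemma is_derive_sumr (I : Type) (s : seq I) (F : I -> V -> R) (f : I -> R) x v :
  (forall i, is_derive x v (F i) (f i)) ->
  is_derive x v (fun y => \sum_(i <- s) F i y) (\sum_(i <- s) f i).
Proof.
move=> dF; elim: s => [|i s IH].
  rewrite (_ : (fun y => _) = cst 0); last by apply/funext => y; rewrite big_nil.
  by rewrite !big_nil; exact: is_derive_cst.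
rewrite (_ : (fun y => _) = F i + (fun y => \sum_(i <- s) F i y)); last first.
  by apply/funext => y; rewrite big_cons.
by rewrite big_cons; exact: is_deriveD.
Qed.

Lemma is_derive_dotv (a x v : V) : is_derive x v (dotv a) (dotv a v).
Proof.
apply: is_derive_sumr => i.
have D := is_deriveMr (is_derive_cst (a 0 i) x v) (is_derive_coord i x v).
by apply: is_derive_eq; rewrite /cst mul0r add0r.
Qed.

Lemma is_derive_norm2 (x v : V) : is_derive x v (@norm2 R d) (2 * dotv x v).
Proof.
have D : is_derive x v (@norm2 R d) (\sum_i (v 0 i * x 0 i + x 0 i * v 0 i)).
  by apply: is_derive_sumr => i; apply: is_deriveMr; exact: is_derive_coord.
apply: is_derive_eq; rewrite /dotv mulr_sumr; apply: eq_bigr => i _; ring.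
Qed.

Lemma is_derive_gauss (x v : V) :
  is_derive x v (fun y => expR (- norm2 y)) (- (2 * dotv x v) * expR (- norm2 x)).
Proof.
have D := @is_deriveN _ _ _ _ _ _ _ (is_derive_norm2 x v).
have := is_derive_comp1 D (is_derive_expR (- norm2 x)).
by rewrite mulrC.
Qed.

Lemma norm2_translate (x : V) i t : `|t| <= 1 -> norm2 x <= 2 * norm2 (t *: unitv R i + x) + 2.
Proof.
move=> t1; rewrite /norm2 /dotv [in leLHS](bigD1 i) //= [in leRHS](bigD1 i) //=.
rewrite [X in _ <= 2 * (_ + X) + _](eq_bigr (fun k => x 0 k * x 0 k)); last first.
  by move=> k ki; rewrite !mxE (negbTE ki) mulr0 add0r.
set S := (\sum_(k | _) _); have S0 : 0 <= S.
  by apply: sumr_ge0 => k _; rewrite -expr2 sqr_ge0.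
rewrite !mxE !eqxx mulr1.
have : t ^+ 2 <= 1 by rewrite -real_normK ?num_real // expr_le1.
(* In coordinate i the two sides differ by (x_i + 2 t)^2 + 2 (1 - t^2). *)
have : 0 <= (x 0 i + 2 * t) ^+ 2 by exact: sqr_ge0.
nra.
Qed.

(** The rate is twice that of [tame]: by [norm2_translate] a translation of length at most 1 can
    halve it. *)
Definition bounded8 (F : V -> R) := exists2 C, 0 <= C &
  forall x, `|F x| <= C * expR (- (norm2 x / 8)).

Lemma bounded8_tame F : vmeas F -> bounded8 F -> tame F.
Proof.
move=> mF [C C0 FC]; split=> //; exists C => x; rewrite (le_trans (FC x)) //.
rewrite ler_wpM2l // ler_expR; have := norm2_ge0 x; lra.
Qed.

Lemma bounded8_translate F : bounded8 F -> exists2 C, 0 <= C &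
  forall x i t, `|t| <= 1 -> `|F (t *: unitv R i + x)| <= C * expR (- (norm2 x / 16)).
Proof.
move=> [C C0 FC]; exists (C * expR 1) => [|x i t t1]; first by rewrite mulr_ge0 ?expR_ge0.
rewrite (le_trans (FC _)) // -mulrA -expRD ler_wpM2l // ler_expR.
have := norm2_translate x i t1; lra.
Qed.

(* Translation invariance makes the integral of every difference quotient of [F] vanish. *)
Lemma Rv_partial (F G : V -> R) i : vmeas F -> bounded8 F -> vmeas G -> bounded8 G ->
  (forall x, is_derive x (unitv R i) F (G x)) -> Rv G = 0.
Proof.
move=> mF bF mG bG dF.
have [CF CF0 sF] := bounded8_translate bF.
have [C C0 sG] := bounded8_translate bG.
have tF := bounded8_tame mF bF.
pose u n : R := n.+1%:R^-1.
pose D n (x : V) := (u n)^-1 * (F (x + u n *: unitv R i) - F x).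
have u0 n : 0 < u n by rewrite invr_gt0.
have u1 n : u n <= 1 by rewrite invf_le1 // ler1n.
have nu n : `|u n| <= 1 by rewrite gtr0_norm.
have mFs n : vmeas (fun x => F (x + u n *: unitv R i)).
  by apply: vmeas_compv => // k; have [+ _] := jacobian_translate i (u n); apply.
have tFs n : tame (fun x => F (x + u n *: unitv R i)).
  by split=> //; exists CF => x; rewrite addrC sF.
have mD n : vmeas (D n).
  by apply: vmeasM; [exact: vmeas_cst|exact: vmeasB].
have D0 n : Rv (D n) = 0.
  rewrite RvZ; last exact: tameB.
  by rewrite RvB // (Rv_jacobian (jacobian_translate i (u n))) // mul1r subrr mulr0.
have dline x (t : R) : is_derive t 1 (fun t => F (t *: unitv R i + x)) (G (t *: unitv R i + x)).
  apply/is_derive_line; have /is_derive_line := dF (t *: unitv R i + x).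
  rewrite (_ : (fun t0 => F (t0 *: _ + _)) =
    (fun t0 => F ((t0 *: (1 : R) + t) *: unitv R i + x))) //.
  by apply/funext => s; rewrite scalerDl addrA /GRing.scale /= mulr1.
(* By the mean value theorem the quotient is a value of G at a point of the segment, which has
   length at most 1. Hence the majorant does not depend on n. *)
have DH n x : `|D n x| <= C * expR (- (norm2 x / 16)).
  have cont : {within `[0, u n], continuous (fun t => F (t *: unitv R i + x))}.
    by apply: derivable_within_continuous => t _; apply: ex_derive.
  have [c] := MVT (u0 n) (fun t _ => dline x t) cont.
  rewrite in_itv /= => /andP[c0 cu]; rewrite scale0r add0r subr0 => E.
  rewrite /D [x + _]addrC E mulrCA mulVf ?gt_eqF // mulr1 sG //.
  by rewrite gtr0_norm // (le_trans (ltW cu)).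
have DG x : D ^~ x @ \oo --> G x.
  have /is_derive_line [dx dE] := dF x.
  have : (fun h : R => h^-1 *: (((fun t => F (t *: unitv R i + x)) \o shift 0) (h *: (1 : R)) - F (0 *: unitv R i + x))) @ 0^' --> G x.
    by rewrite -dE; apply: dx.
  move=> /cvgr_dnbhsP /(_ u) H.
  have {}H := H (conj (fun n => lt0r_neq0 (u0 n)) (@cvg_harmonic R)).
  apply: cvg_trans H; apply: near_eq_cvg; apply: nearW => n /=.
  by rewrite /D scale0r add0r addr0 [u n *: 1]mulr1 [x + _]addrC.
have tH : tame (fun x : V => C * expR (- (norm2 x / 16))).
  split; last by exists C => x; rewrite ger0_norm // mulr_ge0 ?expR_ge0.
  apply: vmeasM; first exact: vmeas_cst.
  apply: (vmeas_comp (@measurable_expR R)).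
  apply: (@eq_vmeas _ _ (fun x => - (16^-1) * norm2 x)); first by move=> x; rewrite mulNr mulrC.
  by apply: vmeasM; [exact: vmeas_cst|exact: vmeas_norm2].
have := @Rv_cvg R d D G _ mD tH DH DG mG.
rewrite (_ : Rv \o D = cst 0); last by apply/funext => n /=.
by move=> /cvg_unique; apply => //; exact: cvg_cst.
Qed.

End weight.

(** * Reflections and the Euclidean inner product *)

Section euclid.
Context {R : realType} {d : nat}.
Local Notation V := 'rV[R]_d.
Implicit Types (a b x y : V).

Lemma dotvC x y : dotv x y = dotv y x.
Proof. by apply: eq_bigr => i _; rewrite mulrC. Qed.

Lemma dotvDr a x y : dotv a (x + y) = dotv a x + dotv a y.
Proof. by rewrite /dotv -big_split; apply: eq_bigr => i _; rewrite mxE mulrDr. Qed.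

Lemma dotvZr a c x : dotv a (c *: x) = c * dotv a x.
Proof. by rewrite /dotv mulr_sumr; apply: eq_bigr => i _; rewrite mxE mulrCA. Qed.

Lemma dotvNr a x : dotv a (- x) = - dotv a x.
Proof. by rewrite -scaleN1r dotvZr mulN1r. Qed.

Lemma dotvNl a x : dotv (- a) x = - dotv a x.
Proof. by rewrite dotvC dotvNr dotvC. Qed.

Lemma dotvv_gt0 a : a != 0 -> 0 < dotv a a.
Proof.
move=> a0; rewrite lt_neqAle norm2_ge0 andbT eq_sym.
apply: contra a0; rewrite /dotv psumr_eq0; last by move=> i _; rewrite -expr2 sqr_ge0.
move=> /allP H; apply/eqP/rowP => i; rewrite mxE; apply/eqP.
by have := H i (mem_index_enum i); rewrite /= mulf_eq0 orbb.
Qed.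

Lemma dotv_refl b x y : dotv x (refl b y) = dotv (refl b x) y.
Proof.
rewrite /refl dotvDr dotvNr dotvZr [RHS]dotvC dotvDr dotvNr dotvZr.
by rewrite (dotvC y x) (dotvC y b) (dotvC x b); ring.
Qed.

Lemma refl_dotvv a x : a != 0 -> dotv a (refl a x) = - dotv a x.
Proof.
move=> /dotvv_gt0 aa; rewrite /refl dotvDr dotvNr dotvZr.
by field; rewrite gt_eqF.
Qed.

Lemma reflK a : a != 0 -> involutive (refl a).
Proof.
move=> a0 x; have aa := dotvv_gt0 a0.
rewrite {1}/refl refl_dotvv // /refl -addrA -opprD -scalerDl.
by rewrite mulrN mulNr subrr scale0r subr0.
Qed.

Lemma norm2_refl a x : a != 0 -> norm2 (refl a x) = norm2 x.
Proof. by move=> a0; rewrite /norm2 dotv_refl reflK. Qed.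

Lemma refl_root a : a != 0 -> refl a a = - a.
Proof.
move=> /dotvv_gt0 aa; rewrite /refl mulfK ?gt_eqF //.
by rewrite scaler_nat mulr2n opprD addrA subrr sub0r.
Qed.

Lemma vmeas_refl a i : vmeas (fun x : V => refl a x 0 i).
Proof.
apply: (@eq_vmeas _ _ (fun x => x 0 i - (2 / dotv a a * a 0 i) * dotv a x)).
  by move=> x; rewrite !mxE; ring.
apply: vmeasB; first exact: vmeas_coord.
by apply: vmeasM; [exact: vmeas_cst|exact: vmeas_dotv].
Qed.

Lemma tempered_refl a F : a != 0 -> tempered F -> tempered (fun x : V => F (refl a x)).
Proof.
move=> a0 [mF FC]; split; first by apply: vmeas_compv => // i; exact: vmeas_refl.
by move=> e e0; have [C {}FC] := FC e e0; exists C => x; rewrite -(norm2_refl x a0).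
Qed.

Lemma tempered_gauss_tame F : tempered F -> tame (fun x : V => F x * expR (- norm2 x)).
Proof.
move=> tF; have : 8^-1 <= (1 : R) by rewrite invf_le1 // ler1n.
by move=> /(tempered_tame)/(_ tF); apply: eq_tame => x; rewrite mul1r.
Qed.

Lemma tempered_gauss_bounded8 F : tempered F ->
  bounded8 (fun x : V => F x * expR (- norm2 x)).
Proof.
move=> [mF FC]; have e0 : (0 : R) < 2^-1 by rewrite invr_gt0.
have [C {}FC] := FC _ e0.
have C0 : 0 <= C.
  by have := le_trans (normr_ge0 _) (FC 0); rewrite pmulr_lge0 // expR_gt0.
exists C => // x; rewrite normrM (ger0_norm (expR_ge0 _)).
apply: le_trans (ler_wpM2r (expR_ge0 _) (FC x)) _.
by rewrite -mulrA -expRD ler_wpM2l // ler_expR; have := norm2_ge0 x; lra.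
Qed.

Lemma Rv_refl a F : a != 0 -> tame F -> tame (fun x : V => F (refl a x)) ->
  Rv (fun x => F (refl a x)) = Rv F.
Proof. by move=> a0 tF tFr; rewrite (Rv_jacobian (jacobian_refl a0)) // mul1r. Qed.

End euclid.

(** * Root systems, the invariant weight and its regularization *)

Section roots.
Context {R : realType} {d : nat}.
Local Notation V := 'rV[R]_d.
Context (Rs Rp : seq V) (kappa : V -> R).
Hypothesis hRs : root_system Rs.
Hypothesis hRp : positive_subsystem Rs Rp.
Hypothesis hk : multiplicity Rs kappa.

Lemma positive_root a : a \in Rp -> a \in Rs.
Proof. by have [beta [_ _ ->]] := hRp => /andP[]. Qed.

Lemma root_neq0 a : a \in Rs -> a != 0.
Proof. by have [_ + _ _] := hRs => h aR; apply: contraNneq h => <-. Qed.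

Lemma root_opp a : a \in Rs -> - a \in Rs.
Proof.
move=> aR; rewrite -refl_root; last exact: root_neq0.
by have [_ _ + _] := hRs; apply.
Qed.

Lemma kappa_refl a b : a \in Rs -> b \in Rs -> kappa (refl b a) = kappa a.
Proof. by move=> aR bR; have [_ /(_ [:: b] a)] := hk; rewrite /= bR; apply. Qed.

Lemma kappa_opp a : a \in Rs -> kappa (- a) = kappa a.
Proof. by move=> aR; rewrite -refl_root ?kappa_refl //; exact: root_neq0. Qed.

Lemma kappa_ge0 a : a \in Rp -> 0 <= kappa a.
Proof. by move=> /positive_root; have [+ _] := hk; apply. Qed.

(** No root is orthogonal to beta, so exactly one of a and -a is positive. Products over positive
    roots are thereby compared with products over all roots, which reflections permute. *)
Lemma perm_roots : perm_eq Rs (Rp ++ map -%R Rp).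
Proof.
have [uRs _ _ _] := hRs; have [beta [b0 uRp mRp]] := hRp.
apply: uniq_perm => //.
  rewrite cat_uniq uRp (map_inj_uniq oppr_inj) uRp andbT /=.
  apply/hasPn => _ /mapP[a aR ->]; move: aR; rewrite /= !mRp => /andP[_ ab].
  by rewrite dotvNl oppr_gt0 (lt_gtF ab) andbF.
move=> a; rewrite mem_cat; apply/idP/orP => [aR|[|/mapP[b bR ->]]].
- have := b0 a aR; rewrite neq_lt => /orP[ab|ab]; [right|left].
    apply/mapP; exists (- a); last by rewrite opprK.
    by rewrite mRp root_opp //= dotvNl oppr_gt0.
  by rewrite mRp aR.
- exact: positive_root.
- by apply: root_opp; exact: positive_root.
Qed.

Lemma prod_roots (F : V -> R) : (forall a, a \in Rs -> F (- a) = F a) ->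
  \prod_(a <- Rs) F a = (\prod_(a <- Rp) F a) ^+ 2.
Proof.
move=> FN; rewrite (perm_big _ perm_roots) /= big_cat /= big_map expr2; congr (_ * _).
by apply: eq_big_seq => a aR; rewrite FN //; exact: positive_root.
Qed.

Lemma prod_refl_roots (F : V -> R) b : b \in Rs ->
  \prod_(a <- Rs) F (refl b a) = \prod_(a <- Rs) F a.
Proof.
move=> bR; have b0 := root_neq0 bR; have [uRs _ cl _] := hRs.
rewrite -(big_map (refl b) xpredT F); apply: perm_big; apply: uniq_perm => //.
  by rewrite map_inj_uniq //; exact/inv_inj/reflK.
move=> a; apply/mapP/idP => [[c cR ->]|aR]; first exact: cl.
by exists (refl b a); [exact: cl|rewrite reflK].
Qed.

(** A reflection need not map positive roots to positive roots. For an even F, however, the product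
    over all roots is the square of the product over the positive ones; it is invariant, and a
    nonnegative number is determined by its square. *)
Lemma prod_positive_refl (F : V -> R) b : b \in Rs ->
  (forall a, a \in Rs -> 0 <= F a) -> (forall a, a \in Rs -> F (- a) = F a) ->
  \prod_(a <- Rp) F (refl b a) = \prod_(a <- Rp) F a.
Proof.
move=> bR F0 FN; have [_ _ cl _] := hRs.
have P0 G : (forall a, a \in Rs -> 0 <= G a) -> 0 <= \prod_(a <- Rp) G a.
  by move=> G0; rewrite big_seq prodr_ge0 // => a /positive_root; exact: G0.
apply/eqP; rewrite -(@eqrXn2 _ 2) //; last 2 first.
- by apply: P0 => a aR; apply: F0; exact: cl.
- exact: P0.
rewrite -!prod_roots //; last first.
  move=> a aR; have -> : refl b (- a) = - refl b a.
    by rewrite /refl dotvNr mulrN mulNr scaleNr !opprD.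
  by rewrite FN //; exact: cl.
by rewrite prod_refl_roots.
Qed.

(* A smooth [W]-invariant approximation of [h_kappa ^+ 2], recovered at [e = 0]. *)
Definition wprod (e : R) (x : V) : R := \prod_(a <- Rp) (dotv a x ^+ 2 + e) `^ kappa a.

Lemma wprod_ge0 e x : 0 <= wprod e x.
Proof. by apply: prodr_ge0 => a _; exact: powR_ge0. Qed.

Lemma wprod0 x : wprod 0 x = h_k Rp kappa x ^+ 2.
Proof.
rewrite /wprod /h_k -prodrXl; apply: eq_bigr => a _.
by rewrite addr0 [RHS]expr2 -powRM // -expr2 real_normK ?num_real.
Qed.

Lemma wprod_refl e b x : b \in Rs -> 0 <= e -> wprod e (refl b x) = wprod e x.
Proof.
move=> bR e0; have [_ _ cl _] := hRs.
rewrite /wprod -(@prod_positive_refl (fun a => (dotv a x ^+ 2 + e) `^ kappa a) b) //.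
- by apply: eq_big_seq => a aR; rewrite dotv_refl kappa_refl //; exact: positive_root.
- by move=> a _; exact: powR_ge0.
- by move=> a aR; rewrite dotvNl sqrrN kappa_opp.
Qed.

Lemma tempered_wprod e : 0 <= e -> tempered (wprod e).
Proof.
move=> e0; apply: tempered_prod => a aR; apply: tempered_powR; first exact: kappa_ge0.
  by move=> x; rewrite addr_ge0 // sqr_ge0.
by apply: temperedD; [apply: temperedX; exact: tempered_dotv|exact: tempered_cst].
Qed.

Lemma le_wprod e e' x : 0 <= e -> e <= e' -> wprod e x <= wprod e' x.
Proof.
move=> e0 ee'; rewrite /wprod big_seq [leRHS]big_seq; apply: ler_prod => a aR.
rewrite powR_ge0 /=; apply: ge0_ler_powR; rewrite ?nnegrE ?kappa_ge0 ?lerD2l //.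
  by rewrite addr_ge0 ?sqr_ge0.
by rewrite addr_ge0 ?sqr_ge0 // (le_trans e0).
Qed.

Lemma is_derive_wprod e x v : 0 < e ->
  is_derive x v (wprod e)
   ((\sum_(a <- Rp) 2 * kappa a * dotv a v * (dotv a x / (dotv a x ^+ 2 + e))) * wprod e x).
Proof.
move=> e0; apply: (@is_derive_logprod _ _ _ _ (fun a x => (dotv a x ^+ 2 + e) `^ kappa a)
  (fun a => 2 * kappa a * dotv a v * (dotv a x / (dotv a x ^+ 2 + e)))) => a aR.
have t0 : 0 < dotv a x ^+ 2 + e by rewrite ltr_wpDl // sqr_ge0.
have D1 := is_deriveMr (is_derive_dotv a x v) (is_derive_dotv a x v).
have D2 : is_derive x v (fun y => dotv a y ^+ 2 + e) (2 * dotv a x * dotv a v).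
  have := is_deriveD D1 (is_derive_cst e x v) => D.
  by apply: (is_derive_eq D); rewrite addr0; ring.
have := is_derive_comp1 D2 (is_derive1_powR (kappa a) t0) => D.
apply: (is_derive_eq D).
have -> : (dotv a x ^+ 2 + e) `^ (kappa a - 1) =
    (dotv a x ^+ 2 + e) `^ kappa a / (dotv a x ^+ 2 + e).
  by rewrite powRB ?powRr1 ?(ltW t0) // (gt_eqF t0) implybT.
by field; rewrite gt_eqF.
Qed.

(** For k = 0 both sides are 1; at t = 0 the sequence approaches from the right, where the power
    tends to 0; for t > 0 the power is differentiable, hence continuous. *)
Lemma cvg_powR_harmonic (t k : R) : 0 <= t -> 0 <= k ->
  (t + harmonic n) `^ k @[n --> \oo] --> t `^ k.
Proof.
move=> t0; rewrite le_eqVlt => /orP[/eqP <-|k0].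
  by under eq_cvg do rewrite powRr0; rewrite powRr0; exact: cvg_cst.
have cv : t + harmonic n @[n --> \oo] --> t.
  by rewrite -[X in _ --> X]addr0; apply: cvgD; [exact: cvg_cst|exact: cvg_harmonic].
move: t0 cv; rewrite le_eqVlt => /orP[/eqP <-|t0] cv.
  rewrite powR0 ?gt_eqF //.
  have /cvg_at_rightP := powR_cvg0 k0.
  by apply; split => // n; rewrite add0r harmonic_gt0.
have /derivable1_diffP/differentiable_continuous C : derivable (fun s : R => s `^ k) t 1.
  by apply: derivable_powR; rewrite in_itv /= t0.
exact: (cvg_comp _ _ cv C).
Qed.

Lemma cvg_wprod x : wprod (harmonic n) x @[n --> \oo] --> wprod 0 x.
Proof.
rewrite /wprod; elim: Rp (@kappa_ge0) => [|a s IH] k0.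
  by rewrite big_nil; under eq_cvg do rewrite big_nil; exact: cvg_cst.
rewrite big_cons; under eq_cvg do rewrite big_cons.
apply: cvgM; last by apply: IH => b bs; apply: k0; rewrite inE bs orbT.
by rewrite addr0; apply: cvg_powR_harmonic; [exact: sqr_ge0|apply: k0; rewrite mem_head].
Qed.

Lemma wprod_root0 a x : a \in Rp -> kappa a != 0 -> dotv a x = 0 -> wprod 0 x = 0.
Proof.
move=> aR ka ax; apply/eqP; rewrite /wprod prodf_seq_eq0; apply/hasP; exists a => //=.
by rewrite ax expr0n addr0 powR0.
Qed.

Definition wgauss (x : V) : R := wprod 0 x * expR (- norm2 x).

Lemma tempered_wgauss_tame F : tempered F -> tame (fun x => F x * wgauss x).
Proof.
move=> tF; have := tempered_gauss_tame (temperedM tF (tempered_wprod (lexx 0))).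
by apply: eq_tame => x; rewrite mulrA.
Qed.

(** * Antisymmetry of the Dunkl operators under the weighted integral *)

Section antisymmetry.
Context (i : 'I_d) (f g f' g' : V -> R) (qf qg : V -> V -> R).
Hypothesis tf : tempered f.
Hypothesis tg : tempered g.
Hypothesis tf' : tempered f'.
Hypothesis tg' : tempered g'.
Hypothesis tqf : forall a, tempered (qf a).
Hypothesis tqg : forall a, tempered (qg a).
Hypothesis df : forall x, is_derive x (unitv R i) f (f' x).
Hypothesis dg : forall x, is_derive x (unitv R i) g (g' x).
Hypothesis qfE : forall a x, a \in Rp -> f x - f (refl a x) = dotv a x * qf a x.
Hypothesis qgE : forall a x, a \in Rp -> g x - g (refl a x) = dotv a x * qg a x.

(** [L] is the derivative of f g exp(-|x|^2) divided by the Gaussian, [S a] is the factor that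
    multiplies kappa(a) a_i in T_i f g + f T_i g, and [rat] is the smooth substitute for 1 / <a,x>
    coming from the derivative of [wprod e]. *)
Let L (x : V) := f' x * g x + f x * g' x - 2 * x 0 i * (f x * g x).
Let S (a x : V) := qf a x * g x + f x * qg a x.
Let rat (a : V) (e : R) (x : V) := dotv a x / (dotv a x ^+ 2 + e).

Let tempered_L : tempered L.
Proof.
apply: temperedB; first by apply: temperedD; apply: temperedM.
by apply: temperedM; apply: temperedM => //; [exact: tempered_cst|exact: tempered_coord].
Qed.

Let tempered_S a : tempered (S a).
Proof. by apply: temperedD; apply: temperedM. Qed.

Let den_gt0 (a : V) (e : R) (x : V) : 0 < e -> 0 < dotv a x ^+ 2 + e.
Proof. by move=> e0; rewrite ltr_wpDl // sqr_ge0. Qed.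

Let tempered_ratio a (e : R) : 0 < e -> tempered (rat a e).
Proof.
move=> e0; apply: (@le_tempered _ _ _ (fun x => e^-1 * (1 + dotv a x ^+ 2))).
- apply: vmeasM; first exact: vmeas_dotv.
  apply: (@eq_vmeas _ _ (fun x => (dotv a x ^+ 2 + e) `^ (-1))).
    by move=> x; rewrite powR_inv1 // ltW // den_gt0.
  apply: (@vmeas_comp _ _ (fun t => t `^ (-1))); first exact: measurable_powR.
  by apply: vmeasD; [apply: vmeasX; exact: vmeas_dotv|exact: vmeas_cst].
- apply: temperedM; first exact: tempered_cst.
  by apply: temperedD; [exact: tempered_cst|apply: temperedX; exact: tempered_dotv].
move=> x; rewrite /rat normrM normfV (gtr0_norm (den_gt0 a x e0)) mulrC.
apply: ler_pM => //.
- by rewrite invr_ge0 ltW // den_gt0.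
- by rewrite lef_pV2 ?posrE ?den_gt0 // lerDr sqr_ge0.
rewrite -(real_normK (num_real (dotv a x))).
have : 0 <= (`|dotv a x| - 1) ^+ 2 by exact: sqr_ge0.
have := normr_ge0 (dotv a x); nra.
Qed.

Let tempered_ratio2 a (e : R) : 0 < e -> tempered (fun x => dotv a x * rat a e x).
Proof. by move=> e0; apply: temperedM; [exact: tempered_dotv|exact: tempered_ratio]. Qed.

Let E (x : V) : R := expR (- norm2 x).

Let tame_wE F (e : R) : 0 <= e -> tempered F -> tame (fun x => F x * (wprod e x * E x)).
Proof.
move=> e0 tF; have := tempered_gauss_tame (temperedM tF (tempered_wprod e0)).
by apply: eq_tame => x; rewrite mulrA.
Qed.

(* The reflection [refl a] flips the sign of [rat a e] and fixes everything else. *)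
Let odd_part a (e : R) : a \in Rp -> 0 < e ->
  Rv (fun x => (2 * (f x * g x) * rat a e x) * (wprod e x * E x)) =
  Rv (fun x => (S a x * (dotv a x * rat a e x)) * (wprod e x * E x)).
Proof.
move=> aR e0; have aRs := positive_root aR; have a0 := root_neq0 aRs.
(* [psi] is invariant under the reflection, so [psi] times [rat] is odd and integrates to 0.
   Replacing the reflected values by difference quotients gives psi = 2 f g - <a,x> [S a]. *)
pose psi x := f (refl a x) * g x + f x * g (refl a x).
have tpsi : tempered psi.
  by apply: temperedD; apply: temperedM => //; exact: tempered_refl.
have tr := tempered_ratio a e0.
pose K x := (psi x * rat a e x) * (wprod e x * E x).
have tK : tame K by apply: tame_wE; [exact: ltW|exact: temperedM].
have KN x : K (refl a x) = - K x.
  rewrite /K /psi /rat /E norm2_refl // wprod_refl ?ltW // reflK // refl_dotvv // sqrrN.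
  ring.
have : Rv K = 0.
  have := Rv_refl a0 tK; rewrite (eq_Rv KN) RvN // => H.
  have {}H := H (eq_tame (fun x => esym (KN x)) (tameN tK)); lra.
rewrite (eq_Rv (G := fun x => (2 * (f x * g x) * rat a e x) * (wprod e x * E x) -
   (S a x * (dotv a x * rat a e x)) * (wprod e x * E x))); last first.
  move=> x; have := qfE x aR; have := qgE x aR.
  rewrite /K /psi /S => Hg Hf.
  have -> : f (refl a x) = f x - dotv a x * qf a x by rewrite -Hf; ring.
  have -> : g (refl a x) = g x - dotv a x * qg a x by rewrite -Hg; ring.
  ring.
rewrite RvB; first by move/eqP; rewrite subr_eq0 => /eqP.
  apply: tame_wE; first exact: ltW.
  by apply: temperedM => //; apply: temperedM; [exact: tempered_cst|exact: temperedM].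
apply: tame_wE; first exact: ltW.
by apply: temperedM; [exact: tempered_S|exact: tempered_ratio2].
Qed.

(** The integral of the partial derivative of f g [wprod e] [E] vanishes by [Rv_partial]. Its terms
    2 f g [rat a e] have no bound uniform in e; [odd_part] exchanges each of them, after
    integration, for [S a] times <a,x> [rat a e], which has one by [ratio_le1]. *)
Let smooth_identity (e : R) : 0 < e ->
  Rv (fun x => (L x + \sum_(a <- Rp) kappa a * a 0 i * (S a x * (dotv a x * rat a e x)))
     * (wprod e x * E x)) = 0.
Proof.
move=> e0; have e0' := ltW e0.
pose Q x := L x + \sum_(a <- Rp) 2 * kappa a * a 0 i * rat a e x * (f x * g x).
have dota a : dotv a (unitv R i) = a 0 i.
  rewrite /dotv (bigD1 i) //= big1 ?addr0 ?mxE ?eqxx ?mulr1 // => k ki.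
  by rewrite mxE (negbTE ki) andbF mulr0.
have tQs a : tempered (fun x => 2 * kappa a * a 0 i * rat a e x * (f x * g x)).
  by apply: temperedM; [apply: temperedM; [exact: tempered_cst|exact: tempered_ratio]|exact: temperedM].
have tQ : tempered Q by apply: temperedD => //; exact: tempered_sum.
have bd F : tempered F -> vmeas (fun x => F x * (wprod e x * E x)) /\ bounded8 (fun x => F x * (wprod e x * E x)).
  move=> tF; split; first by have [+ _] := tame_wE e0' tF.
  have := tempered_gauss_bounded8 (temperedM tF (tempered_wprod e0')).
  by rewrite (_ : (fun x => _) = (fun x => F x * (wprod e x * E x))) //; apply/funext => x; rewrite mulrA.
have [mF bF] := bd _ (temperedM tf tg).
have [mG bG] := bd _ tQ.
have Q0 : Rv (fun x => Q x * (wprod e x * E x)) = 0.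
  apply: (Rv_partial (i := i) mF bF mG bG) => x.
  have D := is_deriveMr (is_deriveMr (df x) (dg x))
    (is_deriveMr (is_derive_wprod x (unitv R i) e0) (is_derive_gauss x (unitv R i))).
  refine (is_derive_eq D _); rewrite !dota /Q /L.
  under eq_bigr do rewrite dota.
  rewrite -/(E x) -mulr_suml /rat; ring.
move: Q0.
rewrite (eq_Rv (G := fun x => L x * (wprod e x * E x) + \sum_(a <- Rp) kappa a * a 0 i *
    ((2 * (f x * g x) * rat a e x) * (wprod e x * E x)))); last first.
  move=> x; rewrite /Q mulrDl; congr (_ + _); rewrite mulr_suml; apply: eq_bigr => a _; ring.
have tA a : tame (fun x => (2 * (f x * g x) * rat a e x) * (wprod e x * E x)).
  apply: tame_wE => //; apply: temperedM => //; last exact: tempered_ratio.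
  by apply: temperedM; [exact: tempered_cst|exact: temperedM].
have tB a : tame (fun x => (S a x * (dotv a x * rat a e x)) * (wprod e x * E x)).
  by apply: tame_wE => //; apply: temperedM; [exact: tempered_S|exact: tempered_ratio2].
rewrite RvD; last 2 first.
- exact: tame_wE.
- by apply: tame_sum => a; exact: tameZ.
rewrite Rv_sum; last by move=> a; exact: tameZ.
rewrite (eq_big_seq (fun a => Rv (fun x => kappa a * a 0 i *
    ((S a x * (dotv a x * rat a e x)) * (wprod e x * E x))))); last first.
  by move=> a aR; rewrite !RvZ ?odd_part.
rewrite -Rv_sum; last by move=> a; exact: tameZ.
rewrite -RvD; last 2 first.
- exact: tame_wE.
- by apply: tame_sum => a; exact: tameZ.
move=> H; rewrite -[RHS]H; apply: eq_Rv => x; rewrite [LHS]mulrDl mulr_suml.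
by congr (_ + _); apply: eq_bigr => a _; ring.
Qed.

Let ratio_le1 a (e : R) x : 0 < e -> `|dotv a x * rat a e x| <= 1.
Proof.
move=> e0; have D0 := den_gt0 a x e0; rewrite /rat mulrA -expr2 ger0_norm.
  by rewrite ler_pdivrMr // mul1r lerDl ltW.
by rewrite divr_ge0 ?sqr_ge0 // ltW.
Qed.

(** Off the hyperplane <a,x> [rat] tends to 1. On it this product stays 0, but the expected limit is
    0 as well: either kappa(a) = 0, or the weight vanishes there by [wprod_root0]. *)
Let cvg_term a x : a \in Rp ->
  kappa a * (dotv a x * rat a (harmonic n) x * wprod (harmonic n) x) @[n --> \oo] -->
  kappa a * wprod 0 x.
Proof.
move=> aR; have [ax|ax] := eqVneq (dotv a x) 0.
  rewrite ax; under eq_cvg do rewrite !mul0r mulr0.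
  have [->|ka] := eqVneq (kappa a) 0; first by rewrite mul0r; exact: cvg_cst.
  by rewrite (wprod_root0 aR ka ax) mulr0; exact: cvg_cst.
have ax2 : dotv a x ^+ 2 != 0 by rewrite sqrf_eq0.
apply: cvgM; first exact: cvg_cst.
rewrite -[X in _ --> X]mul1r; apply: cvgM; last exact: cvg_wprod.
under eq_cvg do rewrite /rat mulrA -expr2.
have cvd : dotv a x ^+ 2 + harmonic n @[n --> \oo] --> dotv a x ^+ 2 + 0.
  by apply: cvgD; [exact: cvg_cst|exact: cvg_harmonic].
rewrite addr0 in cvd.
have := cvgM (cvg_cst (dotv a x ^+ 2)) (cvgV ax2 cvd).
by rewrite divff //; apply.
Qed.

(** The limit of [smooth_identity] along e = [harmonic n], by dominated convergence. As [harmonic n]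
    is at most 1 and [wprod] increases with e, [wprod 1] bounds all the weights. *)
Lemma Rv_dunkl_antisymmetric :
  Rv (fun x => ((f' x + \sum_(a <- Rp) kappa a * a 0 i * qf a x) * g x +
     f x * (g' x + \sum_(a <- Rp) kappa a * a 0 i * qg a x) -
     2 * x 0 i * (f x * g x)) * wgauss x) = 0.
Proof.
pose F (n : nat) x := (L x + \sum_(a <- Rp) kappa a * a 0 i *
   (S a x * (dotv a x * rat a (harmonic n) x))) * (wprod (harmonic n) x * E x).
pose G x := (L x + \sum_(a <- Rp) kappa a * a 0 i * S a x) * wgauss x.
pose H x := (`|L x| + \sum_(a <- Rp) `|kappa a * a 0 i| * `|S a x|) * (wprod 1 x * E x).
have nF (K : V -> R) : tempered K -> tempered (fun x => `|K x|).
  move=> [mK KC]; split; first exact: measurableT_comp.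
  by move=> e e0; have [C {}KC] := KC e e0; exists C => x; rewrite normr_id.
have tH : tame H.
  apply: tame_wE; first exact: ler01.
  apply: temperedD; first exact: nF.
  by apply: tempered_sum => a; apply: temperedM; [exact: tempered_cst|exact: nF].
have tF n : tame (F n).
  have h0 : 0 < harmonic n :> R := harmonic_gt0 n.
  apply: tame_wE; first exact: ltW.
  apply: temperedD => //; apply: tempered_sum => a.
  apply: temperedM; first exact: tempered_cst.
  by apply: temperedM; [exact: tempered_S|exact: tempered_ratio2].
have tG : tame G.
  apply: tempered_wgauss_tame; apply: temperedD => //; apply: tempered_sum => a.
  by apply: temperedM; [exact: tempered_cst|exact: tempered_S].
have FH n x : `|F n x| <= H x.
  have h0 : 0 < harmonic n :> R := harmonic_gt0 n.
  rewrite /F /H normrM; apply: ler_pM => //.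
    rewrite (le_trans (ler_normD _ _)) // lerD2l (le_trans (ler_norm_sum _ _ _)) //.
    apply: ler_sum => a _; rewrite normrM ler_wpM2l // normrM ler_piMr // ratio_le1 //.
  rewrite ger0_norm ?mulr_ge0 ?wprod_ge0 ?expR_ge0 // ler_wpM2r ?expR_ge0 //.
  by apply: le_wprod; [exact: ltW|rewrite invf_le1 // ler1n].
have FG x : F ^~ x @ \oo --> G x.
  rewrite /F /G /wgauss.
  have -> : (L x + \sum_(a <- Rp) kappa a * a 0 i * S a x) * (wprod 0 x * expR (- norm2 x)) =
    L x * E x * wprod 0 x + \sum_(a <- Rp) (a 0 i * S a x * E x) * (kappa a * wprod 0 x).
    rewrite mulrDl mulr_suml; congr (_ + _); first by rewrite /E; ring.
    by apply: eq_bigr => a _; rewrite /E; ring.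
  rewrite (_ : (fun n => _) = (fun n : nat => L x * E x * wprod (harmonic n) x +
     \sum_(a <- Rp) (a 0 i * S a x * E x) *
      (kappa a * (dotv a x * rat a (harmonic n) x * wprod (harmonic n) x)))); last first.
    apply/funext => n; rewrite mulrDl mulr_suml; congr (_ + _); first by ring.
    by apply: eq_bigr => a _; ring.
  apply: cvgD; first by apply: cvgM; [exact: cvg_cst|exact: cvg_wprod].
  (* The induction runs over the list of the sums only; inclusion in [Rp] is carried along because
     [cvg_term] asks for a positive root. *)
  have : {subset Rp <= Rp} by [].
  elim: {1 3 4}Rp => [_|a s IH sR].
    by rewrite big_nil; under eq_cvg do rewrite big_nil; exact: cvg_cst.
  rewrite big_cons; under eq_cvg do rewrite big_cons.
  apply: cvgD; last by apply: IH => b bs; apply: sR; rewrite inE bs orbT.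
  by apply: cvgM; [exact: cvg_cst|apply: cvg_term; apply: sR; rewrite mem_head].
have cv := @Rv_cvg R d F G H (fun n => (tF n).1) tH FH FG tG.1.
have F0 : Rv \o F = cst 0.
  by apply/funext => n /=; rewrite /F smooth_identity //; exact: harmonic_gt0.
rewrite F0 in cv.
transitivity (Rv G); last by have /cvg_unique := cv; apply => //; exact: cvg_cst.
apply: eq_Rv => x; rewrite /G /L; congr (_ * _).
have -> : \sum_(a <- Rp) kappa a * a 0 i * S a x =
  (\sum_(a <- Rp) kappa a * a 0 i * qf a x) * g x +
  f x * (\sum_(a <- Rp) kappa a * a 0 i * qg a x).
  rewrite mulr_suml mulr_sumr -big_split; apply: eq_bigr => a _ /=; rewrite /S; ring.
ring.
Qed.

End antisymmetry.

End roots.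

(** * Density of the polynomials *)

Section exp_partial_sums.
Context {R : realType}.

Definition exp_sum n (x : R) : R := series (exp_coeff x) n.

Lemma cvg_exp_sum x : exp_sum n x @[n --> \oo] --> expR x.
Proof. exact: is_cvg_series_exp_coeff. Qed.

Lemma exp_sum_le n x : `|exp_sum n x| <= expR `|x|.
Proof.
apply: (@le_trans _ _ (exp_sum n `|x|)).
  rewrite /exp_sum /series /= (le_trans (ler_norm_sum _ _ _)) // ler_sum // => i _.
  by rewrite /exp_coeff /= normrM normrX normfV (ger0_norm (ler0n _ _)).
apply: (@nondecreasing_cvgn_le R (exp_sum ^~ `|x|)).
  apply/nondecreasing_seqP => m; rewrite /exp_sum /series /= big_nat_recr //= lerDl.
  by rewrite exp_coeff_ge0.
exact: is_cvg_series_exp_coeff.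
Qed.

End exp_partial_sums.

Section density.
Context {R : realType} {d : nat}.
Local Notation V := 'rV[R]_d.
Local Notation mu := (@tuple_measure R d).

Inductive rpoly : (V -> R) -> Prop :=
| rpoly_cst c : rpoly (fun=> c)
| rpoly_coord i : rpoly (fun x => x 0 i)
| rpolyD p q : rpoly p -> rpoly q -> rpoly (fun x => p x + q x)
| rpolyM p q : rpoly p -> rpoly q -> rpoly (fun x => p x * q x).

Lemma rpoly_tempered p : rpoly p -> tempered p.
Proof.
elim=> [c|i|p' q _ tp _ tq|p' q _ tp _ tq].
- exact: tempered_cst.
- exact: tempered_coord.
- exact: temperedD.
- exact: temperedM.
Qed.

Lemma eq_rpoly p q : p =1 q -> rpoly p -> rpoly q.
Proof. by move=> /funext ->. Qed.

Lemma rpolyX p n : rpoly p -> rpoly (fun x => p x ^+ n).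
Proof.
move=> rp; elim: n => [|n IH].
  by apply: eq_rpoly (rpoly_cst 1) => x; rewrite expr0.
by apply: eq_rpoly (rpolyM rp IH) => x; rewrite exprS.
Qed.

Lemma rpoly_sum I (s : seq I) (p : I -> V -> R) : (forall i, rpoly (p i)) ->
  rpoly (fun x => \sum_(i <- s) p i x).
Proof.
move=> rp; elim: s => [|i s IH].
  by apply: eq_rpoly (rpoly_cst 0) => x; rewrite big_nil.
by apply: eq_rpoly (rpolyD (rp i) IH) => x; rewrite big_cons.
Qed.

Variable w : V -> R.
Hypothesis w0 : forall x, 0 <= w x.
Hypothesis mw : vmeas w.
Hypothesis tw : forall F, tempered F -> tame (fun x => F x * expR (norm2 x / 4) * w x).

Definition wnorm2 (F : V -> R) : \bar R := vint (fun x => (w x * F x ^+ 2)%:E).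

Definition poly_limit (F : V -> R) := vmeas F /\
  forall e, 0 < e -> exists2 p, rpoly p & (wnorm2 (fun x => F x - p x)%R < e%:E)%E.

Lemma vemeas_w F : vmeas F -> vemeas (fun x => (w x * F x ^+ 2)%:E).
Proof. by move=> mF; apply: vmeasE; apply: vmeasM => //; exact: vmeasX. Qed.

Lemma wint_ge0 F x : (0 <= (w x * F x ^+ 2)%:E)%E.
Proof. by rewrite lee_fin mulr_ge0 // sqr_ge0. Qed.

(** Norms stay squared, so (F + G)^2 <= 2 F^2 + 2 G^2 takes the place of the triangle inequality.
    This is where the tolerances e / 4 below come from. *)
Lemma wnorm2D F G : vmeas F -> vmeas G ->
  (wnorm2 (fun x => F x + G x)%R <= 2%:E * wnorm2 F + 2%:E * wnorm2 G)%E.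
Proof.
move=> mF mG; rewrite -!ge0_integralZl_EFin //; last 4 first.
- by move=> t _; exact: wint_ge0.
- exact: vemeas_w.
- by move=> t _; exact: wint_ge0.
- exact: vemeas_w.
have mZ K : vmeas K -> measurable_fun setT (fun t => (2%:E * (w (tv t) * K (tv t) ^+ 2)%:E)%E).
  by move=> mK; apply: emeasurable_funM => //; exact: vemeas_w.
rewrite -ge0_integralD //; last 4 first.
- by move=> t _; rewrite mule_ge0 ?wint_ge0.
- exact: mZ.
- by move=> t _; rewrite mule_ge0 ?wint_ge0.
- exact: mZ.
apply: ge0_le_integral => //.
- by move=> t _; exact: (@wint_ge0 (fun x => F x + G x)).
- by apply: (@vemeas_w (fun x => F x + G x)); exact: vmeasD.
- by apply: emeasurable_funD; exact: mZ.
move=> t _; rewrite -!EFinM -EFinD lee_fin.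
rewrite [X in _ <= X](_ : _ = w (tv t) * (2 * (F (tv t) ^+ 2 + G (tv t) ^+ 2))); last by ring.
rewrite ler_wpM2l //.
have : 0 <= (F (tv t) - G (tv t)) ^+ 2 by exact: sqr_ge0.
nra.
Qed.

Lemma lt_quarters (a b : \bar R) (e : R) :
  (a < (e / 4)%:E -> b < (e / 4)%:E -> 2%:E * a + 2%:E * b < e%:E)%E.
Proof.
move=> ae be; have -> : e%:E = (2%:E * (e / 4)%:E + 2%:E * (e / 4)%:E)%E.
  by rewrite -!EFinM -EFinD; congr EFin; lra.
by apply: lteD; rewrite lte_pmul2l // lte_fin.
Qed.

Lemma wnorm2_cvg0 (F : nat -> V -> R) (H : V -> R) :
  (forall n, vmeas (F n)) -> vmeas H -> (forall n x, `|F n x| <= H x) ->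
  (wnorm2 H < +oo)%E -> (forall x, F ^~ x @ \oo --> 0) ->
  forall e, 0 < e -> exists n, (wnorm2 (F n) < e%:E)%E.
Proof.
move=> mF mH FH Hoo F0 e e0.
have := @dominated_convergence _ _ _ mu setT measurableT
  (fun n t => (w (tv t) * F n (tv t) ^+ 2)%:E) (cst 0%E)
  (fun t => (w (tv t) * H (tv t) ^+ 2)%:E).
case.
- by move=> n; exact: vemeas_w.
- exact: measurable_cst.
- apply: aeW => t _; apply: cvg_EFin; first exact: nearW.
  have cvw : w (tv t) * (F n (tv t) * F n (tv t)) @[n --> \oo] --> w (tv t) * (0 * 0).
    by apply: cvgM; [exact: cvg_cst|apply: cvgM; exact: F0].
  rewrite !mulr0 in cvw; apply: cvg_trans cvw; apply: near_eq_cvg.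
  by apply: nearW => n /=; rewrite expr2.
- apply/integrableP; split; first exact: vemeas_w.
  by under eq_integral do rewrite gee0_abs ?wint_ge0 //.
- apply: aeW => t n _; rewrite gee0_abs ?wint_ge0 // lee_fin ler_wpM2l //.
  rewrite -real_normK ?num_real // lerXn2r ?nnegrE //.
  exact: le_trans (FH n _).
move=> _ _; rewrite integral0 => /fine_cvgP[fin cv].
have /cvgrPdist_lt /(_ e e0) := cv.
move=> H1; have [n _ Hn] : \forall n \near \oo, (wnorm2 (F n) < e%:E)%E.
  near=> n; have fn : wnorm2 (F n) \is a fin_num by near: n.
  rewrite -(fineK fn) lte_fin.
  have : `|0 - fine (wnorm2 (F n))| < e by near: n.
  by rewrite sub0r normrN; apply: le_lt_trans; exact: ler_norm.
by exists n; apply: Hn => /=.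
Unshelve. all: end_near. Qed.

(** The factor exp(|x|^2 / 8) bounds all partial sums of the series of exp(-x_j^2 / 8). Its square
    is the factor exp(|x|^2 / 4) for which [tw] leaves room. *)
Lemma wnorm2_tempered F : tempered F ->
  (wnorm2 (fun x => F x * expR (norm2 x / 8))%R < +oo)%E.
Proof.
move=> tF; have tF2 := tw (temperedX 2 tF).
rewrite /wnorm2.
have -> : (fun x => (w x * (F x * expR (norm2 x / 8)) ^+ 2)%:E) =
  (fun x => (F x ^+ 2 * expR (norm2 x / 4) * w x)%:E).
  apply/funext => x; congr EFin; rewrite exprMn [w x * _]mulrC -expRM_natl.
  by congr (_ * expR _ * _); field.
by rewrite vint_tame // ltry.
Qed.

(** Dominated pointwise convergence gives convergence in norm, so one term of the sequence is close
    to F, and a polynomial is close to that term. *)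
Lemma poly_limit_trans F (Fn : nat -> V -> R) H :
  vmeas F -> (forall n, poly_limit (Fn n)) -> vmeas H ->
  (forall n x, `|F x - Fn n x| <= H x) -> (wnorm2 H < +oo)%E ->
  (forall x, Fn ^~ x @ \oo --> F x) -> poly_limit F.
Proof.
move=> mF lFn mH FH Hoo cv; split=> // e e0.
have e4 : 0 < e / 4 by rewrite divr_gt0.
have mFn n : vmeas (fun x => F x - Fn n x) by apply: vmeasB => //; exact: (lFn n).1.
have cF x : (fun n => F x - Fn n x) @ \oo --> (0 : R).
  by rewrite -(subrr (F x)); apply: cvgB; [exact: cvg_cst|exact: cv].
have [n Hn] := wnorm2_cvg0 mFn mH FH Hoo cF e4.
have [p rp Hp] := (lFn n).2 _ e4; exists p => //.
rewrite (_ : (fun x => F x - p x) = (fun x => (F x - Fn n x) + (Fn n x - p x))); last first.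
  by apply/funext => x; rewrite addrA subrK.
have mp := (rpoly_tempered rp).1.
apply: le_lt_trans (wnorm2D _ _) _; [exact: vmeasB mF (lFn n).1|exact: vmeasB (lFn n).1 mp|].
exact: lt_quarters.
Qed.

Lemma poly_limit_rpoly p : rpoly p -> poly_limit p.
Proof.
move=> rp; split; first exact: (rpoly_tempered rp).1.
move=> e e0; exists p => //; rewrite /wnorm2 /vint integral0_eq ?lte_fin // => t _.
by rewrite subrr expr0n mulr0.
Qed.

Lemma poly_limitD F G : poly_limit F -> poly_limit G -> poly_limit (fun x => F x + G x).
Proof.
move=> [mF lF] [mG lG]; split; first exact: vmeasD.
move=> e e0; have e4 : 0 < e / 4 by rewrite divr_gt0.
have [p rp Hp] := lF _ e4; have [q rq Hq] := lG _ e4.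
exists (fun x => p x + q x); first exact: rpolyD.
rewrite (_ : (fun x => _) = (fun x => (F x - p x) + (G x - q x))); last first.
  by apply/funext => x; ring.
have mp := (rpoly_tempered rp).1; have mq := (rpoly_tempered rq).1.
apply: le_lt_trans (wnorm2D _ _) _; [exact: vmeasB|exact: vmeasB|].
exact: lt_quarters.
Qed.

(* Bounded multipliers of the closure of the polynomials: an algebra closed
   under bounded pointwise limits. *)
Definition multiplier (f : V -> R) := [/\ vmeas f, exists c, forall x, `|f x| <= c &
  forall q, rpoly q -> poly_limit (fun x => f x * q x)].

Lemma eq_multiplier f g : f =1 g -> multiplier f -> multiplier g.
Proof. by move=> /funext ->. Qed.

Lemma multiplier_cst c : multiplier (fun=> c).
Proof.
split; first exact: vmeas_cst; first by exists `|c|.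
move=> q rq.
by apply: poly_limit_rpoly; apply: rpolyM => //; exact: rpoly_cst.
Qed.

Lemma multiplierD f g : multiplier f -> multiplier g -> multiplier (fun x => f x + g x).
Proof.
move=> [mf [c fc] lf] [mg [b gb] lg]; split; first exact: vmeasD.
  by exists (c + b) => x; rewrite (le_trans (ler_normD _ _)) // lerD.
move=> q rq; rewrite (_ : (fun x => _) = (fun x => f x * q x + g x * q x)).
  by apply: poly_limitD; [exact: lf|exact: lg].
by apply/funext => x; rewrite mulrDl.
Qed.

(** The function g q is only a limit of polynomials r, so f is applied to such an r: f r is again
    close to a polynomial, and f (g q - r) is small because f is bounded. *)
Lemma multiplierM f g : multiplier f -> multiplier g -> multiplier (fun x => f x * g x).
Proof.
move=> [mf [c fc] lf] [mg [b gb] lg]; split; first exact: vmeasM.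
  by exists (c * b) => x; rewrite normrM ler_pM.
move=> q rq; have [mgq lgq] := lg _ rq.
have c0 : 0 <= c := le_trans (normr_ge0 _) (fc 0).
split; first by apply: vmeasM; [exact: vmeasM|exact: (rpoly_tempered rq).1].
(* Multiplication by f costs at most c^2, and (c^2 + 1) (e / K) = e / 4. The summand 1 keeps K
   positive when c = 0. *)
move=> e e0; pose K := 4 * (c ^+ 2 + 1).
have c2 : 0 <= c ^+ 2 by exact: sqr_ge0.
have K0 : 0 < K by rewrite mulr_gt0 // ltr_wpDl.
have eK : 0 < e / K by rewrite divr_gt0.
have e4 : 0 < e / 4 by rewrite divr_gt0.
have [r rr Hr] := lgq _ eK; have [_ lfr] := lf _ rr; have [p rp Hp] := lfr _ e4.
exists p => //.
rewrite (_ : (fun x => _) = (fun x => f x * (g x * q x - r x) + (f x * r x - p x))); last first.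
  by apply/funext => x; ring.
have mp := (rpoly_tempered rp).1; have mq := (rpoly_tempered rq).1; have mr := (rpoly_tempered rr).1.
apply: le_lt_trans (wnorm2D _ _) _.
- by apply: vmeasM => //; exact: vmeasB.
- by apply: vmeasB => //; exact: vmeasM.
apply: lt_quarters => //.
apply: (@le_lt_trans _ _ ((c ^+ 2)%:E * wnorm2 (fun x => g x * q x - r x)%R)%E).
  rewrite -ge0_integralZl_EFin //; last 2 first.
  - by move=> t _; exact: (@wint_ge0 (fun x => g x * q x - r x)).
  - by apply: (@vemeas_w (fun x => g x * q x - r x)); exact: vmeasB.
  apply: ge0_le_integral => //.
  - by move=> t _; exact: (@wint_ge0 (fun x => f x * (g x * q x - r x))).
  - by apply: (@vemeas_w (fun x => f x * (g x * q x - r x))); apply: vmeasM => //; exact: vmeasB.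
  - by apply: emeasurable_funM => //; apply: (@vemeas_w (fun x => g x * q x - r x)); exact: vmeasB.
  move=> t _; rewrite -EFinM lee_fin exprMn mulrCA ler_wpM2r //.
    by rewrite mulr_ge0 // sqr_ge0.
  by rewrite -real_normK ?num_real // lerXn2r ?nnegrE.
apply: (@le_lt_trans _ _ ((c ^+ 2 + 1)%:E * wnorm2 (fun x => g x * q x - r x)%R)%E).
  rewrite lee_wpmul2r ?lee_fin ?lerDl //.
  by apply: integral_ge0 => t _; exact: (@wint_ge0 (fun x => g x * q x - r x)).
rewrite (_ : e / 4 = (c ^+ 2 + 1) * (e / K)); last by rewrite /K; field; rewrite gt_eqF // ltr_wpDl.
by rewrite EFinM lte_pmul2l // lte_fin ltr_wpDl.
Qed.

Lemma multiplier_lim f (fn : nat -> V -> R) c : (forall n, multiplier (fn n)) ->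
  (forall n x, `|fn n x| <= c) -> (forall x, fn ^~ x @ \oo --> f x) -> multiplier f.
Proof.
move=> mfn fnc cv.
have mf : vmeas f.
  apply: (@measurable_fun_cvg _ _ _ _ (fun n t => fn n (tv t))); last by move=> t _; exact: cv.
  by move=> n; have [] := mfn n.
have fc x : `|f x| <= c.
  have cvn : `|fn n x| @[n --> \oo] --> `|f x| by apply: cvg_norm; exact: cv.
  by apply: (cvgr_to_le cvn); apply: nearW => n; exact: fnc.
split=> //; first by exists c.
move=> q rq; have tq := rpoly_tempered rq.
apply: (@poly_limit_trans _ (fun n x => fn n x * q x) (fun x => (2 * c * `|q x|) * expR (norm2 x / 8))).
- by apply: vmeasM => //; exact: tq.1.
- by move=> n; have [_ _] := mfn n; apply.
- apply: vmeasM; first by apply: vmeasM; [exact: vmeas_cst|apply: measurableT_comp => //; exact: tq.1].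
  apply: (vmeas_comp (@measurable_expR R)).
  by apply: vmeasM; [exact: vmeas_norm2|exact: vmeas_cst].
- move=> n x; rewrite -mulrBl normrM.
  apply: (@le_trans _ _ (2 * c * `|q x|)).
    rewrite ler_wpM2r // (le_trans (ler_normB _ _)) // mulr2n mulrDl !mul1r lerD //.
  rewrite ler_peMr //.
    by rewrite !mulr_ge0 // (le_trans (normr_ge0 _) (fc x)).
  by rewrite -expR0 ler_expR divr_ge0 // norm2_ge0.
- apply: wnorm2_tempered; apply: temperedM; first exact: tempered_cst.
  have [mq qC] := tq; split; first exact: measurableT_comp.
  by move=> e e0; have [C H] := qC e e0; exists C => x; rewrite normr_id.
- by move=> x; apply: cvgM; [exact: cv|exact: cvg_cst].
Qed.

Lemma multiplier_sum I (s : seq I) (f : I -> V -> R) : (forall i, multiplier (f i)) ->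
  multiplier (fun x => \sum_(i <- s) f i x).
Proof.
move=> mf; elim: s => [|i s IH].
  by apply: eq_multiplier (multiplier_cst 0) => x; rewrite big_nil.
by apply: eq_multiplier (multiplierD (mf i) IH) => x; rewrite big_cons.
Qed.

Lemma multiplierX f n : multiplier f -> multiplier (fun x => f x ^+ n).
Proof.
move=> mf; elim: n => [|n IH].
  by apply: eq_multiplier (multiplier_cst 1) => x; rewrite expr0.
by apply: eq_multiplier (multiplierM mf IH) => x; rewrite exprS.
Qed.

Lemma multiplier_expR f : multiplier f -> multiplier (fun x => expR (f x)).
Proof.
move=> mf; have [_ [c fc] _] := mf.
apply: (@multiplier_lim _ (fun n x => exp_sum n (f x)) (expR c)).
- move=> n; apply: multiplier_sum => i; rewrite /exp_coeff /=.
  by apply: multiplierM; [exact: multiplierX|exact: multiplier_cst].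
- by move=> n x; rewrite (le_trans (exp_sum_le _ _)) // ler_expR.
- by move=> x; exact: cvg_exp_sum.
Qed.

Lemma multiplier_gt f c : multiplier f -> multiplier (fun x => (c < f x)%R%:R).
Proof.
move=> mf.
(* If c < f x then [y n x] tends to minus infinity and exp(-exp(y)) to 1. If f x <= c then [y n x]
   is at least n and exp(-exp(y)) tends to 0; the summand n is what decides the case f x = c. *)
pose y n x : R := - (n%:R ^+ 2 * (f x - c)) + n%:R.
apply: (@multiplier_lim _ (fun n x => expR (- expR (y n x))) 1).
- move=> n; apply: multiplier_expR.
  apply: (@eq_multiplier (fun x => -1 * expR (y n x))); first by move=> x; rewrite mulN1r.
  apply: multiplierM; first exact: multiplier_cst.
  apply: multiplier_expR; apply: (@eq_multiplier (fun x => - n%:R ^+ 2 * f x + (n%:R ^+ 2 * c + n%:R))).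
    by move=> x; rewrite /y; ring.
  by apply: multiplierD; [apply: multiplierM => //; exact: multiplier_cst|exact: multiplier_cst].
- by move=> n x; rewrite ger0_norm ?expR_ge0 // -expR0 ler_expR oppr_le0 expR_ge0.
move=> x; have [cf|fc] := ltP c (f x).
  rewrite mulr1n -[X in _ --> X]expR0.
  have d0 : 0 < f x - c by rewrite subr_gt0.
  have cv0 : expR (y n x) @[n --> \oo] --> (0 : R).
    apply: (squeeze_cvgr (f := fun=> 0) (h := fun n : nat => expR (- n%:R))); last 2 first.
    - exact: cvg_cst.
    - exact: cvgn_expR.
    near=> n; rewrite expR_ge0 ler_expR /y.
    have nd : 2 <= n%:R * (f x - c).
      rewrite -ler_pdivrMr // ltW //; near: n; exact: nbhs_infty_gtr.
    have n0 : 0 <= n%:R :> R by [].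
    have : 2 * n%:R <= n%:R * (f x - c) * n%:R by rewrite ler_wpM2r.
    nra.
  have cvN : - expR (y n x) @[n --> \oo] --> (0 : R).
    by rewrite -[X in _ --> X]oppr0; exact: cvgN.
  exact: (cvg_comp _ _ cvN (@continuous_expR R 0)).
rewrite mulr0n.
apply: (squeeze_cvgr (f := fun=> 0) (h := fun n : nat => expR (- n%:R))); last 2 first.
- exact: cvg_cst.
- exact: cvgn_expR.
apply: nearW => n; rewrite expR_ge0 ler_expR lerN2.
apply: le_trans (expR_ge1Dx _); rewrite /y.
have : 0 <= n%:R ^+ 2 * (c - f x) by rewrite mulr_ge0 ?sqr_ge0 // subr_ge0.
lra.
Unshelve. all: end_near.
Qed.

(** The Gaussian factor makes x_j - c bounded without changing its sign, so that [multiplier_gt] at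
    0 yields the indicator of a half-space. The partial sums of the exponential series are
    polynomials, dominated through x_j^2 <= |x|^2. *)
Lemma multiplier_coord j c :
  multiplier (fun x => (x 0 j - c) * expR (- (x 0 j ^+ 2 / 8))).
Proof.
have tl : tempered (fun x : V => x 0 j - c).
  by apply: temperedB; [exact: tempered_coord|exact: tempered_cst].
have me : vmeas (fun x : V => expR (- (x 0 j ^+ 2 / 8))).
  apply: (vmeas_comp (@measurable_expR R)).
  apply: (@eq_vmeas _ _ (fun x => - (8^-1) * x 0 j ^+ 2)); first by move=> x; rewrite mulNr mulrC.
  by apply: vmeasM; [exact: vmeas_cst|apply: vmeasX; exact: vmeas_coord].
have mv : vmeas (fun x : V => (x 0 j - c) * expR (- (x 0 j ^+ 2 / 8))).
  by apply: vmeasM => //; exact: tl.1.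
split=> //.
  exists (8 + `|c|) => x; rewrite normrM (ger0_norm (expR_ge0 _)) expRN.
  rewrite ler_pdivrMr ?expR_gt0 //.
  apply: (@le_trans _ _ ((8 + `|c|) * (1 + x 0 j ^+ 2 / 8))); last first.
    by rewrite ler_wpM2l ?expR_ge1Dx // addr_ge0.
  rewrite (le_trans (ler_normB _ _)) // -(real_normK (num_real (x 0 j))).
  have := normr_ge0 (x 0 j); have := normr_ge0 c.
  have : 0 <= (`|x 0 j| - 1) ^+ 2 by exact: sqr_ge0.
  have : 0 <= `|x 0 j| ^+ 2 by exact: sqr_ge0.
  nra.
move=> q rq; have tq := rpoly_tempered rq.
apply: (@poly_limit_trans _ (fun n x => exp_sum n (- (x 0 j ^+ 2 / 8)) * ((x 0 j - c) * q x))
   (fun x => (2 * `|(x 0 j - c) * q x|) * expR (norm2 x / 8))).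
- by apply: vmeasM => //; exact: tq.1.
- move=> n; apply: poly_limit_rpoly; apply: rpolyM; last first.
    apply: rpolyM => //; apply: (@eq_rpoly (fun x => x 0 j + (- c))) => //.
    by apply: rpolyD; [exact: rpoly_coord|exact: rpoly_cst].
  apply: rpoly_sum => i; rewrite /exp_coeff /=; apply: rpolyM; last exact: rpoly_cst.
  apply: rpolyX; apply: (@eq_rpoly (fun x => - (8^-1) * x 0 j ^+ 2)).
    by move=> x; rewrite mulNr mulrC.
  by apply: rpolyM; [exact: rpoly_cst|apply: rpolyX; exact: rpoly_coord].
- have [m1 _] := temperedM tl tq; apply: vmeasM.
    by apply: vmeasM; [exact: vmeas_cst|exact: measurableT_comp].
  apply: (vmeas_comp (@measurable_expR R)).
  by apply: vmeasM; [exact: vmeas_norm2|exact: vmeas_cst].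
- move=> n x; set y := - (x 0 j ^+ 2 / 8).
  rewrite (_ : _ - _ = ((x 0 j - c) * q x) * (expR y - exp_sum n y)); last by ring.
  rewrite normrM [2 * _]mulrC -mulrA ler_wpM2l //.
  have yx : `|y| <= norm2 x / 8.
    by rewrite normrN ger0_norm ?divr_ge0 ?sqr_ge0 // ler_wpM2r ?invr_ge0 // sqr_coord_le.
  rewrite (le_trans (ler_normB _ _)) // (ger0_norm (expR_ge0 _)) mulr2n mulrDl !mul1r lerD //.
    by rewrite ler_expR (le_trans (ler_norm _)).
  by rewrite (le_trans (exp_sum_le _ _)) // ler_expR.
- apply: wnorm2_tempered; apply: temperedM; first exact: tempered_cst.
  have [m1 qC] := temperedM tl tq; split; first exact: measurableT_comp.
  by move=> e e0; have [C H] := qC e e0; exists C => x; rewrite normr_id.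
- move=> x.
  rewrite (_ : (x 0 j - c) * _ * q x = expR (- (x 0 j ^+ 2 / 8)) * ((x 0 j - c) * q x)); last by ring.
  by apply: cvgM; [exact: cvg_exp_sum|exact: cvg_cst].
Qed.

Definition ind (P : V -> Prop) (x : V) : R := `[< P x >]%:R.

Lemma multiplier_indN P : multiplier (ind P) -> multiplier (ind (fun x => ~ P x)).
Proof.
move=> mP; apply: (@eq_multiplier (fun x => 1 + -1 * ind P x)).
  by move=> x; rewrite /ind asbool_neg; case: asboolP => _; rewrite ?mulr1 ?subrr ?mulr0 ?addr0.
apply: multiplierD; first exact: multiplier_cst.
by apply: multiplierM => //; exact: multiplier_cst.
Qed.

(** One minus the product of the first n complementary indicators is the indicator of a finite
    union, and these indicators are eventually constant at each point. *)
Lemma multiplier_ind_ex (P : nat -> V -> Prop) : (forall n, multiplier (ind (P n))) ->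
  multiplier (ind (fun x => exists n, P n x)).
Proof.
move=> mP; pose f n x := 1 - \prod_(k < n) (1 - ind (P k) x).
have f01 n x : 0 <= \prod_(k < n) (1 - ind (P k) x) <= 1.
  elim: n => [|n IH]; first by rewrite big_ord0 ler01 lexx.
  rewrite big_ord_recr /=; move/andP: IH => [p0 p1].
  by rewrite /ind; case: asboolP => _; rewrite ?subrr ?mulr0 ?subr0 ?mulr1 ?p0 ?p1 ?lexx ?ler01.
apply: (@multiplier_lim _ f 1).
- elim=> [|n IH].
    by apply: (@eq_multiplier (fun=> 0)) => [x|]; rewrite /f ?big_ord0 ?subrr //; exact: multiplier_cst.
  apply: (@eq_multiplier (fun x => 1 + -1 * ((1 + -1 * f n x) * (1 + -1 * ind (P n) x)))).
    by move=> x; rewrite /f big_ord_recr /=; ring.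
  have mL g : multiplier g -> multiplier (fun x => 1 + -1 * g x).
    move=> mg; apply: multiplierD; first exact: multiplier_cst.
    by apply: multiplierM => //; exact: multiplier_cst.
  by apply: (mL (fun x => (1 + -1 * f n x) * (1 + -1 * ind (P n) x))); apply: multiplierM; exact: mL.
- move=> n x; have /andP[p0 p1] := f01 n x.
  by rewrite /f ger0_norm ?subr_ge0 // lerBlDr lerDl.
move=> x; rewrite /ind; case: asboolP => [[m Pm]|nP].
  apply: cvg_near_cst; exists m.+1 => //= n /= mn.
  rewrite /f (bigD1 (Ordinal mn)) //= /ind asboolT // subrr mul0r subr0 //.
rewrite /f (_ : (fun n => _) = fun=> 0); first exact: cvg_cst.
apply/funext => n; rewrite big1 ?subrr // => k _; rewrite /ind asboolF ?subr0 // => Pk.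
by apply: nP; exists k.
Qed.

(** The sets whose indicator is a multiplier form a sigma-algebra. It contains the half-spaces x_j >
    c, and open rays generate the Borel sets of the line. *)
Lemma multiplier_measurable (B : set (d.-tuple R)) : measurable B ->
  multiplier (ind (fun x => B (vt x))).
Proof.
have sa (I : Type) (h : V -> I) : sigma_algebra setT [set C : set I | multiplier (ind (fun x => C (h x)))].
  split => [|C /= mC|F /= mF].
  - apply: (@eq_multiplier (fun=> 0)); last exact: multiplier_cst.
    by move=> x; rewrite /ind asboolF.
  - apply: eq_multiplier (multiplier_indN mC) => x; rewrite /ind; congr (_%:R : R).
    by congr nat_of_bool; apply: asbool_equiv_eq; split => [|[]].
  - apply: eq_multiplier (multiplier_ind_ex mF) => x; rewrite /ind; congr (_%:R : R).
    by congr nat_of_bool; apply: asbool_equiv_eq; split => [[n]|[n _]]; exists n.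
suff: (measurable : set (set (d.-tuple R))) `<=` [set B | multiplier (ind (fun x => B (vt x)))].
  by apply.
apply: smallest_sub; first exact: sa.
apply: (@big_ind _ (fun G : set (set (d.-tuple R)) => G `<=` [set B | multiplier (ind (fun x => B (vt x)))])).
- by [].
- by move=> G H hG hH C [/hG|/hH].
move=> i _ _ [C mC <-] /=.
have : measurable C by [].
rewrite -[measurable C]/((ocitv (R:=R)).-sigma.-measurable C) RGenOInfty.measurableE.
have : (RGenOInfty.G (R:=R)).-sigma.-measurable `<=` [set C | multiplier (ind (fun x : V => C (x 0 i)))].
  apply: smallest_sub; first exact: sa.
  move=> _ [c ->] /=.
  apply: eq_multiplier (multiplier_gt 0 (multiplier_coord i c)) => x.
  rewrite /ind pmulr_lgt0 ?expR_gt0 // subr_gt0; congr (_%:R : R); congr nat_of_bool.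
  by apply/idP/asboolP; rewrite /= in_itv /= andbT.
move=> /(_ C) + mC'; move=> /(_ mC') /=; apply: eq_multiplier => x.
rewrite /ind; congr (_%:R : R); congr nat_of_bool; apply: asbool_equiv_eq.
by rewrite tnth_mktuple; split => [|[]].
Qed.

Lemma multiplier_meas_gt f c : vmeas f -> multiplier (fun x => (c < f x)%R%:R).
Proof.
move=> mf; have := @multiplier_measurable [set t | c < f (tv t)].
have mB : measurable [set t : d.-tuple R | c < f (tv t)].
  have := mf measurableT _ (measurable_itv `]c, +oo[); rewrite setTI.
  by congr measurable; apply/seteqP; split => t /=; rewrite in_itv /= andbT.
move=> /(_ mB); apply: eq_multiplier => x; rewrite /ind /= vtK; congr (_%:R : R).
by congr nat_of_bool; apply/asboolP/idP.
Qed.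

(** The sum counts the integers 1, ..., n below y. After rescaling it is a staircase of indicators
    that approximates a bounded function uniformly. *)
Lemma count_approx n (y : R) : 0 <= y -> y <= n%:R ->
  `|y - \sum_(k < n) (k.+1%:R < y)%R%:R| <= 1.
Proof.
move=> y0; elim: n => [|n IH] yn.
  by rewrite big_ord0 subr0 ger0_norm // (le_trans yn).
rewrite big_ord_recr /= [n.+1%:R < y]ltNge yn addr0.
have [/IH //|ny] := lerP y n%:R.
rewrite (eq_bigr (fun=> 1)); last first.
  by move=> k _; rewrite (le_lt_trans _ ny) // ler_nat.
rewrite sumr_const card_ord ger0_norm; last by rewrite subr_ge0 ltW.
by move: yn; rewrite -natr1; lra.
Qed.

Lemma multiplier_bounded f c : vmeas f -> (forall x, `|f x| <= c) -> multiplier f.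
Proof.
move=> mf fc; have c0 : 0 <= c := le_trans (normr_ge0 _) (fc 0).
(* f + c lies between 0 and 2 c; the summand 1 keeps K positive when c = 0. *)
pose K := 2 * c + 1; have K0 : 0 < K by rewrite /K; lra.
pose g x := (f x + c) / K.
have g01 x : 0 <= g x <= 1.
  have := fc x; rewrite ler_norml => /andP[f1 f2].
  by rewrite /g divr_ge0 ?ler_pdivrMr ?(ltW K0) //= /K; lra.
have mg : vmeas g.
  by apply: vmeasM; [apply: vmeasD => //; exact: vmeas_cst|exact: vmeas_cst].
suff mtg : multiplier g.
  apply: (@eq_multiplier (fun x => K * g x + (- c))).
    by move=> x; rewrite /g mulrCA divff ?gt_eqF // mulr1 addrK.
  apply: multiplierD; last exact: multiplier_cst.
  by apply: multiplierM => //; exact: multiplier_cst.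
have dist n x : `|g x - n.+1%:R^-1 * \sum_(k < n.+1) (k.+1%:R < n.+1%:R * g x)%R%:R| <= harmonic n.
  have /andP[g0 g1] := g01 x.
  have n0 : 0 < n.+1%:R :> R by [].
  have := @count_approx n.+1 (n.+1%:R * g x); rewrite mulr_ge0 // ler_piMr // => /(_ isT isT) H.
  rewrite -(ler_pM2l n0) -{1}(gtr0_norm n0) -normrM mulrBr [in X in _ - X]mulrA /=.
  by rewrite !divff ?gt_eqF // mul1r.
apply: (@multiplier_lim _ (fun n x => n.+1%:R^-1 * \sum_(k < n.+1) (k.+1%:R < n.+1%:R * g x)%R%:R) 2).
- move=> n; apply: multiplierM; first exact: multiplier_cst.
  apply: multiplier_sum => k.
  apply: multiplier_meas_gt.
  by apply: vmeasM => //; exact: vmeas_cst.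
- move=> n x; have /andP[g0 g1] := g01 x; have := dist n x; rewrite distrC => dn.
  have h1 : harmonic n <= 1 :> R by rewrite invf_le1 // ler1n.
  rewrite -(subrK (g x) (_ * _)) (le_trans (ler_normD _ _)) //.
  by rewrite (ger0_norm g0) (_ : 2 = 1 + 1) // lerD // (le_trans dn).
move=> x; apply: (squeeze_cvgr (f := fun n => g x - harmonic n) (h := fun n => g x + harmonic n)).
- by apply: nearW => n; rewrite -ler_distl distrC dist.
- by rewrite -[X in _ --> X]subr0; apply: cvgB; [exact: cvg_cst|exact: cvg_harmonic].
- by rewrite -[X in _ --> X]addr0; apply: cvgD; [exact: cvg_cst|exact: cvg_harmonic].
Qed.

(** The truncation of f to the set where |f| <= n is bounded and measurable, hence a multiplier;
    applied to the polynomial 1 it lies in the closure. The truncations converge to f, dominated by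
    |f|. *)
Lemma poly_dense f : vmeas f -> (wnorm2 f < +oo)%E -> poly_limit f.
Proof.
move=> mf foo.
apply: (@poly_limit_trans _ (fun n x => (`|f x| <= n%:R)%R%:R * f x) (fun x => `|f x|)) => //.
- move=> n.
  have mfn : vmeas (fun x => (`|f x| <= n%:R)%R%:R * f x).
    apply: vmeasM => //; apply: (@eq_vmeas _ _ (fun x => 1 - (n%:R < `|f x|)%R%:R)).
      by move=> x; rewrite leNgt; case: ltP => _; rewrite ?subr0 ?subrr.
    apply: vmeasB; first exact: vmeas_cst.
    have mnf : vmeas (fun x => `|f x|) by exact: measurableT_comp.
    by have [] := multiplier_meas_gt n%:R mnf.
  have [|_ _ H] := @multiplier_bounded _ n%:R mfn.
    move=> x; case: (leP `|f x| n%:R) => [fn|_]; first by rewrite mul1r.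
    by rewrite mul0r normr0.
  have [mm lm] := H _ (rpoly_cst 1).
  split=> // e e0; have [p rp Hp] := lm e e0; exists p => //.
  by move: Hp; congr (wnorm2 _ < _)%E; apply/funext => x; rewrite mulr1.
- exact: measurableT_comp.
- move=> n x; case: (leP `|f x| n%:R) => _; first by rewrite mul1r subrr normr0.
  by rewrite mul0r subr0.
- move: foo; congr (vint _ < _)%E; apply/funext => x.
  by rewrite real_normK ?num_real.
- move=> x; apply: cvg_near_cst; near=> n.
  rewrite (_ : (`|f x| <= n%:R)%R) ?mul1r //; near: n; exact: nbhs_infty_ger.
Unshelve. all: end_near. Qed.

End density.

(** * Polar coordinates *)

Section one_dim.
Context {R : realType}.
Local Notation leb := (@lebesgue_measure R).

Lemma measurable_leR d (T : measurableType d) (f g : T -> R) :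
  measurable_fun setT f -> measurable_fun setT g ->
  measurable_fun setT (fun x => (f x <= g x)%R%:R : R).
Proof.
move=> mf mg; rewrite (_ : (fun x => _) = (fun x => if (f x <= g x)%R then 1 else 0)); last first.
  by apply/funext => x; case: (f x <= g x)%R.
apply: measurable_fun_ifT => //; exact: measurable_fun_ler.
Qed.

Lemma measurable_ltR d (T : measurableType d) (f g : T -> R) :
  measurable_fun setT f -> measurable_fun setT g ->
  measurable_fun setT (fun x => (f x < g x)%R%:R : R).
Proof.
move=> mf mg; rewrite (_ : (fun x => _) = (fun x => if (f x < g x)%R then 1 else 0)); last first.
  by apply/funext => x; case: (f x < g x)%R.
apply: measurable_fun_ifT => //; exact: measurable_fun_ltr.
Qed.

Lemma integral_powR (a u : R) : 0 < a -> 0 < u ->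
  (\int[leb]_(t in `[0%R, u]) (t `^ a)%:E = (u `^ (a + 1) / (a + 1))%:E)%E.
Proof.
move=> a0 u0; have a1 : 0 < a + 1 by rewrite addr_gt0.
have cont (b t : R) : 0 < t -> (fun x : R => x `^ b) @ t --> t `^ b.
  move=> t0; have : derivable (fun x : R => x `^ b) t 1 by apply: derivable_powR; rewrite in_itv /= t0.
  by move=> /derivable1_diffP/differentiable_continuous.
rewrite (@continuous_FTC2 _ _ (fun t => t `^ (a + 1) / (a + 1))) //.
- by rewrite powR0 ?gt_eqF // mul0r sube0.
- apply/continuous_within_itvP => //; split.
  + by move=> t; rewrite in_itv /= => /andP[t0 _]; exact: cont.
  + by rewrite powR0 ?gt_eqF //; exact: powR_cvg0.
  + by apply: cvg_at_left_filter; exact: cont.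
- split.
  + move=> t; rewrite in_itv /= => /andP[t0 _]; apply: derivableM => //.
    by apply: derivable_powR; rewrite in_itv /= t0.
  + apply: cvgM; last exact: cvg_cst.
    by rewrite powR0 ?gt_eqF //; exact: powR_cvg0.
  + apply: cvgM; last exact: cvg_cst.
    by apply: cvg_at_left_filter; exact: cont.
move=> t; rewrite in_itv /= => /andP[t0 _].
have D := is_derive1_powR (a + 1) t0.
have D2 := @is_deriveM _ _ _ _ _ _ _ _ D (is_derive_cst ((a + 1)^-1) t 1).
rewrite derive1E (@derive_val _ _ _ _ _ _ _ D2) scaler0 add0r /GRing.scale /= addrK.
by rewrite mulrA mulVf ?mul1r // gt_eqF.
Qed.

Lemma integral_powR_ind (a u : R) : 0 < a ->
  (\int[leb]_t ((0 < t)%R%:R * (t <= u)%R%:R * t `^ a)%:E =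
   ((0 < u)%R%:R * (u `^ (a + 1) / (a + 1)))%:E)%E.
Proof.
move=> a0; have [u0|u0] := ltP 0 u.
  rewrite mul1r -integral_powR // [RHS]integral_mkcond; apply: eq_integral => t _.
  rewrite patchE mem_setE in_itv /=.
  have [t0|t0|<-] := ltgtP 0 t; rewrite ?mul0r //=.
    by case: (t <= u); rewrite ?mulr1 ?mul1r ?mulr0 ?mul0r.
  by rewrite powR0 ?gt_eqF // if_same.
rewrite mul0r integral0_eq // => t _.
have [t0|] := ltP 0 t; last by rewrite !mul0r.
by rewrite [t <= u]leNgt (le_lt_trans u0 t0) mulr0 mul0r.
Qed.

Lemma integral_exp_tail (r : R) :
  (\int[leb]_t ((r <= t)%R%:R * expR (- t))%:E = (expR (- r))%:E)%E.
Proof.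
transitivity (\int[leb]_(t in `[r, +oo[) (expR (- t))%:E)%E.
  rewrite [RHS]integral_mkcond; apply: eq_integral => t _.
  rewrite patchE mem_setE in_itv /= andbT.
  by case: (r <= t); rewrite ?mul1r ?mul0r.
have cexp (t : R) : {for t, continuous (fun t : R => expR (- t))}.
  move=> A HA; apply: (cvg_comp (-%R) expR); [exact: oppr_continuous|exact: continuous_expR|exact: HA].
rewrite (@ge0_continuous_FTC2y _ _ (fun t => - expR (- t)) _ 0) //.
- by rewrite EFinN oppeK add0e.
- by apply: continuous_subspaceT => t; exact: cexp.
- by rewrite -oppr0; apply: cvgN; exact: cvgr_expR.
- by apply: cvgN; apply: cvg_at_right_filter; exact: cexp.
move=> t _.
have D1 : is_derive t 1 (fun t : R => expR (- t)) (expR (- t) * -1).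
  exact: (is_derive1_comp (is_derive_expR (- t)) (is_deriveNid t 1)).
have D := @is_deriveN _ _ _ _ _ _ _ D1.
by rewrite derive1E (@derive_val _ _ _ _ _ _ _ D) mulrN1 opprK.
Qed.

Definition gamma_fun (s t : R) : R := (0 < t)%R%:R * (t `^ (s - 1) * expR (- t)).
(** The extended value allows Tonelli before finiteness is known; [Gamma] is its finite part. *)
Definition Gammae (s : R) : \bar R := (\int[leb]_t (gamma_fun s t)%:E)%E.

Lemma gamma_fun_ge0 s t : 0 <= gamma_fun s t.
Proof. by rewrite !mulr_ge0 ?powR_ge0 ?expR_ge0. Qed.

Lemma measurable_gamma_fun s : measurable_fun setT (gamma_fun s).
Proof.
apply: measurable_funM; first exact: measurable_ltR.
apply: measurable_funM; first exact: measurable_powR.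
by apply: measurableT_comp; first exact: measurable_expR.
Qed.

Lemma GammaE s : Gamma s = fine (Gammae s).
Proof.
rewrite /Gamma /Gammae integral_mkcond; congr fine; apply: eq_integral => t _.
rewrite patchE /gamma_fun; case: ifPn; rewrite ?inE /= => t0; first by rewrite t0 mul1r.
by move/asboolPn: t0; rewrite /= => /negP/negbTE ->; rewrite mul0r.
Qed.

Lemma Gammae_ge0 s : (0 <= Gammae s)%E.
Proof. by apply: integral_ge0 => t _; rewrite lee_fin gamma_fun_ge0. Qed.

(** The function t^(s-1) exp(-u) on 0 < t <= u is integrated in both orders: over u first it gives
    Gamma(s), over t first Gamma(s+1) / s. The condition 1 < s is that of [integral_powR_ind] for
    the exponent s - 1. *)
Lemma Gammae_rec s : 1 < s -> (Gammae (s + 1) = s%:E * Gammae s)%E.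
Proof.
move=> s1; have s0 : 0 < s by rewrite (lt_trans _ s1).
pose f (p : measurableTypeR R * measurableTypeR R) : \bar R :=
  ((0 < p.1)%R%:R * (p.1 <= p.2)%R%:R * p.1 `^ (s - 1) * expR (- p.2))%:E.
have f0 p : (0 <= f p)%E by rewrite lee_fin !mulr_ge0 ?powR_ge0 ?expR_ge0.
have mf : measurable_fun setT f.
  apply/measurable_EFinP; apply: measurable_funM.
    apply: measurable_funM; first apply: measurable_funM.
    - exact: measurable_ltR.
    - exact: measurable_leR.
    - exact: (measurableT_comp (@measurable_powR R (s - 1))).
  apply: measurableT_comp; first exact: measurable_expR.
  exact: measurableT_comp.
have E1 : (\int[leb]_x \int[leb]_y f (x, y) = Gammae s)%E.
  apply: eq_integral => t _; rewrite /f /=.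
  under eq_integral.
    move=> u _.
    rewrite (_ : _ * expR _ = ((0 < t)%R%:R * t `^ (s - 1)) * ((t <= u)%R%:R * expR (- u))); last by ring.
    rewrite EFinM; over.
  rewrite ge0_integralZl_EFin //.
  - by rewrite integral_exp_tail -EFinM /gamma_fun mulrA.
  - apply/measurable_EFinP; apply: measurable_funM; first exact: measurable_leR.
    by apply: measurableT_comp; first exact: measurable_expR.
  - by rewrite mulr_ge0 ?powR_ge0.
have E2 : (\int[leb]_y \int[leb]_x f (x, y) = (s^-1)%:E * Gammae (s + 1))%E.
  rewrite -ge0_integralZl_EFin ?invr_ge0 ?(ltW s0) //; last 2 first.
  - by move=> u _; rewrite lee_fin gamma_fun_ge0.
  - by apply/measurable_EFinP; exact: measurable_gamma_fun.
  apply: eq_integral => u _; rewrite /f /=.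
  under eq_integral do rewrite EFinM muleC.
  rewrite ge0_integralZl_EFin ?expR_ge0 //; last 2 first.
  - by move=> t _; rewrite lee_fin !mulr_ge0 ?powR_ge0.
  - apply/measurable_EFinP; apply: measurable_funM; last exact: measurable_powR.
    by apply: measurable_funM; [exact: measurable_ltR|exact: measurable_leR].
  rewrite integral_powR_ind ?subr_gt0 // -!EFinM subrK /gamma_fun addrK.
  by congr EFin; ring.
rewrite -E1 (fubini_tonelli f) // E2 muleA -EFinM divff ?gt_eqF // mul1e //.
Qed.

(** With n the integer part of s, t^(s-1) <= 1 + t^(n+1), and the exponential series gives t^(n+1)
    <= (n+1)! 2^(n+1) exp(t/2). Half of the exponential decay is spent on this, the other half is
    integrated. *)
Lemma Gammae_fin s : 1 <= s -> (Gammae s < +oo)%E.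
Proof.
move=> s1; pose n := Num.truncn s; pose C : R := 1 + (n.+1)`!%:R * 2 ^+ n.+1.
have C0 : 0 <= C by rewrite addr_ge0 // mulr_ge0 // exprn_ge0.
pose f (t : R) := (0 <= t)%R%:R * expR (- t).
have fle t : gamma_fun s t <= C * f (2^-1 * t + 0).
  rewrite /gamma_fun /f addr0; have [t0|t0] := ltP 0 t; last first.
    by rewrite mul0r; apply: mulr_ge0 => //; apply: mulr_ge0 => //; exact: expR_ge0.
  rewrite mul1r mulr_ge0 ?(ltW t0) ?invr_ge0 // mul1r.
  have e2 : expR (- t) = expR (- (2^-1 * t)) * expR (- (2^-1 * t)).
    by rewrite -expRD; congr expR; field.
  rewrite e2 mulrA ler_wpM2r ?expR_ge0 //.
  have ht : 0 <= 2^-1 * t by rewrite mulr_ge0 ?(ltW t0).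
  have ge1 : 1 + (2^-1 * t) ^+ n.+1 / n.+1`!%:R <= expR (2^-1 * t) := expR_ge1Dxn n ht.
  have e0 : 0 < expR (2^-1 * t) by rewrite expR_gt0.
  have f0 : 0 < (n.+1)`!%:R :> R by rewrite ltr0n fact_gt0.
  have k0 : 0 <= (2^-1 * t) ^+ n.+1 / n.+1`!%:R by rewrite divr_ge0 ?exprn_ge0 ?(ltW f0).
  have p1 : t `^ (s - 1) <= 1 + t ^+ n.+1.
    have [t1|t1] := lerP t 1.
      apply: (@le_trans _ _ 1); last by rewrite lerDl exprn_ge0 // ltW.
      apply: (@le_trans _ _ (1 `^ (s - 1))); last by rewrite powR1.
      by apply: ge0_ler_powR; rewrite ?nnegrE ?subr_ge0 ?(ltW t0).
    apply: (@le_trans _ _ (t `^ n.+1%:R)).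
      apply: ler_powR; first exact: ltW.
      have := truncnS_gt s; rewrite -/n; lra.
    by rewrite powR_mulrn ?(ltW t0) // lerDr.
  have p2 : t ^+ n.+1 <= (n.+1)`!%:R * 2 ^+ n.+1 * expR (2^-1 * t).
    have -> : t ^+ n.+1 = (n.+1)`!%:R * 2 ^+ n.+1 * ((2^-1 * t) ^+ n.+1 / n.+1`!%:R).
      rewrite exprMn exprVn; field; rewrite gt_eqF // expf_neq0 //.
    rewrite ler_wpM2l ?mulr_ge0 ?exprn_ge0 ?(ltW f0) //; lra.
  rewrite expRN ler_pdivrMr // in |- *.
  apply: (le_trans p1); rewrite /C mulrDl mul1r lerD //; lra.
have mfe : measurable_fun setT f.
  apply: measurable_funM; first exact: measurable_leR.
  by apply: measurableT_comp; first exact: measurable_expR.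
have c0 : 2^-1 != 0 :> R by rewrite invr_eq0.
have fin : (\int[leb]_t (f (2^-1 * t + 0))%:E < +oo)%E.
  have := integral_exp_tail 0; rewrite -/f (@ge0_integral_affine R 2^-1 0) //.
  - move=> H; rewrite ltey; apply: contra_eqN H => /eqP ->.
    by rewrite gt0_muley // lte_fin normr_gt0.
  - by apply/measurable_EFinP.
have mfa : measurable_fun setT (fun t : R => f (2^-1 * t + 0)).
  by apply: (measurableT_comp mfe); apply: measurable_funD => //; exact: measurable_funM.
apply: (@le_lt_trans _ _ (\int[leb]_t (C%:E * (f (2^-1 * t + 0))%:E))%E).
  apply: ge0_le_integral => //.
  - by move=> t _; rewrite lee_fin gamma_fun_ge0.
  - by apply/measurable_EFinP; exact: measurable_gamma_fun.
  - by apply: emeasurable_funM => //; apply/measurable_EFinP.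
  - by move=> t _; rewrite -EFinM lee_fin fle.
rewrite ge0_integralZl_EFin //.
- by rewrite lte_mul_pinfty.
- by move=> t _; rewrite lee_fin; apply: mulr_ge0 => //; exact: expR_ge0.
- by apply/measurable_EFinP.
Qed.

(** From t = 1 on, the integrand is at least exp(-t), whose integral there is exp(-1). *)
Lemma Gammae_gt0 s : 1 <= s -> (0 < Gammae s)%E.
Proof.
move=> s1; apply: (@lt_le_trans _ _ (expR (- 1))%:E); first by rewrite lte_fin expR_gt0.
rewrite -integral_exp_tail; apply: ge0_le_integral => //.
- apply/measurable_EFinP; apply: measurable_funM; first exact: measurable_leR.
  by apply: measurableT_comp; first exact: measurable_expR.
- by apply/measurable_EFinP; exact: measurable_gamma_fun.
move=> t _; rewrite lee_fin /gamma_fun; have [t1|_] := lerP 1 t; last first.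
  by rewrite mul0r; exact: gamma_fun_ge0.
rewrite (lt_le_trans _ t1) // !mul1r ler_peMl ?expR_ge0 //.
rewrite -[leLHS](powRr0 t); apply: ler_powR => //; by rewrite subr_ge0.
Qed.

End one_dim.

(** * Gaussian integrals of homogeneous functions *)

Section polar.
Context {R : realType} {d : nat}.
Local Notation V := 'rV[R]_d.
Local Notation leb := (@lebesgue_measure R).
Local Notation mu := (@tuple_measure R d).

Lemma norm2Z (c : R) (x : V) : norm2 (c *: x) = c ^+ 2 * norm2 x.
Proof. by rewrite /norm2 /dotv mulr_sumr; apply: eq_bigr => i _; rewrite !mxE; ring. Qed.

Section nonneg.
Variables (G : V -> R) (p : R).
Hypothesis mG : vmeas G.
Hypothesis G0 : forall x, 0 <= G x.
Hypothesis hG : forall c x, 0 < c -> G (c *: x) = c `^ p * G x.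

(** Only the origin is concerned, and there homogeneity gives G(0) = 2^p G(0) with 2^p > 1. *)
Lemma Gzero x : 0 < p -> norm2 x <= 0 -> G x = 0.
Proof.
move=> p0 nx; have -> : x = 0.
  by apply/eqP; apply: contraTT nx => x0; rewrite -ltNge; exact: dotvv_gt0.
have := @hG 2 0 ltac:(done); rewrite scaler0 => /eqP.
rewrite -subr_eq0 -{1}[G 0]mul1r -mulrBl mulf_eq0 => /orP[|/eqP //].
rewrite subr_eq0 => /eqP E; have : 1 < 2 `^ p :> R.
  have p1 : 1 `^ p = 1 :> R by rewrite powR1.
  by rewrite -[ltLHS]p1; apply: gt0_ltr_powR; rewrite // ?nnegrE ?ltr1n.
by rewrite -E ltxx.
Qed.

(** The parameter u is the square of the radius. *)
Definition ball_mass (u : R) : \bar R := vint (fun x => (G x * (norm2 x <= u)%R%:R)%:E).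

Lemma vmeas_ball u : vmeas (fun x : V => (norm2 x <= u)%R%:R).
Proof. by apply: measurable_leR; [exact: vmeas_norm2|exact: measurable_cst]. Qed.

(** Dilation by the square root c of u: homogeneity contributes c^p and the change of variables
    c^d. *)
Lemma ball_massE u : 0 < u -> ball_mass u = ((u `^ ((p + d%:R) / 2))%:E * ball_mass 1)%E.
Proof.
move=> u0; pose c := u `^ 2^-1; have c0 : 0 < c by rewrite powR_gt0.
have c2 : c ^+ 2 = u.
  by rewrite -powR_mulrn ?(ltW c0) // /c -powRrM mulVf // powRr1 ?ltW.
have mGu v : vemeas (fun x => (G x * (norm2 x <= v)%R%:R)%:E).
  by apply: vmeasE; apply: vmeasM => //; exact: vmeas_ball.
have G0u v x : (0 <= (G x * (norm2 x <= v)%R%:R)%:E)%E by rewrite lee_fin mulr_ge0.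
have [_ /(_ _ (mGu u) (G0u u))] := @jacobian_scale R d c (lt0r_neq0 c0).
rewrite -/(ball_mass u) (gtr0_norm c0) => H.
have E : vint (fun x => (G (c *: x) * (norm2 (c *: x) <= u)%R%:R)%:E) =
   ((c `^ p)%:E * ball_mass 1)%E.
  rewrite /ball_mass -ge0_integralZl_EFin ?powR_ge0 //; last exact: mGu.
  apply: eq_integral => t _; rewrite hG // norm2Z c2 -EFinM mulrA; congr (_ * _)%:E.
  by rewrite -[X in (_ <= X)%R]mulr1 ler_pM2l.
move: H; rewrite E => H.
have cd : 0 < c ^+ d by rewrite exprn_gt0.
transitivity ((c ^+ d)%:E * ((c^-1 ^+ d)%:E * ball_mass u))%E.
  by rewrite muleA -EFinM -exprMn divff ?gt_eqF // expr1n mul1e.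
rewrite -H muleA -EFinM; congr (_%:E * _)%E.
rewrite -powR_mulrn ?(ltW c0) // -powRD ?(gt_eqF c0) ?implybT // addrC /c -[LHS]powRrM.
by congr (_ `^ _); rewrite mulrC.
Qed.

(* [expR (- r)] is the integral of [expR (- u)] over [r <= u]: exchange the integrals. *)
Lemma gauss_ball_mass : 0 < p ->
  vint (fun x => (G x * expR (- norm2 x))%:E) =
  (Gammae ((p + d%:R) / 2 + 1) * ball_mass 1)%E.
Proof.
move=> p0.
pose f (q : d.-tuple R * measurableTypeR R) : \bar R :=
  (G (tv q.1) * ((norm2 (tv q.1) <= q.2)%R%:R * expR (- q.2)))%:E.
have f0 q : (0 <= f q)%E by rewrite lee_fin mulr_ge0 // mulr_ge0 ?expR_ge0.
have mf : measurable_fun setT f.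
  apply/measurable_EFinP; apply: measurable_funM; first exact: (measurableT_comp mG).
  apply: measurable_funM.
    by apply: measurable_leR => //; exact: (measurableT_comp vmeas_norm2).
  by apply: measurableT_comp; first exact: measurable_expR; exact: measurableT_comp.
have E1 : (\int[mu]_x \int[leb]_y f (x, y))%E = vint (fun x => (G x * expR (- norm2 x))%:E).
  apply: eq_integral => t _; rewrite /f /=.
  under eq_integral do rewrite EFinM.
  rewrite ge0_integralZl_EFin //.
  - by rewrite integral_exp_tail -EFinM.
  - apply/measurable_EFinP; apply: measurable_funM; first exact: measurable_leR.
    by apply: measurableT_comp; first exact: measurable_expR.
have mGu u : vemeas (fun x => (G x * (norm2 x <= u)%R%:R)%:E).
  by apply: vmeasE; apply: vmeasM => //; exact: vmeas_ball.
have E2 : (\int[leb]_y \int[mu]_x f (x, y))%E = (Gammae ((p + d%:R) / 2 + 1) * ball_mass 1)%E.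
  rewrite /Gammae -ge0_integralZr //; last 3 first.
  - by apply/measurable_EFinP; exact: measurable_gamma_fun.
  - by move=> t _; rewrite lee_fin gamma_fun_ge0.
  - by apply: integral_ge0 => t _; rewrite lee_fin mulr_ge0.
  apply: eq_integral => u _; rewrite /f /=.
  rewrite /gamma_fun addrK; have [u0|u0] := ltP 0 u.
    under eq_integral do rewrite mulrA EFinM muleC.
    rewrite ge0_integralZl_EFin ?expR_ge0 //; last 2 first.
    - by move=> t _; rewrite lee_fin mulr_ge0.
    - exact: mGu.
    rewrite -[X in (_ * X)%E]/(ball_mass u) ball_massE // muleA -EFinM mul1r.
    by rewrite [expR _ * _]mulrC.
  rewrite !mul0r mul0e integral0_eq // => t _.
  have [nu|] := lerP (norm2 (tv t)) u; last by rewrite !mul0r mulr0.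
  by rewrite Gzero ?mul0r // (le_trans nu).
by rewrite -E1 (fubini_tonelli f).
Qed.

End nonneg.

(* The extension of degree 0 of [G] from the unit sphere, which is what [sph_int] integrates. *)
Definition radial (G : V -> R) (x : V) : R :=
  (0 < norm2 x)%R%:R * G ((Num.sqrt (norm2 x))^-1 *: x).

Lemma vmeas_radial G : vmeas G -> vmeas (radial G).
Proof.
move=> mG; apply: vmeasM.
  by apply: measurable_ltR; [exact: measurable_cst|exact: vmeas_norm2].
apply: (vmeas_compv mG) => i.
rewrite (_ : (fun x => _) = (fun x : V => (Num.sqrt (norm2 x))^-1 * x 0 i)); last first.
  by apply/funext => x; rewrite mxE.
apply: vmeasM; last exact: vmeas_coord.
apply: (vmeas_comp (g := fun u : R => (Num.sqrt u)^-1)); last exact: vmeas_norm2.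
rewrite (_ : (fun u => _) = (fun u : R => u `^ (-1)) \o Num.sqrt); last first.
  by apply/funext => u; rewrite /= powR_inv1 ?sqrtr_ge0.
apply: measurableT_comp; first exact: measurable_powR.
by apply: continuous_measurable_fun; exact: sqrt_continuous.
Qed.

(** The factor c^0 gives the statement the form of the homogeneity hypothesis of [ball_massE], here
    of degree 0. *)
Lemma radialZ G (c : R) (x : V) : 0 < c -> radial G (c *: x) = c `^ 0 * radial G x.
Proof.
move=> c0; rewrite powRr0 mul1r /radial norm2Z pmulr_rgt0 ?exprn_gt0 //.
congr (_ * G _); rewrite scalerA sqrtrM ?sqr_ge0 // sqrtr_sqr (gtr0_norm c0).
by rewrite invfM mulrAC mulVf ?mul1r // gt_eqF.
Qed.

Lemma radialE (G : V -> R) p (x : V) : 0 < p ->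
  (forall c x, 0 < c -> G (c *: x) = c `^ p * G x) ->
  G x = radial G x * norm2 x `^ (p / 2).
Proof.
move=> p0 hG; rewrite /radial; have [x0|x0] := ltP 0 (norm2 x); last first.
  by rewrite (Gzero hG p0 x0) !mul0r.
rewrite mul1r hG ?invr_gt0 ?sqrtr_gt0 // mulrAC -powR12_sqrt ?(ltW x0) //.
rewrite -(powR_inv1 (powR_ge0 _ _)) -!powRrM -powRD ?(gt_eqF x0) ?implybT //.
by rewrite (_ : _ + _ = 0) ?powRr0 ?mul1r //; field.
Qed.

(* [1 - r `^ (p / 2)] is the length of the set of [u <= 1] with [r `^ (p / 2) <= u]. *)
Lemma ball_mass_radial G p : (0 < d)%N -> vmeas G -> (forall x, 0 <= G x) -> 0 < p ->
  (forall c x, 0 < c -> G (c *: x) = c `^ p * G x) ->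
  (ball_mass (radial G) 1 = ball_mass G 1 +
    (p / (p + d%:R))%:E * ball_mass (radial G) 1)%E.
Proof.
move=> d0 mG G0 p0 hG; set K := radial G.
have mK : vmeas K by exact: vmeas_radial.
have K0 x : 0 <= K x by rewrite mulr_ge0.
have q0 : 0 < p / 2 by rewrite divr_gt0.
pose f (q : d.-tuple R * measurableTypeR R) : \bar R :=
  (K (tv q.1) * ((norm2 (tv q.1) `^ (p / 2) <= q.2)%R%:R * (q.2 <= 1)%R%:R))%:E.
have f0 q : (0 <= f q)%E by rewrite lee_fin mulr_ge0 // mulr_ge0.
have mN : vmeas (fun x : V => norm2 x `^ (p / 2)).
  by apply: (vmeas_comp (g := fun u => u `^ (p / 2))); [exact: measurable_powR|exact: vmeas_norm2].
have mf : measurable_fun setT f.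
  apply/measurable_EFinP; apply: measurable_funM; first exact: (measurableT_comp mK).
  apply: measurable_funM; last exact: measurable_leR.
  by apply: measurable_leR => //; exact: (measurableT_comp mN).
have E1 t : (\int[leb]_y f (t, y) =
    (K (tv t) * ((norm2 (tv t) <= 1)%R%:R * (1 - norm2 (tv t) `^ (p / 2))))%:E)%E.
  rewrite /f /=; set r := norm2 (tv t).
  have r0 : 0 <= r by exact: norm2_ge0.
  under eq_integral do rewrite EFinM.
  rewrite ge0_integralZl_EFin //; last first.
    apply/measurable_EFinP; apply: measurable_funM; exact: measurable_leR.
  rewrite [in RHS]EFinM; congr (_%:E * _)%E.
  transitivity (\int[leb]_(y in `[(r `^ (p / 2))%R, 1%R]) (cst 1%E) y)%E.
    rewrite [RHS]integral_mkcond; apply: eq_integral => y _.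
    rewrite patchE mem_setE in_itv /=.
    by case: (_ <= y); rewrite ?mul0r // mul1r; case: (y <= 1).
  rewrite integral_cst // mul1e.
  move: (@lebesgue_measure_itv R `[(r `^ (p / 2))%R, 1%R]).
  move=> H; apply: (etrans H) => {H}; rewrite /= lte_fin.
  have -> : (r `^ (p / 2) < 1) = (r < 1).
    have p1 : 1 `^ (p / 2) = 1 :> R by rewrite powR1.
    apply/idP/idP => [|r1]; last by rewrite -[ltRHS]p1; apply: gt0_ltr_powR; rewrite ?nnegrE.
    apply: contraTT; rewrite -!leNgt => r1.
    by rewrite -[leLHS]p1; apply: ge0_ler_powR; rewrite ?nnegrE // ltW.
  have [r1|r1|->] := ltgtP r 1; first by rewrite mul1r EFinB.
    by rewrite mul0r.
  by rewrite powR1 subrr mulr0.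
have mG1 : vemeas (fun x => (G x * (norm2 x <= 1)%R%:R)%:E).
  by apply: vmeasE; apply: vmeasM => //; exact: vmeas_ball.
have E2 : vint (fun x => (K x * (norm2 x <= 1)%R%:R)%:E) =
   (vint (fun x => (G x * (norm2 x <= 1)%R%:R)%:E) + \int[mu]_t \int[leb]_y f (t, y))%E.
  rewrite -ge0_integralD //; last 3 first.
  - by move=> t _; rewrite lee_fin mulr_ge0.
  - by move=> t _; apply: integral_ge0.
  - exact: measurable_fun_fubini_tonelli_F.
  apply: eq_integral => t _; rewrite E1 -EFinD (radialE _ p0 hG) -/K; congr EFin.
  by ring.
rewrite /ball_mass [LHS]E2 (fubini_tonelli f) //; congr (_ + _)%E.
pose B := vint (fun x => (K x * (norm2 x <= 1)%R%:R)%:E).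
(* The integral of u^(d/p) over ]0, 1]. *)
have -> : p / (p + d%:R) = 1 `^ (d%:R / p + 1) / (d%:R / p + 1).
  have := ler0n R d => dn; rewrite powR1; field.
  by apply/andP; split; apply: lt0r_neq0 => //; lra.
have dp : 0 < d%:R / p + 1 by rewrite ltr_pwDr // divr_ge0 // ltW.
have B0 : (0 <= B)%E by apply: integral_ge0 => t _; rewrite lee_fin mulr_ge0.
have mP : measurable_fun setT
    (fun u : R => ((0 < u)%R%:R * (u <= 1)%R%:R * u `^ (d%:R / p))%:E).
  apply/measurable_EFinP; apply: measurable_funM; last exact: measurable_powR.
  by apply: measurable_funM; [exact: measurable_ltR|exact: measurable_leR].
transitivity (\int[leb]_u (((0 < u)%R%:R * (u <= 1)%R%:R * u `^ (d%:R / p))%:E * B))%E; last first.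
  rewrite ge0_integralZr //; last by move=> u _; rewrite lee_fin !mulr_ge0 ?powR_ge0.
  by rewrite integral_powR_ind ?ltr01 ?mul1r // divr_gt0 // ltr0n.
apply: eq_integral => u _; rewrite /f /=.
have [u1|u1] := lerP u 1; last first.
  by rewrite mulr0 mul0r mul0e integral0_eq // => t _; rewrite !mulr0.
have [u0|u0] := ltP 0 u; last first.
  rewrite mul0r mul0r mul0e integral0_eq // => t _.
  have [nu|] := lerP (norm2 (tv t) `^ (p / 2)) u; last by rewrite mul0r mulr0.
  rewrite /K /radial; have [t0|] := ltP 0 (norm2 (tv t)); last by rewrite !mul0r.
  by have := lt_le_trans (powR_gt0 (p / 2) t0) (le_trans nu u0); rewrite ltxx.
(* The condition |x|^p <= u describes the ball of squared radius v, whose mass for a function of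
   degree 0 is proportional to v^(d/2) = u^(d/p). *)
pose v := u `^ (2 / p); have v0 : 0 < v by rewrite powR_gt0.
have hK c x : 0 < c -> K (c *: x) = c `^ 0 * K x by exact: radialZ.
transitivity (ball_mass K v).
  apply: eq_integral => t _; rewrite mulr1; congr (_ * _%:R)%:E.
  have r0 : 0 <= norm2 (tv t) by exact: norm2_ge0.
  congr nat_of_bool; apply/idP/idP => H.
    rewrite /v (_ : norm2 _ = (norm2 (tv t) `^ (p / 2)) `^ (2 / p)); last first.
      rewrite -powRrM (_ : _ * _ = 1) ?powRr1 //; field; exact: lt0r_neq0.
    by apply: ge0_ler_powR; rewrite ?nnegrE ?powR_ge0 ?divr_ge0 ?(ltW p0) ?(ltW u0).
  rewrite (_ : u = v `^ (p / 2)); last first.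
    rewrite -powRrM (_ : _ * _ = 1) ?powRr1 ?ltW //; field; exact: lt0r_neq0.
  by apply: ge0_ler_powR; rewrite ?nnegrE ?(ltW v0) ?(ltW q0).
rewrite (ball_massE mK K0 hK v0) -/B !mul1r add0r /v -powRrM.
by congr ((_ `^ _)%:E * _)%E; field; exact: lt0r_neq0.
Qed.

Lemma tame_ball G : tempered G -> tame (fun x : V => radial G x * (norm2 x <= 1)%R%:R).
Proof.
move=> [mG GC]; have [C HC] := GC 1 ltr01.
have C0 : 0 <= C.
  have := le_trans (normr_ge0 _) (HC 0).
  by rewrite pmulr_lge0 // expR_gt0.
split.
  by apply: vmeasM; [exact: vmeas_radial|exact: vmeas_ball].
exists (C * expR (1 + 16^-1)) => x; rewrite /radial.
have pos : 0 <= C * expR (1 + 16^-1) * expR (- (norm2 x / 16)).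
  by rewrite !mulr_ge0 ?expR_ge0.
have [x0|x0] := ltP 0 (norm2 x); last by rewrite !mul0r normr0.
have [x1|x1] := lerP (norm2 x) 1; last by rewrite mulr0 normr0.
rewrite mul1r mulr1 (le_trans (HC _)) // norm2Z exprVn sqr_sqrtr ?(ltW x0) //.
rewrite mulVf ?gt_eqF // mulr1 -mulrA ler_wpM2l // -expRD ler_expR; lra.
Qed.

(** With I the ball mass of G and J that of its radial extension, [ball_mass_radial] reads J = I + p
    / (p + d) J, so I = d / (p + d) J. The Gaussian integral is Gamma(s + 1) I with s = (p + d) / 2,
    and Gamma(s + 1) = s Gamma(s) leaves Gamma(s) (d / 2) J. The condition 2 - d < p says that 1 <
    s. *)
Lemma polar_nonneg G p : (0 < d)%N -> tempered G -> (forall x, 0 <= G x) -> 2 - d%:R < p -> 0 < p ->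
  (forall c x, 0 < c -> G (c *: x) = c `^ p * G x) ->
  Rv (fun x => G x * expR (- norm2 x)) =
  fine (Gammae ((p + d%:R) / 2)) * (d%:R / 2) * Rv (fun x => radial G x * (norm2 x <= 1)%R%:R).
Proof.
move=> d0 tG G0 dp p0 hG; have [mG _] := tG.
have pd : 0 < p + d%:R by rewrite addr_gt0 // ltr0n.
set s := (p + d%:R) / 2; have s1 : 1 < s by rewrite /s; lra.
have fJ := vint_tame (tame_ball tG).
have Jr := ball_mass_radial d0 mG G0 p0 hG.
rewrite /ball_mass in Jr; rewrite fJ in Jr.
set J := Rv _ in Jr fJ *.
(* An infinite value would contradict the finite left side of [Jr]; now the equation can be solved
   over the reals. *)
have [I EI] : exists I, vint (fun x => (G x * (norm2 x <= 1)%R%:R)%:E) = I%:E.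
  have := @integral_ge0 _ _ _ mu setT (fun t => (G (tv t) * (norm2 (tv t) <= 1)%R%:R)%:E).
  move: Jr; rewrite /vint; case: (integral _ _ _) => [r _ _|//|_ ].
    by exists r.
  by move=> /(_ _)/wrap[] // t _; rewrite lee_fin mulr_ge0.
rewrite EI -EFinM -EFinD in Jr; case: Jr => Jr.
have IE : I = d%:R / (p + d%:R) * J.
  have : (p + d%:R) * J = (p + d%:R) * I + p * J by rewrite {1}Jr; field; exact: lt0r_neq0.
  move=> H; have : (p + d%:R) * I = d%:R * J by lra.
  by move=> E; apply: (mulfI (lt0r_neq0 pd)); rewrite E; field; exact: lt0r_neq0.
have [g Eg] : exists g, Gammae s = g%:E.
  have := Gammae_fin (ltW s1); have := Gammae_ge0 s.
  by case: (Gammae s) => // r _ _; exists r.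
rewrite /Rv (gauss_ball_mass mG G0 hG p0) /ball_mass EI -/s Gammae_rec // Eg -!EFinM /= IE /s.
by field; exact: lt0r_neq0.
Qed.

(** The positive and negative parts of G are homogeneous of the same degree, and both sides are
    additive. From 2 <= d and 0 < p follows 2 - d < p. *)
Lemma polar G p : (2 <= d)%N -> tempered G -> 0 < p ->
  (forall c x, 0 < c -> G (c *: x) = c `^ p * G x) ->
  Rv (fun x => G x * expR (- norm2 x)) =
  Gamma ((p + d%:R) / 2) * (d%:R / 2) * Rv (fun x => radial G x * (norm2 x <= 1)%R%:R).
Proof.
move=> d2 tG p0 hG; rewrite GammaE.
pose Gp x := Num.max (G x) 0; pose Gm x := Num.max (- G x) 0.
have GE x : G x = Gp x - Gm x.
  rewrite /Gp /Gm; have [g0|g0] := lerP (G x) 0.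
    by rewrite max_l ?oppr_ge0 // sub0r opprK.
  by rewrite max_r ?subr0 // oppr_le0 ltW.
have mx (f : V -> R) : vmeas f -> vmeas (fun x => Num.max (f x) 0).
  by move=> mf; apply: measurable_maxr => //; exact: measurable_cst.
have [mG GC] := tG.
have tGp : tempered Gp.
  split=> [|e e0]; first exact: mx.
  have [C {}GC] := GC e e0; exists C => x; apply: le_trans (GC x).
   rewrite /Gp; have [g0|g0] := lerP (G x) 0; first by rewrite normr0.
  by [].
have tGm : tempered Gm.
  split=> [|e e0]; first by apply: mx; apply: measurable_funN.
  have [C {}GC] := GC e e0; exists C => x; apply: le_trans (GC x).
   rewrite /Gm; have [g0|g0] := lerP (- G x) 0; first by rewrite normr0.
  by rewrite normrN.
have Gp0 x : 0 <= Gp x by rewrite /Gp le_max lexx orbT.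
have Gm0 x : 0 <= Gm x by rewrite /Gm le_max lexx orbT.
have hGp c x : 0 < c -> Gp (c *: x) = c `^ p * Gp x.
  by move=> c0; rewrite /Gp hG // maxr_pMr ?powR_ge0 // mulr0.
have hGm c x : 0 < c -> Gm (c *: x) = c `^ p * Gm x.
  by move=> c0; rewrite /Gm hG // maxr_pMr ?powR_ge0 // mulr0 mulrN.
have dp : 2 - d%:R < p by apply: le_lt_trans p0; rewrite subr_le0 ler_nat.
have d0 : (0 < d)%N by exact: ltnW.
rewrite (eq_Rv (G := fun x => Gp x * expR (- norm2 x) - Gm x * expR (- norm2 x))); last first.
  by move=> x; rewrite GE mulrBl.
rewrite RvB; last 2 first.
- exact: tempered_gauss_tame.
- exact: tempered_gauss_tame.
rewrite (polar_nonneg d0 tGp Gp0 dp) // (polar_nonneg d0 tGm Gm0 dp) // -mulrBr; congr (_ * _).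
rewrite -RvB; last 2 first.
- exact: tame_ball.
- exact: tame_ball.
by apply: eq_Rv => x; rewrite -mulrBl /radial -mulrBr GE.
Qed.

End polar.

(** * The Clifford algebra *)

Section clifford.
Context {R : realType} {d : nat}.
Local Notation Cl := (Cl R d).
Local Notation set_d := {set 'I_d}.
Implicit Types (A B C : set_d) (a b c : Cl).

Definition symd A B : set_d := (A :|: B) :\: (A :&: B).

Lemma in_symd A B p : (p \in symd A B) = (p \in A) (+) (p \in B).
Proof. by rewrite !inE; case: (p \in A); case: (p \in B). Qed.

(* The parity of the exponent in [clsign]: the pairs [q = p] account for [e_p ^ 2 = -1].
   It is additive in [A] and in [B] for the symmetric difference, whence associativity. *)
Definition twist A B : bool :=
  \big[addb/false]_p \big[addb/false]_q [&& p \in A, q \in B & (q <= p)%N].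

Lemma twist_symdl A B C : twist (symd A B) C = twist A C (+) twist B C.
Proof.
rewrite /twist -big_split /=; apply: eq_bigr => p _.
rewrite -big_split /=; apply: eq_bigr => q _.
by rewrite in_symd; case: (p \in A); case: (p \in B) => //=; rewrite ?addbb ?addbF.
Qed.

Lemma twist_symdr A B C : twist A (symd B C) = twist A B (+) twist A C.
Proof.
rewrite /twist -big_split /=; apply: eq_bigr => p _.
rewrite -big_split /=; apply: eq_bigr => q _.
by rewrite in_symd; case: (p \in A); case: (q \in B); case: (q \in C); case: (_ <= _)%N.
Qed.

Lemma odd_sum (I : finType) (F : I -> nat) : odd (\sum_i F i) = \big[addb/false]_i odd (F i).
Proof. by apply: big_morph => // x y; rewrite oddD. Qed.

Lemma clsignE A B : clsign R A B = (-1) ^+ twist A B.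
Proof.
rewrite /clsign -signr_odd; congr (_ ^+ (nat_of_bool _)).
set S := finset _.
have -> : #|S| = (\sum_p \sum_q [&& p \in A, q \in B & (q < p)%N])%N.
  rewrite -sum1_card pair_big /= big_mkcond; apply: eq_bigr => p _.
  by rewrite inE; case: (_ && _).
have -> : #|A :&: B| = (\sum_p \sum_q [&& p \in A, q \in B & (q == p)])%N.
  rewrite -sum1_card big_mkcond; apply: eq_bigr => p _.
  rewrite (bigD1 p) //= eqxx andbT big1 ?addn0; last first.
    by move=> q /negbTE ->; rewrite !andbF.
  by rewrite inE; case: (_ && _).
rewrite -big_split odd_sum; apply: eq_bigr => p _ /=.
rewrite -big_split odd_sum; apply: eq_bigr => q _ /=.
rewrite [(q <= p)%N]leq_eqVlt -val_eqE oddD !oddb.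
by case: (p \in A); case: (q \in B) => //=; case: ltngtP.
Qed.

(* Locked, because unification would otherwise unfold the coefficient formulas. *)
Definition cm : Cl -> Cl -> Cl := locked (@clmul R d).
Definition cj : Cl -> Cl := locked (@clconj R d).

Lemma cmE : @clmul R d = cm. Proof. by rewrite /cm -lock. Qed.
Lemma cjE : @clconj R d = cj. Proof. by rewrite /cj -lock. Qed.

Definition sg A B : R[i] := (-1) ^+ twist A B.

Lemma clsignC A B : ((clsign R A B)%:C)%C = sg A B.
Proof. by rewrite clsignE rmorphXn rmorphN1. Qed.

Lemma cmDl a b c : cm (a + b) c = cm a c + cm b c.
Proof.
rewrite -cmE; apply/ffunP => C; rewrite !ffunE -big_split; apply: eq_bigr => A _ /=.
by rewrite -big_split; apply: eq_bigr => B _ /=; rewrite ffunE; ring.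
Qed.

Lemma cmDr a b c : cm a (b + c) = cm a b + cm a c.
Proof.
rewrite -cmE; apply/ffunP => C; rewrite !ffunE -big_split; apply: eq_bigr => A _ /=.
by rewrite -big_split; apply: eq_bigr => B _ /=; rewrite ffunE; ring.
Qed.

Lemma cmZl k a b : cm (k *: a) b = k *: cm a b.
Proof.
rewrite -cmE; apply/ffunP => C; rewrite !ffunE [RHS]mulr_sumr; apply: eq_bigr => A _ /=.
by rewrite mulr_sumr; apply: eq_bigr => B _ /=; rewrite ffunE /GRing.scale /=; ring.
Qed.

Lemma cmZr k a b : cm a (k *: b) = k *: cm a b.
Proof.
rewrite -cmE; apply/ffunP => C; rewrite !ffunE [RHS]mulr_sumr; apply: eq_bigr => A _ /=.
by rewrite mulr_sumr; apply: eq_bigr => B _ /=; rewrite ffunE /GRing.scale /=; ring.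
Qed.

Lemma cm0l a : cm 0 a = 0.
Proof. by rewrite -(scale0r (0 : Cl)) cmZl !scale0r. Qed.

Lemma cm0r a : cm a 0 = 0.
Proof. by rewrite -(scale0r (0 : Cl)) cmZr !scale0r. Qed.

Lemma cmNl a b : cm (- a) b = - cm a b.
Proof. by rewrite -scaleN1r cmZl scaleN1r. Qed.

Lemma cmNr a b : cm a (- b) = - cm a b.
Proof. by rewrite -scaleN1r cmZr scaleN1r. Qed.

Lemma cmBr a b c : cm a (b - c) = cm a b - cm a c.
Proof. by rewrite cmDr cmNr. Qed.

Lemma cmBl a b c : cm (a - b) c = cm a c - cm b c.
Proof. by rewrite cmDl cmNl. Qed.

Lemma cm_suml (I : Type) (r : seq I) (P : pred I) (F : I -> Cl) b :
  cm (\sum_(i <- r | P i) F i) b = \sum_(i <- r | P i) cm (F i) b.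
Proof.
by apply: (big_morph (fun a => cm a b)) => [x y|]; rewrite ?cmDl ?cm0l.
Qed.

Lemma cm_sumr (I : Type) (r : seq I) (P : pred I) (F : I -> Cl) b :
  cm b (\sum_(i <- r | P i) F i) = \sum_(i <- r | P i) cm b (F i).
Proof.
by apply: (big_morph (fun a => cm b a)) => [x y|]; rewrite ?cmDr ?cm0r.
Qed.

Definition clE A : Cl := locked [ffun B => (B == A)%:R].

Lemma clE_ A B : clE A B = (B == A)%:R.
Proof. by rewrite /clE -lock ffunE. Qed.

Lemma cl_decomp a : a = \sum_A a A *: clE A.
Proof.
apply/ffunP => B; rewrite sum_ffunE (bigD1 B) //= big1 ?addr0; last first.
  by move=> A AB; rewrite !(clE_, ffunE) eq_sym (negbTE AB) /GRing.scale /= mulr0.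
by rewrite !(clE_, ffunE) eqxx /GRing.scale /= mulr1.
Qed.

Lemma cm_clE A B : cm (clE A) (clE B) = sg A B *: clE (symd A B).
Proof.
rewrite -cmE; apply/ffunP => C; rewrite !(clE_, ffunE) (bigD1 A) //= [X in _ + X]big1 ?addr0; last first.
  move=> A' AA'; rewrite big1 // => B' _; rewrite !(clE_, ffunE) (negbTE AA').
  by rewrite mulr0 mul0r.
rewrite big_mkcond (bigD1 B) //= [X in _ + X]big1 ?addr0; last first.
  by move=> B' BB'; rewrite !(clE_, ffunE) (negbTE BB') mulr0 if_same.
rewrite !(clE_, ffunE) !eqxx /= !mulr1 clsignC -/(symd A B) [C == _]eq_sym /GRing.scale /=.
by case: (_ == C); rewrite ?mulr1 ?mulr0.
Qed.

Lemma cl1E : cl1 R d = clE finset.set0.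
Proof. by apply/ffunP => A; rewrite !(clE_, ffunE) cards_eq0; case: eqP. Qed.

Definition ce i : Cl := clE [set i].
Definition cv (x : 'rV[R]_d) : Cl := \sum_i ((x 0 i)%:C)%C *: ce i.

Lemma ceE i : clbasis R i = ce i.
Proof. by apply/ffunP => A; rewrite !(clE_, ffunE); case: eqP. Qed.

Lemma cvE : @clvec R d = cv.
Proof. by apply/funext => x; apply: eq_bigr => i _; rewrite ceE. Qed.

Definition conj_sign A : bool := odd (#|A| * #|A|.+1)./2.

Lemma cjD a b : cj (a + b) = cj a + cj b.
Proof. by rewrite -cjE; apply/ffunP => A; rewrite !(clE_, ffunE) rmorphD mulrDr. Qed.

Lemma cjZ k a : cj (k *: a) = conjc k *: cj a.
Proof. by rewrite -cjE; apply/ffunP => A; rewrite !(clE_, ffunE) rmorphM /GRing.scale /= mulrCA. Qed.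

Lemma cj_sum (I : Type) (r : seq I) (P : pred I) (F : I -> Cl) :
  cj (\sum_(i <- r | P i) F i) = \sum_(i <- r | P i) cj (F i).
Proof.
apply: (big_morph _ cjD).
by rewrite -cjE; apply/ffunP => A; rewrite !(clE_, ffunE) rmorph0 mulr0.
Qed.

Lemma cj_clE A : cj (clE A) = (-1) ^+ conj_sign A *: clE A.
Proof.
rewrite -cjE; apply/ffunP => B; rewrite !(clE_, ffunE) rmorph_nat /conj_sign signr_odd rmorphXn rmorphN1.
by case: eqP => [->//|_]; rewrite /GRing.scale /= !mulr0.
Qed.

Lemma conjc_sign (n : nat) : conjc ((-1) ^+ n) = (-1) ^+ n :> R[i].
Proof. by rewrite rmorphXn rmorphN1. Qed.

Lemma cjK a : cj (cj a) = a.
Proof.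
rewrite -cjE; apply/ffunP => A; rewrite !(clE_, ffunE) rmorphM /= conjcK mulrA -[RHS]mul1r; congr (_ * _).
by rewrite oppr0 -rmorphM /= -expr2 sqrr_sign.
Qed.

Lemma symdA A B C : symd A (symd B C) = symd (symd A B) C.
Proof. by apply/setP => p; rewrite !in_symd addbA. Qed.

Lemma cmA a b c : cm a (cm b c) = cm (cm a b) c.
Proof.
rewrite (cl_decomp a) !cm_suml; apply: eq_bigr => A _; rewrite !cmZl; congr (_ *: _).
rewrite (cl_decomp b) cm_sumr !cm_suml cm_sumr; apply: eq_bigr => B _.
rewrite cmZl !cmZr cmZl; congr (_ *: _).
rewrite (cl_decomp c) !cm_sumr; apply: eq_bigr => C _; rewrite !cmZr; congr (_ *: _).
rewrite !cm_clE cmZr cmZl !cm_clE !scalerA symdA.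
congr (_ *: _); rewrite /sg twist_symdl twist_symdr !signr_addb; ring.
Qed.

Lemma symd0l A : symd finset.set0 A = A.
Proof. by apply/setP => p; rewrite in_symd inE. Qed.

Lemma symd0r A : symd A finset.set0 = A.
Proof. by apply/setP => p; rewrite in_symd inE addbF. Qed.

Lemma twist0l A : twist finset.set0 A = false.
Proof. by rewrite /twist big1 // => p _; rewrite big1 // => q _; rewrite inE. Qed.

Lemma twist0r A : twist A finset.set0 = false.
Proof. by rewrite /twist big1 // => p _; rewrite big1 // => q _; rewrite inE andbF. Qed.

Lemma cm1l a : cm (cl1 R d) a = a.
Proof.
rewrite {2}(cl_decomp a) {1}(cl_decomp a) cm_sumr; apply: eq_bigr => A _.
by rewrite cmZr cl1E cm_clE symd0l /sg twist0l expr0 scale1r.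
Qed.

Lemma cm1r a : cm a (cl1 R d) = a.
Proof.
rewrite {2}(cl_decomp a) {1}(cl_decomp a) cm_suml; apply: eq_bigr => A _.
by rewrite cmZl cl1E cm_clE symd0r /sg twist0r expr0 scale1r.
Qed.

Lemma twist1 (i j : 'I_d) : twist [set i] [set j] = (j <= i)%N.
Proof.
rewrite /twist (bigD1 i) //= [X in _ (+) X]big1 ?addbF; last first.
  by move=> p pi; rewrite big1 // => q _; rewrite inE (negbTE pi).
rewrite (bigD1 j) //= [X in _ (+) X]big1 ?addbF; last first.
  by move=> q qj; rewrite !inE (negbTE qj) andbF.
by rewrite !inE !eqxx.
Qed.

Lemma ce_anticomm i j :
  cm (ce i) (ce j) + cm (ce j) (ce i) =
  if i == j then - 2 *: cl1 R d else 0.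
Proof.
rewrite /ce !cm_clE /sg !twist1.
have -> : symd [set j] [set i] = symd [set i] [set j].
  by apply/setP => p; rewrite !in_symd addbC.
rewrite -scalerDl; have [<-|ij] := eqVneq i j.
  rewrite leqnn (_ : symd _ _ = finset.set0) ?cl1E; last first.
    by apply/setP => p; rewrite in_symd addbb inE.
  by congr (_ *: _); ring.
suff -> : (-1) ^+ (j <= i)%N + (-1) ^+ (i <= j)%N = 0 :> R[i] by rewrite scale0r.
have : val i != val j by [].
by case: ltngtP => //= _ _; ring.
Qed.

Lemma cv_anticomm (x y : 'rV[R]_d) :
  cm (cv x) (cv y) + cm (cv y) (cv x) = ((- 2 * dotv x y)%:C)%C *: cl1 R d.
Proof.
rewrite /cv !cm_suml.
under eq_bigr do rewrite cm_sumr.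
under [X in _ + X]eq_bigr do rewrite cm_sumr.
rewrite [X in _ + X]exchange_big -big_split /= /dotv mulr_sumr rmorph_sum scaler_suml /=.
apply: eq_bigr => i _; rewrite -big_split /= (bigD1 i) //= big1 ?addr0; last first.
  move=> j ji; rewrite !cmZl !cmZr !scalerA [in X in _ + X]mulrC -scalerDr.
  by rewrite ce_anticomm eq_sym (negbTE ji) scaler0.
rewrite !cmZl !cmZr !scalerA [in X in _ + X]mulrC -scalerDr ce_anticomm eqxx scalerA; congr (_ *: _).
by rewrite !rmorphM rmorphN rmorph_nat; ring.
Qed.

(** A parity count with T(n) = n (n + 1) / 2. It combines T(m + n) = T(m) + T(n) + m n, the fact
    that the two twists add up to |A| |B| + |A :&: B| modulo 2, and |A| + |B| = |[symd A B]| + 2 |A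
    :&: B|. It is what makes conjugation reverse products. *)
Lemma conj_sign_symd A B :
  conj_sign (symd A B) (+) twist A B = conj_sign A (+) conj_sign B (+) twist B A.
Proof.
pose T n := (n * n.+1)./2.
have TD m n : T (m + n)%N = (T m + T n + m * n)%N.
  rewrite /T (_ : (m + n) * (m + n).+1 = m * m.+1 + n * n.+1 + (m * n).*2)%N; last by lia.
  rewrite halfD doubleK odd_double andbF add0n halfD.
  by rewrite !oddM /= !andbN add0n.
have tAB : twist A B (+) twist B A = odd (#|A| * #|B| + #|A :&: B|).
  rewrite -!sum1_card big_distrlr /= /twist [X in _ (+) X]exchange_big -big_split /=.
  rewrite [in RHS]big_mkcond [X in odd (_ + X)%N]big_mkcond -[in RHS]big_split odd_sum /=.
  apply: eq_bigr => p _.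
  rewrite -big_split /= inE; case: (p \in A) => /=; last first.
    by rewrite big1 // => q _; rewrite andbF.
  rewrite oddD [in RHS]big_mkcond odd_sum.
  rewrite (bigD1 p) //= [in RHS](bigD1 p) //= leqnn !andbT addbb addFb.
  rewrite [RHS]addbC addbA; case: (p \in B) => /=.
    apply: eq_bigr => q qp; case: (q \in B) => //=.
    have : val q != val p by [].
    by case: ltngtP.
  apply: eq_bigr => q qp; case: (q \in B) => //=.
  have : val q != val p by [].
  by case: ltngtP.
have card : (#|symd A B| + #|A :&: B| + #|A :&: B| = #|A| + #|B|)%N.
  have AB : A :&: B \subset A :|: B .
    by apply/fintype.subsetP => p; rewrite !inE => /andP[-> _].
  have := cardsID (A :&: B) (A :|: B); rewrite -/(symd A B) (finset.setIidPr AB) => H.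
  by rewrite -[RHS]cardsUI -H; congr addn; rewrite addnC.
have := congr1 (fun n => odd (T n)) card; rewrite -addnA !TD !oddD !oddM.
rewrite /conj_sign -/(T _) -/(T _) -/(T _); move: tAB; rewrite oddD oddM.
rewrite oddD !addbb andbb andbF addbF addFb.
move: (odd #|A :&: B|) (twist A B) (twist B A) (odd (T _)) (odd (T _)) (odd (T _)) (_ && _).
by do 7!case.
Qed.

Lemma cjM a b : cj (cm a b) = cm (cj b) (cj a).
Proof.
rewrite (cl_decomp a) cm_suml !cj_sum cm_sumr; apply: eq_bigr => A _.
rewrite cmZl !cjZ cmZr; congr (_ *: _).
rewrite (cl_decomp b) cm_sumr !cj_sum cm_suml; apply: eq_bigr => B _.
rewrite cmZr !cjZ cmZl; congr (_ *: _).
rewrite cm_clE cjZ !cj_clE cmZl cmZr cm_clE !scalerA.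
have -> : symd B A = symd A B by apply/setP => p; rewrite !in_symd addbC.
congr (_ *: _); rewrite /sg conjc_sign -!signr_addb addbC conj_sign_symd.
by rewrite [conj_sign A (+) _]addbC.
Qed.

Lemma cj_basis i : cj (ce i) = - ce i :> Cl.
Proof. by rewrite /ce cj_clE /conj_sign cards1 /= expr1 scaleN1r. Qed.

End clifford.

(** * Dunkl operators on polynomials *)

Section polynomials.
Context {R : realType} {d : nat}.
Local Notation V := 'rV[R]_d.
Local Notation Cl := (Cl R d).
Local Notation "r %:K" := ((r%:C)%C) (at level 2, format "r %:K").

Lemma rcD (x y : R) : (x + y)%:K = x%:K + y%:K. Proof. exact: rmorphD. Qed.
Lemma rcB (x y : R) : (x - y)%:K = x%:K - y%:K. Proof. exact: rmorphB. Qed.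
Lemma rcN (x : R) : (- x)%:K = - x%:K. Proof. exact: rmorphN. Qed.
Lemma rcM (x y : R) : (x * y)%:K = x%:K * y%:K. Proof. exact: rmorphM. Qed.
Lemma rc_sum (I : Type) (r : seq I) (P : pred I) (F : I -> R) :
  (\sum_(i <- r | P i) F i)%:K = \sum_(i <- r | P i) (F i)%:K.
Proof. exact: rmorph_sum. Qed.
Lemma ReZ (x : R) (z : R[i]) : complex.Re (x%:K * z) = x * complex.Re z.
Proof. by case: z => a b /=; rewrite mul0r subr0. Qed.
Lemma ImZ (x : R) (z : R[i]) : complex.Im (x%:K * z) = x * complex.Im z.
Proof. by case: z => a b /=; rewrite mul0r addr0. Qed.

Lemma cl_coef0 A : (0 : Cl) A = 0. Proof. by rewrite ffunE. Qed.
Lemma cl_coefD (a b : Cl) A : (a + b) A = a A + b A. Proof. by rewrite ffunE. Qed.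
Lemma cl_coefN (a : Cl) A : (- a) A = - a A. Proof. by rewrite ffunE. Qed.
Lemma cl_coefZ k (a : Cl) A : (k *: a) A = k * a A. Proof. by rewrite ffunE. Qed.
Definition cl_coefE := (cl_coef0, cl_coefD, cl_coefN, cl_coefZ).

Lemma clD_eq (a b c e : Cl) : a = c -> b = e -> a + b = c + e.
Proof. by move=> -> ->. Qed.
Lemma clZ_eq k l (a b : Cl) : k = l -> a = b -> k *: a = l *: b.
Proof. by move=> -> ->. Qed.

(** Homogeneous polynomials generated by multiplication with coordinates: identities for Dunkl
    operators then follow by induction from their commutation with one coordinate. [hom_polyP]
    identifies this predicate with [hom_poly]. *)
Inductive hpol : nat -> (V -> Cl) -> Prop :=
| hpol_zero n : hpol n (fun=> 0)
| hpol_cst c : hpol 0 (fun=> c)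
| hpol_add n f g : hpol n f -> hpol n g -> hpol n (fun x => f x + g x)
| hpol_coord n j f : hpol n f -> hpol n.+1 (fun x => (x 0 j)%:K *: f x).

Lemma eq_hpol n f g : f =1 g -> hpol n f -> hpol n g.
Proof. by move=> /funext ->. Qed.

Lemma hpol_sum (I : Type) (r : seq I) (P : pred I) n (F : I -> V -> Cl) :
  (forall i, P i -> hpol n (F i)) -> hpol n (fun x => \sum_(i <- r | P i) F i x).
Proof.
move=> hF; elim: r => [|i r IH].
  by apply: eq_hpol (hpol_zero n) => x; rewrite big_nil.
have [Pi|Pi] := boolP (P i).
  by apply: eq_hpol (hpol_add (hF i Pi) IH) => x; rewrite big_cons Pi.
by apply: eq_hpol IH => x; rewrite big_cons (negbTE Pi).
Qed.

Lemma hpol_Z n k f : hpol n f -> hpol n (fun x => k *: f x).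
Proof.
elim=> {n f} [n|c|n f g _ hf _ hg|n j f _ hf].
- by apply: eq_hpol (hpol_zero n) => x; rewrite scaler0.
- exact: hpol_cst.
- by apply: eq_hpol (hpol_add hf hg) => x; rewrite scalerDr.
- by apply: eq_hpol (hpol_coord j hf) => x; rewrite !scalerA mulrC.
Qed.

Lemma hpol_N n f : hpol n f -> hpol n (fun x => - f x).
Proof. by move=> /(hpol_Z (-1)); apply: eq_hpol => x; rewrite scaleN1r. Qed.

Lemma hpol_B n f g : hpol n f -> hpol n g -> hpol n (fun x => f x - g x).
Proof. by move=> hf /hpol_N; exact: hpol_add. Qed.

Lemma hpol_cml n c f : hpol n f -> hpol n (fun x => cm c (f x)).
Proof.
elim=> {n f} [n|b|n f g _ hf _ hg|n j f _ hf].
- by apply: eq_hpol (hpol_zero n) => x; rewrite cm0r.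
- exact: hpol_cst.
- by apply: eq_hpol (hpol_add hf hg) => x; rewrite cmDr.
- by apply: eq_hpol (hpol_coord j hf) => x; rewrite cmZr.
Qed.

Lemma hpol_cmr n c f : hpol n f -> hpol n (fun x => cm (f x) c).
Proof.
elim=> {n f} [n|b|n f g _ hf _ hg|n j f _ hf].
- by apply: eq_hpol (hpol_zero n) => x; rewrite cm0l.
- exact: hpol_cst.
- by apply: eq_hpol (hpol_add hf hg) => x; rewrite cmDl.
- by apply: eq_hpol (hpol_coord j hf) => x; rewrite cmZl.
Qed.

Lemma dotvE (a x : V) : dotv a x = \sum_k a 0 k * x 0 k.
Proof. by []. Qed.

Lemma hpol_dotv n a f : hpol n f -> hpol n.+1 (fun x => (dotv a x)%:K *: f x).
Proof.
move=> hf; have : hpol n.+1 (fun x => \sum_k (a 0 k)%:K *: ((x 0 k)%:K *: f x)).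
  by apply: hpol_sum => k _; apply: hpol_Z; exact: hpol_coord.
apply: eq_hpol => x; rewrite dotvE rc_sum scaler_suml; apply: eq_bigr => k _.
by rewrite rcM scalerA.
Qed.

Lemma refl_coord (a x : V) j :
  refl a x 0 j = x 0 j - 2 / dotv a a * a 0 j * dotv a x.
Proof. by rewrite /refl !mxE; ring. Qed.

Lemma hpol_refl n a f : hpol n f -> hpol n (fun x => f (refl a x)).
Proof.
elim=> {n f} [n|c|n f g _ hf _ hg|n j f _ hf].
- exact: hpol_zero.
- exact: hpol_cst.
- exact: hpol_add hf hg.
apply: eq_hpol (hpol_B (hpol_coord j hf) (hpol_Z (2 / dotv a a * a 0 j)%:K (hpol_dotv a hf))) => x.
by rewrite scalerA -rcM -scalerBl -rcB refl_coord.
Qed.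

Lemma hpol_vec n f : hpol n f -> hpol n.+1 (fun x => cm (cv x) (f x)).
Proof.
move=> hf; have : hpol n.+1 (fun x => \sum_k (x 0 k)%:K *: cm (ce k) (f x)).
  by apply: hpol_sum => k _; apply: hpol_coord; exact: hpol_cml.
by apply: eq_hpol => x; rewrite /cv cm_suml; apply: eq_bigr => k _; rewrite cmZl.
Qed.

Lemma hpol_prod (r : seq 'I_d) (m : 'I_d -> nat) c :
  hpol (\sum_(i <- r) m i) (fun x => (\prod_(i <- r) x 0 i ^+ m i)%:K *: c).
Proof.
elim: r => [|i r IH].
  by rewrite big_nil; apply: eq_hpol (hpol_cst c) => x; rewrite big_nil scale1r.
apply: (@eq_hpol _ (fun x => (x 0 i ^+ m i)%:K *: ((\prod_(i <- r) x 0 i ^+ m i)%:K *: c))).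
  by move=> x; rewrite big_cons rcM scalerA.
rewrite big_cons; elim: (m i) => [|k IHk].
  by apply: eq_hpol IH => x; rewrite expr0 scale1r.
by apply: eq_hpol (hpol_coord i IHk) => x; rewrite exprS rcM scalerA.
Qed.

Definition mono (m : 'I_d -> nat) (x : V) : R := \prod_i x 0 i ^+ m i.

Lemma hom_poly_sum n (f g : V -> Cl) : hom_poly n f -> hom_poly n g -> hom_poly n (fun x => f x + g x).
Proof.
move=> [c hc] [e he]; exists (fun al => c al + e al) => x.
by rewrite hc he -big_split; apply: eq_bigr => al _; rewrite scalerDr.
Qed.

Lemma hom_poly_zero n : hom_poly n (fun _ : V => 0 : Cl).
Proof. by exists (fun=> 0) => x; rewrite big1 // => al _; rewrite scaler0. Qed.

Lemma hom_poly_mono n m c : (\sum_i m i)%N = n ->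
  hom_poly n (fun x : V => (mono m x)%:K *: c : Cl).
Proof.
move=> mn; have le i : (m i < n.+1)%N by rewrite ltnS -mn (bigD1 i) //= leq_addr.
pose al0 : {ffun 'I_d -> 'I_n.+1} := [ffun i => Ordinal (le i)].
exists (fun al => if al == al0 then c else 0) => x.
rewrite (bigD1 al0) /=; last first.
  by apply/eqP; rewrite -[RHS]mn; apply: eq_bigr => i _; rewrite ffunE.
rewrite eqxx [X in _ + X]big1 ?addr0; last by move=> al /andP[_ /negbTE ->]; rewrite scaler0.
by congr (_%:K *: _); apply: eq_bigr => i _; rewrite ffunE.
Qed.

Lemma hom_polyP n (f : V -> Cl) : hom_poly n f <-> hpol n f.
Proof.
split=> [[c hc]|hf].
  rewrite (funext hc).
  by apply: hpol_sum => al /eqP {1}<-; exact: hpol_prod.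
(* A monomial factor is carried along, so that multiplication by a coordinate becomes an increment
   of its exponent. *)
suff H m : hom_poly (n + \sum_i m i) (fun x => (mono m x)%:K *: f x).
  have := H (fun=> 0%N); rewrite big1 // addn0 => -[c hc]; exists c => x.
  by rewrite -hc /mono big1 ?scale1r // => i _; rewrite expr0.
elim: hf m => {n f} [n|c|n f g _ hf _ hg|n j f _ hf] m.
- have [c hc] := hom_poly_zero (n + \sum_i m i); exists c => x.
  by rewrite -hc scaler0.
- by rewrite add0n; exact: hom_poly_mono.
- have [c hc] := hom_poly_sum (hf m) (hg m); exists c => x.
  by rewrite -hc scalerDr.
have := hf (fun i => m i + (i == j))%N.
have -> : (\sum_i (m i + (i == j)) = (\sum_i m i).+1)%N.
  by rewrite big_split /= [X in (_ + X)%N](bigD1 j) //= eqxx [X in (_ + (_ + X))%N]big1 ?addn0 ?addn1 // => i /negbTE ->.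
rewrite addnS -addSn => -[c hc]; exists c => x; rewrite -hc scalerA -rcM.
congr (_%:K *: _); rewrite /mono (bigD1 j) //= [RHS](bigD1 j) //= eqxx addn1 exprSr.
rewrite mulrAC; congr (_ * _); apply: eq_bigr => i /negbTE ->; by rewrite addn0.
Qed.

Definition cderiv (v : V) (f f' : V -> Cl) := forall x A,
  is_derive x v (fun y => complex.Re (f y A)) (complex.Re (f' x A)) /\
  is_derive x v (fun y => complex.Im (f y A)) (complex.Im (f' x A)).

Definition pd (v : V) : (V -> Cl) -> V -> Cl := locked (dirder v).

Lemma pdE v : dirder v = pd v.
Proof. by rewrite /pd -lock. Qed.

Lemma cderivE v f f' : cderiv v f f' -> pd v f = f'.
Proof.
move=> h; rewrite -pdE; apply/funext => x; apply/ffunP => A; rewrite ffunE.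
have [h1 h2] := h x A.
by rewrite (@derive_val _ _ _ _ _ _ _ h1) (@derive_val _ _ _ _ _ _ _ h2); case: (f' x A).
Qed.

Lemma cderiv_cst v c : cderiv v (fun=> c) (fun=> 0).
Proof. by move=> x A; rewrite cl_coefE; split; exact: is_derive_cst. Qed.

Lemma cderivD v f g f' g' : cderiv v f f' -> cderiv v g g' ->
  cderiv v (fun x => f x + g x) (fun x => f' x + g' x).
Proof.
move=> hf hg x A; have [f1 f2] := hf x A; have [g1 g2] := hg x A.
split.
  rewrite (_ : (fun y => _) = (fun y => complex.Re (f y A)) + (fun y => complex.Re (g y A))).
    by rewrite cl_coefE raddfD; exact: is_deriveD.
  by apply/funext => y; rewrite cl_coefE raddfD.
rewrite (_ : (fun y => _) = (fun y => complex.Im (f y A)) + (fun y => complex.Im (g y A))).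
  by rewrite cl_coefE raddfD; exact: is_deriveD.
by apply/funext => y; rewrite cl_coefE raddfD.
Qed.

Lemma cderiv_coord v j f f' : cderiv v f f' ->
  cderiv v (fun x => (x 0 j)%:K *: f x) (fun x => (v 0 j)%:K *: f x + (x 0 j)%:K *: f' x).
Proof.
move=> hf x A; have [f1 f2] := hf x A; split.
  rewrite (_ : (fun y => _) = (fun y : V => y 0 j * complex.Re (f y A))); last first.
    by apply/funext => y; rewrite cl_coefE ReZ.
  rewrite !cl_coefE raddfD /= !ReZ.
  exact: is_deriveMr (is_derive_coord j x v) f1.
rewrite (_ : (fun y => _) = (fun y : V => y 0 j * complex.Im (f y A))); last first.
  by apply/funext => y; rewrite cl_coefE ImZ.
rewrite !cl_coefE raddfD /= !ImZ.
exact: is_deriveMr (is_derive_coord j x v) f2.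
Qed.

Definition smooth (f : V -> Cl) := forall v, exists f', cderiv v f f'.

Lemma smooth_pd v f : smooth f -> cderiv v f (pd v f).
Proof. by move=> /(_ v)[f' hf']; rewrite (cderivE hf'). Qed.

Lemma smoothD f g : smooth f -> smooth g -> smooth (fun x => f x + g x).
Proof.
by move=> hf hg v; have [f' hf'] := hf v; have [g' hg'] := hg v; eexists; exact: cderivD hf' hg'.
Qed.

Lemma hpol_smooth n f : hpol n f -> smooth f.
Proof.
elim=> {n f} [n|c|n f g _ hf _ hg|n j f _ hf].
- by move=> v; exists (fun=> 0); exact: cderiv_cst.
- by move=> v; exists (fun=> 0); exact: cderiv_cst.
- exact: smoothD.
- by move=> v; have [f' hf'] := hf v; eexists; exact: cderiv_coord hf'.
Qed.

Lemma pd_coord v j f : smooth f ->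
  pd v (fun x => (x 0 j)%:K *: f x) = fun x => (v 0 j)%:K *: f x + (x 0 j)%:K *: pd v f x.
Proof. by move=> hf; apply: cderivE; apply: cderiv_coord; exact: smooth_pd. Qed.

Lemma pdD v f g : smooth f -> smooth g ->
  pd v (fun x => f x + g x) = fun x => pd v f x + pd v g x.
Proof.
by move=> hf hg; apply: cderivE; apply: cderivD; exact: smooth_pd.
Qed.

Lemma pd_cst v c : pd v (fun _ : V => c : Cl) = fun=> 0.
Proof. exact/cderivE/cderiv_cst. Qed.

Lemma euler n f x : hpol n f -> pd x f x = n%:R *: f x.
Proof.
elim=> {n f} [n|c|n f g hf ef hg eg|n j f hf ef].
- by rewrite pd_cst scaler0.
- by rewrite pd_cst scale0r.
- by rewrite (pdD _ (hpol_smooth hf) (hpol_smooth hg)) ef eg scalerDr.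
rewrite (pd_coord _ _ (hpol_smooth hf)) ef !scalerA [_ * n%:R]mulrC -scalerDl -natr1 mulrDl mul1r.
by rewrite addrC.
Qed.

Definition dq (a : V) : (V -> Cl) -> V -> Cl := locked (dquot a).

Lemma dqE a : dquot a = dq a.
Proof. by rewrite /dq -lock. Qed.

Lemma dq_off a f x : dotv a x != 0 -> dq a f x = ((dotv a x)^-1)%:K *: (f x - f (refl a x)).
Proof. by move=> ax; rewrite -dqE /dquot ax. Qed.

Lemma dq_on a f x : dotv a x = 0 -> dq a f x = (2 / dotv a a)%:K *: pd a f x.
Proof. by move=> ax; rewrite -dqE /dquot ax eqxx -pdE. Qed.

Lemma dq_cst a c x : dq a (fun=> c) x = 0.
Proof.
have [/dq_on ->|/dq_off ->] := eqVneq (dotv a x) 0; first by rewrite pd_cst scaler0.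
by rewrite subrr scaler0.
Qed.

Lemma dqD a f g x : smooth f -> smooth g ->
  dq a (fun x => f x + g x) x = dq a f x + dq a g x.
Proof.
move=> hf hg; have [ax|ax] := eqVneq (dotv a x) 0.
  by rewrite !dq_on // (pdD _ hf hg) scalerDr.
by rewrite !dq_off // -scalerDr opprD addrACA.
Qed.

Lemma refl_hyperplane (a x : V) : dotv a x = 0 -> refl a x = x.
Proof. by move=> ax; rewrite /refl ax mulr0 mul0r scale0r subr0. Qed.

(** Twisted Leibniz rule: the difference quotient of x_j is the constant 2 a_j / <a,a>, and it
    multiplies the reflected value of f. On the hyperplane the reflection is trivial there and the
    rule is that of the derivative. *)
Lemma dq_coord a j f x : smooth f ->
  dq a (fun x => (x 0 j)%:K *: f x) x =
  (x 0 j)%:K *: dq a f x + (2 / dotv a a * a 0 j)%:K *: f (refl a x).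
Proof.
move=> hf; have [ax|ax] := eqVneq (dotv a x) 0.
  rewrite !dq_on // (pd_coord _ _ hf) refl_hyperplane // scalerDr addrC !scalerA -!rcM.
  by rewrite [x 0 j * _]mulrC.
rewrite !dq_off // refl_coord; apply/ffunP => A; rewrite !cl_coefE !rcB !rcM.
have : ((dotv a x)^-1)%:K * (dotv a x)%:K = 1 by rewrite -rcM mulVf.
set u := ((dotv a x)^-1)%:K; set v := (dotv a x)%:K => uv.
set F := f x A; set G := f (refl a x) A.
transitivity (u * ((x 0 j)%:K * (F - G)) + (u * v) * (2%:K * (dotv a a)^-1%:K * (a 0 j)%:K * G)).
  by ring.
by rewrite uv; ring.
Qed.

(* <a,x> dq a f x = f x - f (refl a x) holds on the hyperplane as well *)
Lemma dotv_dq a f x : (dotv a x)%:K *: dq a f x = f x - f (refl a x).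
Proof.
have [ax|ax] := eqVneq (dotv a x) 0; last by rewrite dq_off // scalerA -rcM divff // scale1r.
by rewrite ax scale0r refl_hyperplane // subrr.
Qed.

Section dunkl.
Variables (Rp : seq V) (kappa : V -> R).
Hypothesis Rp0 : forall a, a \in Rp -> a != 0.
Local Notation mu := (mu Rp kappa).

Definition dunkl_op (i : 'I_d) : (V -> Cl) -> V -> Cl := locked (dunklT Rp kappa i).

Local Notation T := dunkl_op.

Lemma dunklE i f x : T i f x =
  pd (unitv R i) f x + \sum_(a <- Rp) (kappa a * a 0 i)%:K *: dq a f x.
Proof.
rewrite /dunkl_op -lock /dunklT pdE; congr (_ + _).
by apply: eq_bigr => a _; rewrite dqE.
Qed.

Lemma dunkl_cst i c x : T i (fun=> c) x = 0.
Proof. by rewrite dunklE pd_cst add0r big1 // => a _; rewrite dq_cst scaler0. Qed.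

Lemma dunklD i f g x : smooth f -> smooth g ->
  T i (fun x => f x + g x) x = T i f x + T i g x.
Proof.
move=> hf hg; rewrite !dunklE (pdD _ hf hg) addrACA -big_split; apply: clD_eq => //.
by apply: eq_bigr => a _; rewrite (dqD _ _ hf hg) scalerDr.
Qed.

Lemma dunkl_coord i j f x : smooth f ->
  T i (fun x => (x 0 j)%:K *: f x) x =
  (x 0 j)%:K *: T i f x + ((i == j)%:R%:K *: f x +
    \sum_(a <- Rp) (kappa a * (2 / dotv a a) * (a 0 i * a 0 j))%:K *: f (refl a x)).
Proof.
move=> hf; rewrite !dunklE (pd_coord _ _ hf) scalerDr scaler_sumr addrACA.
rewrite -big_split /= [_ *: f x + _]addrC (_ : unitv R i 0 j = (i == j)%:R); last first.
  by rewrite mxE eqxx /= eq_sym.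
apply: clD_eq => //; apply: eq_bigr => a _; rewrite (dq_coord _ _ _ hf) scalerDr !scalerA -!rcM.
by apply: clD_eq; apply: clZ_eq => //; congr (_%:K); ring.
Qed.

Lemma hpol_dunkl n i f : hpol n f -> (if n is m.+1 then hpol m (T i f) else T i f = fun=> 0).
Proof.
elim=> {n f} [[|n]|c|[|n] f g hf Tf hg Tg|n j f hf Tf].
- by apply/funext => x; rewrite dunkl_cst.
- by apply: eq_hpol (hpol_zero n) => x; rewrite dunkl_cst.
- by apply/funext => x; rewrite dunkl_cst.
- by apply/funext => x; rewrite (dunklD _ _ (hpol_smooth hf) (hpol_smooth hg)) Tf Tg addr0.
- by apply: eq_hpol (hpol_add Tf Tg) => x; rewrite (dunklD _ _ (hpol_smooth hf) (hpol_smooth hg)).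
have hx : hpol n (fun x => (x 0 j)%:K *: T i f x).
  case: n hf Tf => [|n] hf Tf; last exact: hpol_coord.
  by apply: eq_hpol (hpol_zero 0) => x; rewrite Tf scaler0.
apply: (eq_hpol (fun x => esym (dunkl_coord i j x (hpol_smooth hf)))); apply: hpol_add hx _.
apply: hpol_add; first exact: hpol_Z.
by apply: hpol_sum => a _; apply: hpol_Z; exact: hpol_refl.
Qed.

Lemma dunkl_cml n i c f x : hpol n f -> T i (fun x => cm c (f x)) x = cm c (T i f x).
Proof.
move=> hf; elim: hf x => {n f} [n|b|n f g hf Tf hg Tg|n j f hf Tf] x.
- by rewrite !dunkl_cst cm0r.
- by rewrite !dunkl_cst cm0r.
- rewrite (dunklD _ _ (hpol_smooth hf) (hpol_smooth hg)) cmDr -Tf -Tg.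
  rewrite -(dunklD _ _ (hpol_smooth (hpol_cml c hf)) (hpol_smooth (hpol_cml c hg))); congr (T i _ x).
  by apply/funext => y; rewrite cmDr.
rewrite (dunkl_coord _ _ _ (hpol_smooth hf)) !cmDr !cmZr cm_sumr -Tf.
transitivity (T i (fun y => (y 0 j)%:K *: cm c (f y)) x).
  by congr (T i _ x); apply/funext => y; rewrite cmZr.
rewrite (dunkl_coord _ _ _ (hpol_smooth (hpol_cml c hf))); do 2![apply: clD_eq => //].
by apply: eq_bigr => a _; rewrite cmZr.
Qed.

Lemma dunkl_cmr n i c f x : hpol n f -> T i (fun x => cm (f x) c) x = cm (T i f x) c.
Proof.
move=> hf; elim: hf x => {n f} [n|b|n f g hf Tf hg Tg|n j f hf Tf] x.
- by rewrite !dunkl_cst cm0l.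
- by rewrite !dunkl_cst cm0l.
- rewrite (dunklD _ _ (hpol_smooth hf) (hpol_smooth hg)) cmDl -Tf -Tg.
  rewrite -(dunklD _ _ (hpol_smooth (hpol_cmr c hf)) (hpol_smooth (hpol_cmr c hg))); congr (T i _ x).
  by apply/funext => y; rewrite cmDl.
rewrite (dunkl_coord _ _ _ (hpol_smooth hf)) !cmDl !cmZl cm_suml -Tf.
transitivity (T i (fun y => (y 0 j)%:K *: cm (f y) c) x).
  by congr (T i _ x); apply/funext => y; rewrite cmZl.
rewrite (dunkl_coord _ _ _ (hpol_smooth (hpol_cmr c hf))); do 2![apply: clD_eq => //].
by apply: eq_bigr => a _; rewrite cmZl.
Qed.

Lemma pd_unitv n f (x : V) : hpol n f -> \sum_i (x 0 i)%:K *: pd (unitv R i) f x = pd x f x.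
Proof.
move=> hf; rewrite (euler x hf).
elim: hf => {n f} [n|c|n f g hf ef hg eg|n j f hf ef].
- by rewrite scaler0 big1 // => i _; rewrite pd_cst scaler0.
- by rewrite scale0r big1 // => i _; rewrite pd_cst scaler0.
- rewrite scalerDr -ef -eg -big_split; apply: eq_bigr => i _.
  by rewrite (pdD _ (hpol_smooth hf) (hpol_smooth hg)) scalerDr.
under eq_bigr do rewrite (pd_coord _ _ (hpol_smooth hf)) scalerDr.
rewrite big_split -natr1 scalerDl scale1r [RHS]addrC /=; apply: clD_eq.
  rewrite (bigD1 j) //= big1 ?addr0; first by rewrite mxE !eqxx scale1r.
  by move=> i ij; rewrite mxE eq_sym (negbTE ij) andbF scale0r scaler0.
rewrite scalerA mulrC -scalerA -ef scaler_sumr; apply: eq_bigr => i _.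
by rewrite !scalerA mulrC.
Qed.

(** Summing x_i a_i over i rebuilds <a,x>, which cancels the denominator of the difference quotient
    by [dotv_dq]. The remaining part is the Euler identity. *)
Lemma euler_dunkl n f (x : V) : hpol n f ->
  \sum_i (x 0 i)%:K *: T i f x =
  n%:R *: f x + \sum_(a <- Rp) (kappa a)%:K *: (f x - f (refl a x)).
Proof.
move=> hf; under eq_bigr do rewrite dunklE scalerDr scaler_sumr.
rewrite big_split /= (pd_unitv _ hf) (euler x hf); apply: clD_eq => //.
rewrite exchange_big; apply: eq_bigr => a _; rewrite -dotv_dq scalerA -rcM.
rewrite dotvE mulr_sumr rc_sum scaler_suml; apply: eq_bigr => i _.
by rewrite scalerA -rcM; apply: clZ_eq => //; congr (_%:K); ring.
Qed.

End dunkl.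

End polynomials.

(** * The Dunkl-Dirac operator and the Fischer decomposition *)

Section linear_combinations.
Variables (K : comNzRingType) (M : lmodType K).

Lemma lin_sub2 (a b : M) (k : K) : - (- a - k *: b) - (k + 2) *: b = a - 2 *: b.
Proof. by rewrite opprB opprK scalerDl opprD addrA [k *: b + a]addrC addrK. Qed.

Lemma lin_mul4 (a b c e : M) :
  a - 2 *: b - 2 *: (c - 2 *: e) = a - 2 *: b - 2 *: c + 4 *: e.
Proof.
by rewrite scalerBr scalerA opprB [_ - 2 *: c]addrC addrA (_ : 2 * 2 = 4) //; ring.
Qed.

Lemma lin_comm (a b c e g h : M) :
  a - 2 *: (b - 2 *: c) - 2 *: e + 4 *: (g - 2 *: h) =
  a - 2 *: e - 2 *: b + 4 *: g + 4 *: (c - 2 *: h).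
Proof.
rewrite !scalerBr !scalerA !opprB (_ : 2 * 2 = 4); last by ring.
by rewrite !addrA [LHS](ACl (1*4*3*5*2*6)).
Qed.

End linear_combinations.

Section dirac.
Context {R : realType} {d : nat}.
Local Notation V := 'rV[R]_d.
Local Notation Cl := (Cl R d).
Local Notation "r %:K" := ((r%:C)%C) (at level 2, format "r %:K").
Variables (Rp : seq V) (kappa : V -> R).
Hypothesis Rp0 : forall a, a \in Rp -> a != 0.
Local Notation mu := (mu Rp kappa).
Local Notation T := (dunkl_op Rp kappa).

Definition dirac_op : (V -> Cl) -> V -> Cl := locked (dunkl_dirac Rp kappa).
Local Notation Dir := dirac_op.
Definition mulx (f : V -> Cl) (x : V) : Cl := cm (cv x) (f x).
Definition raising_op (f : V -> Cl) (x : V) : Cl := Dir f x - 2 *: mulx f x.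
Local Notation Dp := raising_op.

Lemma diracE f x : Dir f x = \sum_i cm (ce i) (T i f x).
Proof.
rewrite /dirac_op -lock /dunkl_dirac; apply: eq_bigr => i _.
by rewrite cmE ceE /dunkl_op -lock.
Qed.

Lemma DplusE : Dplus Rp kappa = Dp.
Proof.
by apply/funext => f; apply/funext => x; rewrite /Dplus /raising_op /dirac_op -lock cmE cvE.
Qed.

Lemma mulxE f x : mulx f x = \sum_j (x 0 j)%:K *: cm (ce j) (f x).
Proof. by rewrite /mulx /cv cm_suml; apply: eq_bigr => j _; rewrite cmZl. Qed.

Lemma smooth_sum (I : Type) (r : seq I) (F : I -> V -> Cl) :
  (forall i, smooth (F i)) -> smooth (fun x => \sum_(i <- r) F i x).
Proof.
move=> hF; elim: r => [|i r IH].
  rewrite (_ : (fun x => _) = fun=> 0); last by apply/funext => x; rewrite big_nil.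
  exact: hpol_smooth (hpol_zero 0).
rewrite (_ : (fun x => _) = fun x => F i x + \sum_(i <- r) F i x); first exact: smoothD.
by apply/funext => x; rewrite big_cons.
Qed.

Lemma dunkl_big i (I : Type) (r : seq I) (F : I -> V -> Cl) x : (forall j, smooth (F j)) ->
  T i (fun x => \sum_(j <- r) F j x) x = \sum_(j <- r) T i (F j) x.
Proof.
move=> hF; elim: r => [|j r IH].
  rewrite (_ : (fun x => _) = fun=> 0); last by apply/funext => y; rewrite big_nil.
  by rewrite dunkl_cst big_nil.
rewrite (_ : (fun x => _) = fun x => F j x + \sum_(i <- r) F i x).
  by rewrite dunklD ?big_cons ?IH //; exact: smooth_sum.
by apply/funext => y; rewrite big_cons.
Qed.

Lemma ce_swap i j (b : Cl) :
  cm (ce i) (cm (ce j) b) = - cm (ce j) (cm (ce i) b) - (2 * (i == j)%:R) *: b.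
Proof.
have H : cm (ce i) (ce j) = - cm (ce j) (ce i) - (2 * (i == j)%:R) *: cl1 R d.
  rewrite -[LHS](addrK (cm (ce j) (ce i))) ce_anticomm addrC; apply: clD_eq => //.
  by case: (i == j); rewrite ?mulr1 ?mulr0 ?scale0r ?oppr0 // scaleNr.
by rewrite cmA H cmBl cmNl cmZl cm1l cmA.
Qed.

Lemma cl_half (u v : Cl) : u + u = 2 *: v -> u = v.
Proof.
move=> H; apply/ffunP => A; have := congr1 (fun c : Cl => c A) H.
rewrite !cl_coefE => E; have two : 2 != 0 :> R[i] by rewrite pnatr_eq0.
by apply: (mulfI two); rewrite -E; ring.
Qed.

Lemma ce_sqr i (b : Cl) : cm (ce i) (cm (ce i) b) = - b.
Proof.
apply: cl_half; rewrite {1}ce_swap eqxx mulr1.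
by rewrite addrAC addNr sub0r scalerN.
Qed.

Lemma cv_sqr (a : V) : cm (cv a) (cv a) = (- norm2 a)%:K *: cl1 R d.
Proof.
apply: cl_half; rewrite cv_anticomm scalerA; apply: clZ_eq => //.
by rewrite -/(norm2 a) mulNr !rcN rcM rmorph_nat mulrN.
Qed.

Lemma rc_nat n : (n%:R)%:K = n%:R :> R[i].
Proof. exact: rmorph_nat. Qed.

Lemma rcNn n : (- n%:R)%:K = - n%:R :> R[i].
Proof. by rewrite rcN rmorph_nat. Qed.

(** The commutators of T_i and x_j split the left side into three sums. In [S1] the e_i and e_j are
    interchanged, which gives -x D f - 2 sum x_i T_i f; [S2] is -d f because e_i^2 = -1; [S3] is -2
    sum kappa(a) f(refl a x) because a^2 = -|a|^2. The reflected terms of [S3] cancel those of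
    [euler_dunkl], leaving 2 n + 2 gamma + d. *)
Lemma dirac_mulx n f x : hpol n f ->
  Dir (mulx f) x = - mulx (Dir f) x - (2 * n%:R + mu)%:K *: f x.
Proof.
move=> hf.
have hj j : hpol n (fun x => cm (ce j) (f x)) by exact: hpol_cml.
have hjx j : smooth (fun x : V => (x 0 j)%:K *: cm (ce j) (f x)).
  by apply: (@hpol_smooth _ _ n.+1); exact: hpol_coord.
have TX i : T i (mulx f) x = \sum_j ((x 0 j)%:K *: cm (ce j) (T i f x) +
    ((i == j)%:R%:K *: cm (ce j) (f x) +
    \sum_(a <- Rp) (kappa a * (2 / dotv a a) * (a 0 i * a 0 j))%:K *: cm (ce j) (f (refl a x)))).
  rewrite (_ : mulx f = fun x => \sum_j (x 0 j)%:K *: cm (ce j) (f x)); last first.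
    by apply/funext => y; rewrite mulxE.
  rewrite dunkl_big //; apply: eq_bigr => j _.
  by rewrite (dunkl_coord _ _ _ _ _ (hpol_smooth (hj j))) (dunkl_cml _ _ _ _ _ hf).
rewrite diracE; under eq_bigr do rewrite TX cm_sumr.
pose S1 := \sum_i \sum_j (x 0 j)%:K *: cm (ce i) (cm (ce j) (T i f x)).
pose S2 := \sum_i \sum_j (i == j)%:R%:K *: cm (ce i) (cm (ce j) (f x)).
pose S3 := \sum_(a <- Rp) (kappa a * (2 / dotv a a))%:K *: cm (cv a) (cm (cv a) (f (refl a x))).
transitivity (S1 + (S2 + S3)).
  rewrite /S3 (_ : \sum_(a <- Rp) _ = \sum_i \sum_j \sum_(a <- Rp)
    (kappa a * (2 / dotv a a) * (a 0 i * a 0 j))%:K *: cm (ce i) (cm (ce j) (f (refl a x)))).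
    rewrite /S1 /S2 -!big_split; apply: eq_bigr => i _; rewrite -!big_split.
    by apply: eq_bigr => j _; rewrite /= !cmDr !cmZr cm_sumr; do 2![apply: clD_eq => //];
       apply: eq_bigr => a _; rewrite cmZr.
  symmetry; under eq_bigr do rewrite exchange_big /=.
  rewrite exchange_big /=; apply: eq_bigr => a _; symmetry.
  rewrite {1}/cv cm_suml scaler_sumr; apply: eq_bigr => i _.
  rewrite cmZl /cv cm_suml cm_sumr !scaler_sumr; apply: eq_bigr => j _.
  by rewrite cmZl cmZr !scalerA -!rcM; apply: clZ_eq => //; congr (_%:K); ring.
have -> : S1 = - mulx (Dir f) x - 2 *: \sum_i (x 0 i)%:K *: T i f x.
  rewrite scaler_sumr /S1 exchange_big /= mulxE -sumrN -sumrB; apply: eq_bigr => j _.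
  under eq_bigr do rewrite ce_swap scalerBr scalerN.
  rewrite sumrB sumrN -scaler_sumr diracE cm_sumr; apply: clD_eq => //; congr (- _).
  rewrite (bigD1 j) //= [X in _ + X]big1 ?addr0; last first.
    by move=> i /negbTE ->; rewrite mulr0 scale0r scaler0.
  by rewrite eqxx mulr1 !scalerA mulrC.
have -> : S2 = - (d%:R)%:K *: f x.
  transitivity (\sum_(i < d) - f x).
    apply: eq_bigr => i _; rewrite (bigD1 i) //= [X in _ + X]big1 ?addr0; last first.
      by move=> j; rewrite eq_sym => /negbTE ->; rewrite scale0r.
    by rewrite eqxx scale1r ce_sqr.
  by rewrite sumr_const card_ord -scaler_nat scalerN scaleNr rmorph_nat.
have -> : S3 = - 2 *: \sum_(a <- Rp) (kappa a)%:K *: f (refl a x).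
  rewrite scaler_sumr /S3 !big_seq; apply: eq_bigr => a /Rp0 a0.
  rewrite cmA cv_sqr cmZl cm1l !scalerA -rcM; apply: clZ_eq => //.
  rewrite -rcNn -rcM; congr (_%:K).
  by rewrite /norm2; field; rewrite gt_eqF // dotvv_gt0.
rewrite (euler_dunkl _ _ _ hf).
have -> : \sum_(a <- Rp) (kappa a)%:K *: (f x - f (refl a x)) =
  (gamma_k Rp kappa)%:K *: f x - \sum_(a <- Rp) (kappa a)%:K *: f (refl a x).
  rewrite /gamma_k rc_sum scaler_suml -sumrB; apply: eq_bigr => a _.
  by rewrite scalerBr.
set Y := \sum_(a <- Rp) _; set Z := mulx _ x; set F := f x.
have -> : (2 * n%:R + mu)%:K = 2 * n%:R + (2 * (gamma_k Rp kappa)%:K + d%:R%:K).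
  by rewrite (rcD (2 * n%:R) mu) (rcM 2 n%:R) /Defs.mu (rcD (2 * _)) (rcM 2) !rmorph_nat.
by apply/ffunP => A; rewrite !cl_coefE; ring.
Qed.

(** Sums over several degrees are needed because D lowers the degree and x raises it, so that D_+
    does not preserve homogeneity. *)
Inductive pol : (V -> Cl) -> Prop :=
| pol_hom n f : hpol n f -> pol f
| pol_add f g : pol f -> pol g -> pol (fun x => f x + g x).

Lemma eq_pol f g : f =1 g -> pol f -> pol g.
Proof. by move=> /funext ->. Qed.

Lemma pol_smooth f : pol f -> smooth f.
Proof. by elim=> {f} [n f /hpol_smooth //|f g _ hf _ hg]; exact: smoothD. Qed.

Lemma diracD f g x : smooth f -> smooth g -> Dir (fun x => f x + g x) x = Dir f x + Dir g x.
Proof.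
move=> hf hg; rewrite !diracE -big_split; apply: eq_bigr => i _.
by rewrite dunklD // cmDr.
Qed.

Lemma hpol_dirac n f : hpol n f -> (if n is m.+1 then hpol m (Dir f) else Dir f = fun=> 0).
Proof.
move=> hf; case: n hf => [|n] hf.
  apply/funext => x; rewrite diracE big1 // => i _.
  by rewrite (hpol_dunkl Rp kappa i hf) cm0r.
apply: (eq_hpol (fun x => esym (diracE f x))); apply: hpol_sum => i _.
by apply: hpol_cml; exact: (hpol_dunkl Rp kappa i hf).
Qed.

Lemma hpol_mulx n f : hpol n f -> hpol n.+1 (mulx f).
Proof. exact: hpol_vec. Qed.

Lemma pol_dirac f : pol f -> pol (Dir f).
Proof.
elim=> {f} [[|n] f hf|f g hf Df hg Dg].
- by rewrite (hpol_dirac hf); exact: pol_hom (hpol_zero 0).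
- exact: pol_hom (hpol_dirac hf).
by apply: eq_pol (pol_add Df Dg) => x; rewrite diracD //; exact: pol_smooth.
Qed.

Lemma mulxD f g x : mulx (fun x => f x + g x) x = mulx f x + mulx g x.
Proof. exact: cmDr. Qed.

Lemma pol_mulx f : pol f -> pol (mulx f).
Proof.
elim=> {f} [n f hf|f g _ Xf _ Xg]; first exact: pol_hom (hpol_mulx hf).
by apply: eq_pol (pol_add Xf Xg) => x; rewrite mulxD.
Qed.

Lemma pol_cmr f c : pol f -> pol (fun x => cm (f x) c).
Proof.
elim=> {f} [n f hf|f g _ hf _ hg]; first exact: pol_hom (hpol_cmr c hf).
by apply: eq_pol (pol_add hf hg) => x; rewrite cmDl.
Qed.

(** Complex scalars become right multiplications, so complex linearity of D is an instance of its
    right linearity over the Clifford algebra. *)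
Lemma cl_scaleE k (a : Cl) : k *: a = cm a (k *: cl1 R d).
Proof. by rewrite cmZr cm1r. Qed.

Lemma pol_Z f k : pol f -> pol (fun x => k *: f x).
Proof. by move=> hf; apply: eq_pol (pol_cmr (k *: cl1 R d) hf) => x; rewrite -cl_scaleE. Qed.

Lemma pol_B f g : pol f -> pol g -> pol (fun x => f x - g x).
Proof.
move=> hf hg; apply: eq_pol (pol_add hf (pol_Z (-1) hg)) => x.
by rewrite scaleN1r.
Qed.

Lemma pol_raising f : pol f -> pol (Dp f).
Proof. by move=> hf; apply: pol_B (pol_dirac hf) (pol_Z _ (pol_mulx hf)). Qed.

Lemma dirac_cmr f c x : pol f -> Dir (fun x => cm (f x) c) x = cm (Dir f x) c.
Proof.
move=> hf; elim: hf x => {f} [n f hf|f g hf IHf hg IHg] x.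
  rewrite !diracE cm_suml; apply: eq_bigr => i _.
  by rewrite (dunkl_cmr _ _ _ _ _ hf) cmA.
rewrite diracD ?cmDl -?IHf -?IHg; try exact: pol_smooth.
rewrite -diracD; try exact: pol_smooth (pol_cmr _ _).
by congr (Dir _ x); apply/funext => y; rewrite cmDl.
Qed.

Lemma diracZ f k x : pol f -> Dir (fun x => k *: f x) x = k *: Dir f x.
Proof.
move=> hf; rewrite cl_scaleE -dirac_cmr //; congr (Dir _ x).
by apply/funext => y; rewrite -cl_scaleE.
Qed.

Lemma diracB f g x : pol f -> pol g -> Dir (fun x => f x - g x) x = Dir f x - Dir g x.
Proof.
move=> hf hg; rewrite -scaleN1r -(diracZ _ _ hg) -diracD //; first last.
- by apply: pol_smooth; exact: pol_Z.
- exact: pol_smooth.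
by congr (Dir _ x); apply/funext => y; rewrite scaleN1r.
Qed.

Lemma mulxZ f k x : mulx (fun x => k *: f x) x = k *: mulx f x.
Proof. exact: cmZr. Qed.

Lemma mulxB f g x : mulx (fun x => f x - g x) x = mulx f x - mulx g x.
Proof. exact: cmBr. Qed.

Lemma mulx_cmr f c x : mulx (fun x => cm (f x) c) x = cm (mulx f x) c.
Proof. exact: cmA. Qed.

(* [D, x^2] = -2 x and [D^2, x] = -2 D: unlike [dirac_mulx] these do not see the degree. *)
Lemma dirac_mulx_mulx f x : pol f -> Dir (mulx (mulx f)) x = mulx (mulx (Dir f)) x - 2 *: mulx f x.
Proof.
move=> hf; elim: hf x => {f} [n f hf|f g hf IHf hg IHg] x.
  rewrite (dirac_mulx x (hpol_mulx hf)).
  have -> : mulx (Dir (mulx f)) x = - mulx (mulx (Dir f)) x - (2 * n%:R + mu)%:K *: mulx f x.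
    rewrite (_ : Dir (mulx f) = fun x => - mulx (Dir f) x - (2 * n%:R + mu)%:K *: f x); last first.
      by apply/funext => y; rewrite (dirac_mulx y hf).
    by rewrite mulxB mulxZ; congr (_ - _); exact: cmNr.
  have -> : (2 * n.+1%:R + mu)%:K = (2 * n%:R + mu)%:K + 2.
    by rewrite -(rc_nat 2) -rcD; congr (_%:K); rewrite -natr1; ring.
  exact: lin_sub2.
have XXD (u v : V -> Cl) : mulx (mulx (fun y => u y + v y)) x = mulx (mulx u) x + mulx (mulx v) x.
  by rewrite /mulx !cmDr.
have -> : Dir (fun y => f y + g y) = fun y => Dir f y + Dir g y.
  by apply/funext => y; rewrite diracD //; exact: pol_smooth.
rewrite XXD mulxD scalerDr.
have -> : mulx (mulx (fun y => f y + g y)) = fun y => mulx (mulx f) y + mulx (mulx g) y.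
  by apply/funext => y; rewrite /mulx !cmDr.
rewrite diracD ?IHf ?IHg; first by rewrite opprD addrACA.
- by apply: pol_smooth; do 2!apply: pol_mulx.
- by apply: pol_smooth; do 2!apply: pol_mulx.
Qed.

Lemma dirac_dirac_mulx f x : pol f -> Dir (Dir (mulx f)) x = mulx (Dir (Dir f)) x - 2 *: Dir f x.
Proof.
move=> hf; elim: hf x => {f} [n f hf|f g hf IHf hg IHg] x.
  have pf := pol_hom hf.
  have -> : Dir (mulx f) = fun x => (-1) *: mulx (Dir f) x - (2 * n%:R + mu)%:K *: f x.
    by apply/funext => y; rewrite (dirac_mulx y hf) scaleN1r.
  have pX := pol_mulx (pol_dirac pf).
  rewrite (diracB _ (pol_Z _ pX) (pol_Z _ pf)) (diracZ _ _ pX) (diracZ _ _ pf).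
  case: n hf => [|n] hf.
    rewrite (hpol_dirac hf) (_ : mulx _ = fun=> 0) ?(hpol_dirac (hpol_zero 0)) ?scaler0 ?subrr ?subr0 //;
      last by apply/funext => y; rewrite /mulx cm0r.
    by rewrite /mulx cm0r.
  rewrite (dirac_mulx x (hpol_dirac hf)).
  have -> : (2 * n.+1%:R + mu)%:K = (2 * n%:R + mu)%:K + 2.
    by rewrite -(rc_nat 2) -rcD; congr (_%:K); rewrite -natr1; ring.
  by rewrite scaleN1r; exact: lin_sub2.
have D2 (u v : V -> Cl) : pol u -> pol v -> Dir (fun y => u y + v y) = fun y => Dir u y + Dir v y.
  by move=> hu hv; apply/funext => y; rewrite diracD //; exact: pol_smooth.
have -> : mulx (fun y => f y + g y) = fun y => mulx f y + mulx g y by apply/funext => y; exact: mulxD.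
have [h1 h2] := (pol_mulx hf, pol_mulx hg); rewrite (D2 _ _ h1 h2).
rewrite (D2 _ _ (pol_dirac h1) (pol_dirac h2)) (D2 _ _ hf hg) (D2 _ _ (pol_dirac hf) (pol_dirac hg)).
by rewrite mulxD IHf IHg scalerDr opprD addrACA.
Qed.

(** Here D_+^2 = D^2 - 2 (D x + x D) + 4 x^2. The commutator of D with D x + x D is D^2 x - x D^2 =
    -2 D, and with x^2 it is -2 x; the total is 4 D - 8 x = 4 D_+. *)
Lemma dirac_raising_raising f x : pol f -> Dir (Dp (Dp f)) x = Dp (Dp (Dir f)) x + 4 *: Dp f x.
Proof.
move=> hf.
have e g y : pol g -> Dp (Dp g) y =
    Dir (Dir g) y - 2 *: Dir (mulx g) y - 2 *: mulx (Dir g) y + 4 *: mulx (mulx g) y.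
  move=> hg; rewrite {1}/raising_op diracB; [|exact: pol_dirac|exact: pol_Z (pol_mulx hg)].
  rewrite (diracZ _ _ (pol_mulx hg)) mulxB mulxZ.
  exact: lin_mul4.
rewrite (e _ _ (pol_dirac hf)).
have -> : Dp (Dp f) = fun y => Dir (Dir f) y - 2 *: Dir (mulx f) y - 2 *: mulx (Dir f) y + 4 *: mulx (mulx f) y.
  by apply/funext => y; rewrite e.
have h1 := pol_dirac hf; have h2 := pol_dirac h1; have h3 := pol_dirac (pol_mulx hf).
have h4 := pol_mulx h1; have h5 := pol_mulx (pol_mulx hf).
have h6 := pol_B (pol_B h2 (pol_Z 2 h3)) (pol_Z 2 h4).
rewrite (diracD _ (pol_smooth h6) (pol_smooth (pol_Z 4 h5))) (diracZ _ _ h5).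
rewrite (diracB _ (pol_B h2 (pol_Z 2 h3)) (pol_Z 2 h4)) (diracZ _ _ h4).
rewrite (diracB _ h2 (pol_Z 2 h3)) (diracZ _ _ h3).
have -> : Dir (Dir (mulx f)) x = mulx (Dir (Dir f)) x - 2 *: Dir f x by exact: dirac_dirac_mulx.
rewrite (dirac_mulx_mulx _ hf) /raising_op.
exact: lin_comm.
Qed.

End dirac.

(** * Decomposition of polynomials along powers of x and of D_+ *)

Section fischer.
Context {R : realType} {d : nat}.
Local Notation V := 'rV[R]_d.
Local Notation Cl := (Cl R d).
Local Notation "r %:K" := ((r%:C)%C) (at level 2, format "r %:K").
Variables (Rp : seq V) (kappa : V -> R).
Hypothesis Rp0 : forall a, a \in Rp -> a != 0.
Local Notation mu := (mu Rp kappa).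
Hypothesis mu0 : 0 < mu.
Local Notation Dir := (dirac_op Rp kappa).
Local Notation Dp := (raising_op Rp kappa).
Local Notation diracZ := (@diracZ R d Rp kappa).

Definition harm n (P : V -> Cl) := hpol n P /\ forall x, Dir P x = 0.

Lemma harm_Z n k P : harm n P -> harm n (fun x => k *: P x).
Proof.
move=> [hP DP]; split=> [|x]; first exact: hpol_Z.
by rewrite (diracZ _ _ (pol_hom hP)) DP scaler0.
Qed.

Lemma harm_Mn n P : Mn Rp kappa n P <-> harm n P.
Proof.
rewrite /harm -hom_polyP /Mn; split=> -[hP DP]; split=> // x;
by rewrite /dirac_op -?lock //; have := DP x; rewrite /dirac_op -lock.
Qed.

(** Up to sign, the factor in D x^s P = -c x^(s-1) P for P in M_n. The recursion is [dirac_mulx] in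
    degree n + s. *)
Fixpoint cX (n s : nat) : R :=
  if s is s'.+1 then 2 * (n + s')%:R + mu - cX n s' else 0.

Lemma cX2 n s : cX n s.+2 = cX n s + 2.
Proof. by rewrite /= addnS -natr1; ring. Qed.

(** The values start with 2 n + mu and 2, and grow by 2 in every second step. Positivity lets
    [fischer_lift] divide by them. *)
Lemma cX_gt0 n s : 0 < cX n s.+1.
Proof.
elim/ltn_ind: s => -[|[|s]] IH; first by rewrite /= subr0 ltr_wpDl.
  by rewrite cX2 add0r.
by rewrite cX2 addr_gt0 // IH.
Qed.

Lemma hpol_iter_mulx n s (P : V -> Cl) : hpol n P -> hpol (s + n) (iter s mulx P).
Proof. by move=> hP; elim: s => //= s IH; exact: hpol_mulx. Qed.

Lemma iter_mulxZ k s P x : iter s mulx (fun x : V => k *: P x) x = k *: iter s mulx P x :> Cl.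
Proof. by elim: s x => //= s IH x; rewrite /mulx IH cmZr. Qed.

Lemma dirac_iter_mulx n s P x : harm n P ->
  Dir (iter s mulx P) x = - (cX n s)%:K *: iter s.-1 mulx P x.
Proof.
move=> [hP DP]; elim: s x => [|s IH] x; first by rewrite DP oppr0 scale0r.
rewrite /= (dirac_mulx _ Rp0 _ (hpol_iter_mulx s hP)).
have -> : mulx (Dir (iter s mulx P)) x = - (cX n s)%:K *: iter s mulx P x.
  rewrite /mulx IH; case: s {IH} => [|s]; first by rewrite /= oppr0 !scale0r cm0r.
  by rewrite cmZr.
have -> : (cX n s.+1)%:K = (2 * (s + n)%:R + mu)%:K - (cX n s)%:K by rewrite addnC -rcB.
by rewrite scaleNr opprK -scalerBl opprB.
Qed.

Inductive fischer : nat -> (V -> Cl) -> Prop :=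
| fischer_mono n s P : harm n P -> fischer (s + n) (iter s mulx P)
| fischer_add n f g : fischer n f -> fischer n g -> fischer n (fun x => f x + g x).

Lemma fischer_hpol n f : fischer n f -> hpol n f.
Proof.
elim=> {n f} [n s P [hP _]|n f g _ hf _ hg]; first exact: hpol_iter_mulx.
exact: hpol_add.
Qed.

(** D maps x^(s+1) P to a nonzero multiple of x^s P, so dividing by this factor gives a preimage one
    degree higher. *)
Lemma fischer_lift n f : fischer n f ->
  exists2 g, fischer n.+1 g & forall x, Dir g x = f x.
Proof.
elim=> {n f} [n s P hP|n f1 f2 _ [g1 hg1 E1] _ [g2 hg2 E2]].
  exists (iter s.+1 mulx (fun x => (- (cX n s.+1)^-1)%:K *: P x)).
    by apply: (@fischer_mono n s.+1); exact: harm_Z.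
  move=> x; rewrite (dirac_iter_mulx _ _ (harm_Z _ hP)) iter_mulxZ scalerA -rcN -rcM mulrNN.
  by rewrite divff ?scale1r // gt_eqF // cX_gt0.
exists (fun x => g1 x + g2 x) => [|x]; first exact: fischer_add.
have [s1 s2] := (hpol_smooth (fischer_hpol hg1), hpol_smooth (fischer_hpol hg2)).
by rewrite (diracD _ _ _ s1 s2) E1 E2.
Qed.

(* Subtracting from [f] the lift of [Dir f] leaves an element of M_n. *)
Lemma hpol_fischer n f : hpol n f -> fischer n f.
Proof.
elim: n f => [|n IH] f hf.
  apply: (@fischer_mono 0 0); split=> // x.
  by rewrite (hpol_dirac _ _ hf).
have [g hg Eg] := fischer_lift (IH _ (hpol_dirac Rp kappa hf)).
have pg := fischer_hpol hg.
rewrite (_ : f = fun x => g x + (f x - g x)); last by apply/funext => x; rewrite addrC subrK.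
apply: fischer_add => //; apply: (@fischer_mono n.+1 0); split=> [|x]; first exact: hpol_B.
by rewrite (diracB _ _ _ (pol_hom hf) (pol_hom pg)) Eg subrr.
Qed.

(** The factor in D D_+^s P = c D_+^(s-1) P for P in M_n. The value at s = 1 comes from D_+ P = -2 x
    P and [dirac_mulx]; the increment 4 is the commutator of D with D_+^2. *)
Fixpoint cH (n s : nat) : R :=
  match s with
  | 0 => 0
  | 1 => 2 * (2 * n%:R + mu)
  | s'.+2 => cH n s' + 4
  end.

Lemma pol_iter_raising s f : pol f -> pol (iter s Dp f).
Proof. by move=> hf; elim: s => //= s IH; exact: pol_raising. Qed.

Lemma raisingZ f k x : pol f -> Dp (fun x => k *: f x) x = k *: Dp f x.
Proof.
by move=> hf; rewrite /raising_op (diracZ _ _ hf) mulxZ scalerBr scalerA mulrC -scalerA.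
Qed.

Lemma raisingD f g x : pol f -> pol g -> Dp (fun x => f x + g x) x = Dp f x + Dp g x.
Proof.
move=> /pol_smooth hf /pol_smooth hg.
by rewrite /raising_op (diracD _ _ _ hf hg) mulxD scalerDr opprD addrACA.
Qed.

Lemma iter_raisingZ s f k : pol f -> iter s Dp (fun x => k *: f x) = fun x => k *: iter s Dp f x.
Proof.
move=> hf; elim: s => //= s ->; apply/funext => x.
by rewrite (raisingZ _ _ (pol_iter_raising s hf)).
Qed.

Lemma raising_cmr f c x : pol f -> Dp (fun x => cm (f x) c) x = cm (Dp f x) c.
Proof.
by move=> hf; rewrite /raising_op (dirac_cmr _ _ _ _ hf) mulx_cmr -cmZl -cmBl.
Qed.

Lemma iter_raising_cmr s f c : pol f -> iter s Dp (fun x => cm (f x) c) = fun x => cm (iter s Dp f x) c.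
Proof.
move=> hf; elim: s => //= s ->; apply/funext => x.
by rewrite (raising_cmr _ _ (pol_iter_raising s hf)).
Qed.

Lemma dirac_iter_raising n s P x : harm n P ->
  Dir (iter s Dp P) x = (cH n s)%:K *: iter s.-1 Dp P x.
Proof.
move=> [hP DP]; have pP := pol_hom hP.
elim/ltn_ind: s x => -[|[|s]] IH x; first by rewrite DP scale0r.
  rewrite /= (_ : Dp P = fun x => (-2) *: mulx P x); last first.
    by apply/funext => y; rewrite /raising_op DP sub0r scaleNr.
  rewrite (diracZ _ _ (pol_mulx pP)) (dirac_mulx _ Rp0 _ hP).
  rewrite {1}/mulx DP cm0r oppr0 sub0r scalerN scalerA -scaleNr.
  by rewrite mulNr opprK rcM rmorph_nat.
rewrite [LHS](dirac_raising_raising _ Rp0 _ (pol_iter_raising s pP)).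
have -> : Dir (iter s Dp P) = fun y => (cH n s)%:K *: iter s.-1 Dp P y.
  by apply/funext => y; rewrite IH // ltnW.
have ps := pol_iter_raising s.-1 pP.
have -> : Dp (fun y => (cH n s)%:K *: iter s.-1 Dp P y) = fun y => (cH n s)%:K *: Dp (iter s.-1 Dp P) y.
  by apply/funext => y; rewrite (raisingZ _ _ ps).
rewrite (raisingZ _ _ (pol_raising _ _ ps)) [cH n s.+2]/= rcD rc_nat [RHS]scalerDl; apply: clD_eq => [|//].
(* For s = 0 the powers of D_+ differ, because [s.-1] is 0, but their common factor [cH n 0] is
   0. *)
case: s {IH ps} => [|s]; last by [].
have -> : (cH n 0)%:K = 0 by [].
by rewrite [LHS]scale0r [RHS]scale0r.
Qed.

Inductive hspan : (V -> Cl) -> Prop :=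
| hspan_mono n s P : harm n P -> hspan (iter s Dp P)
| hspan_add f g : hspan f -> hspan g -> hspan (fun x => f x + g x).

Lemma hspan_pol f : hspan f -> pol f.
Proof.
elim=> {f} [n s P [/pol_hom hP _]|f g _ hf _ hg]; first exact: pol_iter_raising.
exact: pol_add.
Qed.

Lemma hspan_Z f k : hspan f -> hspan (fun x => k *: f x).
Proof.
elim=> {f} [n s P hP|f g _ hf _ hg].
  by rewrite -(iter_raisingZ _ _ (pol_hom hP.1)); apply: hspan_mono; exact: harm_Z hP.
rewrite (_ : (fun x => _) = fun x => k *: f x + k *: g x); first exact: hspan_add.
by apply/funext => x; rewrite scalerDr.
Qed.

Lemma hspan_raising f : hspan f -> hspan (Dp f).
Proof.
elim=> {f} [n s P hP|f g hf Hf hg Hg]; first exact: (@hspan_mono n s.+1).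
rewrite (_ : Dp _ = fun x => Dp f x + Dp g x); first exact: hspan_add.
by apply/funext => x; rewrite raisingD //; exact: hspan_pol.
Qed.

(** Solving D_+ f = D f - 2 x f for x f with f = x^s P gives x^(s+1) P = -(c/2) x^(s-1) P - (1/2)
    D_+ (x^s P), with c = [cX n s]. Hence the strong induction on s. *)
Lemma hspan_iter_mulx n s P : harm n P -> hspan (iter s mulx P).
Proof.
move=> hP; elim/ltn_ind: s => -[|s] IH; first exact: (@hspan_mono n 0).
rewrite (_ : iter s.+1 mulx P = fun x => (- (2^-1 * (cX n s)%:K)) *: iter s.-1 mulx P x
   + (- 2^-1) *: Dp (iter s mulx P) x).
  apply: hspan_add; apply: hspan_Z; last by apply: hspan_raising; exact: IH.
  by apply: IH; rewrite (leq_ltn_trans (leq_pred _)).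
apply/funext => x; rewrite /raising_op (dirac_iter_mulx _ _ hP) scalerBr !scalerA.
rewrite addrA -scalerDl !mulNr mulrN opprK mulVf ?pnatr_eq0 //.
by rewrite addNr scale0r sub0r scaleN1r opprK.
Qed.

Lemma pol_hspan f : pol f -> hspan f.
Proof.
elim=> {f} [n f /hpol_fischer|f g _ hf _ hg]; last exact: hspan_add.
elim=> {n f} [n s P hP|n f g _ hf _ hg]; last exact: hspan_add.
exact: hspan_iter_mulx hP.
Qed.

End fischer.

(** * The weighted inner product *)

Lemma lin_add_eq (K : nzRingType) (M : lmodType K) (k : K) (a1 a2 b1 b2 c1 c2 : M) :
  a1 + b1 = k *: c1 -> a2 + b2 = k *: c2 -> (a1 + a2) + (b1 + b2) = k *: (c1 + c2).
Proof. by move=> H1 H2; rewrite scalerDr -H1 -H2 addrACA. Qed.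

Lemma lin_antisym (K : nzRingType) (M : lmodType K) (k : K) (a b c : M) :
  a + (-1) *: b = k *: ((-1) *: c) -> a = b - k *: c.
Proof. by rewrite !scaleN1r scalerN => /(canRL (subrK _)) ->; rewrite addrC. Qed.

Section integrals.
Context {R : realType} {d : nat}.
Local Notation V := 'rV[R]_d.
Local Notation Cl := (Cl R d).
Local Notation "r %:K" := ((r%:C)%C) (at level 2, format "r %:K").
Local Notation Re := (@complex.Re R).
Local Notation Im := (@complex.Im R).

Definition ctame (u : V -> R[i]) := tame (fun x => Re (u x)) /\ tame (fun x => Im (u x)).
Definition cint (u : V -> R[i]) : R[i] :=
  (Rv (fun x => Re (u x)) +i* Rv (fun x => Im (u x)))%C.

Lemma eq_ctame u v : u =1 v -> ctame u -> ctame v.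
Proof. by move=> /funext ->. Qed.

Lemma ReM (z w : R[i]) : Re (z * w) = Re z * Re w - Im z * Im w.
Proof. by case: z; case: w. Qed.

Lemma ImM (z w : R[i]) : Im (z * w) = Re z * Im w + Im z * Re w.
Proof. by case: z => a b; case: w. Qed.

Lemma ctameD u v : ctame u -> ctame v -> ctame (fun x => u x + v x).
Proof.
move=> [u1 u2] [v1 v2]; split.
  by apply: eq_tame (tameD u1 v1) => x; rewrite raddfD.
by apply: eq_tame (tameD u2 v2) => x; rewrite raddfD.
Qed.

Lemma cintD u v : ctame u -> ctame v -> cint (fun x => u x + v x) = cint u + cint v.
Proof.
move=> [u1 u2] [v1 v2]; rewrite /cint.
rewrite (@eq_Rv _ _ (fun x => Re (u x + v x)) (fun x => Re (u x) + Re (v x))); last first.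
  by move=> x; rewrite raddfD.
rewrite (@eq_Rv _ _ (fun x => Im (u x + v x)) (fun x => Im (u x) + Im (v x))); last first.
  by move=> x; rewrite raddfD.
by rewrite !RvD.
Qed.

Lemma cintZ k u : ctame u -> cint (fun x => k * u x) = k * cint u.
Proof.
move=> [u1 u2]; rewrite /cint.
rewrite (@eq_Rv _ _ (fun x => Re (k * u x)) (fun x => Re k * Re (u x) - Im k * Im (u x))); last first.
  by move=> x; rewrite ReM.
rewrite (@eq_Rv _ _ (fun x => Im (k * u x)) (fun x => Re k * Im (u x) + Im k * Re (u x))); last first.
  by move=> x; rewrite ImM.
rewrite RvB ?RvD ?RvZ //; try exact: tameZ.
by apply/eqP; rewrite eq_complex /= ReM ImM !eqxx.
Qed.

Lemma ctame0 : ctame (fun=> 0).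
Proof. by split; exact: tame0. Qed.

Lemma cint0 : cint (fun=> 0) = 0.
Proof. by rewrite /cint /= Rv0. Qed.

Lemma ctame_sum (I : Type) (r : seq I) (P : pred I) (F : I -> V -> R[i]) :
  (forall i, ctame (F i)) -> ctame (fun x => \sum_(i <- r | P i) F i x).
Proof.
move=> tF; elim: r => [|i r IH].
  by apply: eq_ctame ctame0 => x; rewrite big_nil.
have [Pi|/negbTE Pi] := boolP (P i).
  by apply: eq_ctame (ctameD (tF i) IH) => x; rewrite big_cons Pi.
by apply: eq_ctame IH => x; rewrite big_cons Pi.
Qed.

Lemma cint_sum (I : Type) (r : seq I) (P : pred I) (F : I -> V -> R[i]) :
  (forall i, ctame (F i)) ->
  cint (fun x => \sum_(i <- r | P i) F i x) = \sum_(i <- r | P i) cint (F i).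
Proof.
move=> tF; elim: r => [|i r IH].
  rewrite big_nil -[RHS]cint0; congr cint; apply/funext => x; by rewrite big_nil.
rewrite big_cons -IH; have [Pi|/negbTE Pi] := boolP (P i).
  rewrite -cintD //; last exact: ctame_sum.
  by congr cint; apply/funext => x; rewrite big_cons Pi.
by congr cint; apply/funext => x; rewrite big_cons Pi.
Qed.

Lemma ctame_conj u : ctame u -> ctame (fun x => conjc (u x)).
Proof.
move=> [u1 u2]; split; first by apply: eq_tame u1 => x; case: (u x).
by apply: eq_tame (tameN u2) => x; case: (u x).
Qed.

Lemma cint_conj u : ctame u -> cint (fun x => conjc (u x)) = conjc (cint u).
Proof.
move=> [u1 u2]; rewrite /cint /=; apply/eqP; rewrite eq_complex /= -RvN //.
apply/andP; split; apply/eqP; apply: eq_Rv => x; by case: (u x).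
Qed.

Definition cltame (F : V -> Cl) := forall A, ctame (fun x => F x A).
Definition clint (F : V -> Cl) : Cl := locked [ffun A => cint (fun x => F x A)].

Lemma clintE F A : clint F A = cint (fun x => F x A).
Proof. by rewrite /clint -lock ffunE. Qed.

Lemma eq_clint F G : F =1 G -> clint F = clint G.
Proof. by move=> /funext ->. Qed.

Lemma cl_int_tame F : cltame F -> cl_int F = clint F.
Proof.
move=> tF; apply/ffunP => A; rewrite ffunE clintE /cint; have [t1 t2] := tF A.
by rewrite (tame_intRd t1) (tame_intRd t2).
Qed.

Lemma clintD F G : cltame F -> cltame G -> clint (fun x => F x + G x) = clint F + clint G.
Proof.
move=> tF tG; apply/ffunP => A; rewrite cl_coefD !clintE -cintD //.
by congr cint; apply/funext => x; rewrite cl_coefD.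
Qed.

Lemma clintZ k F : cltame F -> clint (fun x => k *: F x) = k *: clint F.
Proof.
move=> tF; apply/ffunP => A; rewrite cl_coefZ !clintE -cintZ //.
by congr cint; apply/funext => x; rewrite cl_coefZ.
Qed.

Lemma clint_sum (I : Type) (r : seq I) (F : I -> V -> Cl) :
  (forall i, cltame (F i)) ->
  clint (fun x => \sum_(i <- r) F i x) = \sum_(i <- r) clint (F i).
Proof.
move=> tF; apply/ffunP => A; rewrite sum_ffunE clintE.
under eq_bigr do rewrite clintE.
rewrite -(cint_sum _ xpredT (fun i => tF i A)); congr cint.
by apply/funext => x; rewrite sum_ffunE.
Qed.

Lemma clint_cst (p : V -> R) (c : Cl) : tame p ->
  clint (fun x => (p x)%:K *: c) = (Rv p)%:K *: c.
Proof.
move=> tp; apply/ffunP => A; rewrite clintE cl_coefZ mulrC.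
have tpc : ctame (fun x => (p x)%:K) by split=> //; exact: tame0.
rewrite (_ : (fun x => _) = fun x => c A * (p x)%:K); last first.
  by apply/funext => x; rewrite cl_coefZ mulrC.
rewrite cintZ //; congr (_ * _); rewrite /cint /= Rv0 //.
Qed.

Lemma cl_coords (F : V -> Cl) x :
  F x = \sum_A ((Re (F x A))%:K *: clE A + (Im (F x A))%:K *: ('i%C *: clE A)).
Proof.
rewrite {1}(cl_decomp (F x)); apply: eq_bigr => A _.
rewrite scalerA -scalerDl; apply: clZ_eq => //.
by rewrite [LHS]complexE mulrC.
Qed.

Lemma clint_cj F : cltame F -> clint (fun x => cj (F x)) = cj (clint F).
Proof.
move=> tF; apply/ffunP => A; rewrite clintE -cjE ffunE clintE.
rewrite -cint_conj // -cintZ; last exact: ctame_conj.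
by congr cint; apply/funext => x; rewrite ffunE.
Qed.

Definition ctempered (f : V -> Cl) := forall A,
  tempered (fun x => Re (f x A)) /\ tempered (fun x => Im (f x A)).

Lemma eq_ctempered f g : f =1 g -> ctempered f -> ctempered g.
Proof. by move=> /funext ->. Qed.

Lemma ctemperedD f g : ctempered f -> ctempered g -> ctempered (fun x => f x + g x).
Proof.
move=> hf hg A; have [f1 f2] := hf A; have [g1 g2] := hg A; split.
  by apply: eq_tempered (temperedD f1 g1) => x; rewrite cl_coefD raddfD.
by apply: eq_tempered (temperedD f2 g2) => x; rewrite cl_coefD raddfD.
Qed.

Lemma ctempered_cst c : ctempered (fun=> c).
Proof. by move=> A; split; exact: tempered_cst. Qed.

Lemma ctemperedM p f : tempered p -> ctempered f -> ctempered (fun x => (p x)%:K *: f x).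
Proof.
move=> hp hf A; have [f1 f2] := hf A; split.
  by apply: eq_tempered (temperedM hp f1) => x; rewrite cl_coefZ ReZ.
by apply: eq_tempered (temperedM hp f2) => x; rewrite cl_coefZ ImZ.
Qed.

Lemma ctempered_sum (I : Type) (r : seq I) (F : I -> V -> Cl) :
  (forall i, ctempered (F i)) -> ctempered (fun x => \sum_(i <- r) F i x).
Proof.
move=> hF; elim: r => [|i r IH].
  by apply: eq_ctempered (ctempered_cst 0) => x; rewrite big_nil.
by apply: eq_ctempered (ctemperedD (hF i) IH) => x; rewrite big_cons.
Qed.

Lemma pol_ctempered f : pol f -> ctempered f.
Proof.
elim=> {f} [n f hf|f g _ hf _ hg]; last exact: ctemperedD.
elim: hf => {n f} [n|c|n f g _ hf _ hg|n j f _ hf].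
- exact: ctempered_cst.
- exact: ctempered_cst.
- exact: ctemperedD.
by apply: ctemperedM => //; exact: tempered_coord.
Qed.

Lemma ctempered_cml f c : ctempered f -> ctempered (fun x => cm c (f x)).
Proof.
move=> hf; apply: (@eq_ctempered (fun x => \sum_A ((Re (f x A))%:K *: cm c (clE A) +
   (Im (f x A))%:K *: cm c ('i%C *: clE A)))).
  move=> x; rewrite {3}(cl_coords f x) cm_sumr; apply: eq_bigr => A _.
  by rewrite cmDr !cmZr.
apply: ctempered_sum => A; have [t1 t2] := hf A.
by apply: ctemperedD; apply: ctemperedM => //; exact: ctempered_cst.
Qed.

Lemma ctempered_cj f : ctempered f -> ctempered (fun x => cj (f x)).
Proof.
move=> hf; apply: (@eq_ctempered (fun x => \sum_A ((Re (f x A))%:K *: cj (clE A) +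
   (Im (f x A))%:K *: cj ('i%C *: clE A)))).
  move=> x; rewrite {3}(cl_coords f x) cj_sum; apply: eq_bigr => A _.
  by rewrite cjD [in RHS]cjZ [X in _ = _ + X]cjZ !conjc_real.
apply: ctempered_sum => A; have [t1 t2] := hf A.
by apply: ctemperedD; apply: ctemperedM => //; exact: ctempered_cst.
Qed.

Lemma ctempered_cm f g : ctempered f -> ctempered g -> ctempered (fun x => cm (f x) (g x)).
Proof.
move=> hf hg; apply: (@eq_ctempered (fun x => \sum_A ((Re (f x A))%:K *: cm (clE A) (g x) +
   (Im (f x A))%:K *: cm ('i%C *: clE A) (g x)))).
  move=> x; rewrite {3}(cl_coords f x) cm_suml; apply: eq_bigr => A _.
  by rewrite cmDl !cmZl.
apply: ctempered_sum => A; have [t1 t2] := hf A.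
by apply: ctemperedD; apply: ctemperedM => //; exact: ctempered_cml.
Qed.

(** * Adjointness of the Dunkl-Dirac and the raising operator *)

Section weighted.
Variables (Rs Rp : seq V) (kappa : V -> R).
Hypothesis hRs : root_system Rs.
Hypothesis hRp : positive_subsystem Rs Rp.
Hypothesis hk : multiplicity Rs kappa.
Local Notation wg := (wgauss Rp kappa).

Lemma weightE x : weight Rp kappa x = wg x.
Proof. by rewrite /weight -wprod0. Qed.

Lemma cltame_weight f : ctempered f -> cltame (fun x => (wg x)%:K *: f x).
Proof.
move=> hf A; have [f1 f2] := hf A; split.
  apply: eq_tame (tempered_wgauss_tame hRp hk f1) => x.
  by rewrite cl_coefZ ReZ mulrC.
apply: eq_tame (tempered_wgauss_tame hRp hk f2) => x.
by rewrite cl_coefZ ImZ mulrC.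
Qed.

Definition ip (f g : V -> Cl) : Cl :=
  locked (clint (fun x => (wg x)%:K *: cm (cj (f x)) (g x))).

Lemma ipE f g : ip f g = clint (fun x => (wg x)%:K *: cm (cj (f x)) (g x)).
Proof. by rewrite /ip -lock. Qed.

Lemma ip_tame f g : ctempered f -> ctempered g ->
  cltame (fun x => (wg x)%:K *: cm (cj (f x)) (g x)).
Proof. by move=> hf hg; apply: cltame_weight; apply: ctempered_cm => //; exact: ctempered_cj. Qed.

Lemma ipHE f g : ctempered f -> ctempered g -> ipH Rp kappa f g = ip f g.
Proof.
move=> hf hg; rewrite /ipH cmE cjE ipE -(cl_int_tame (ip_tame hf hg)); congr cl_int.
by apply/funext => x; rewrite weightE.
Qed.

Lemma ipDl f f' g : ctempered f -> ctempered f' -> ctempered g ->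
  ip (fun x => f x + f' x) g = ip f g + ip f' g.
Proof.
move=> hf hf' hg; rewrite !ipE -clintD; try exact: ip_tame.
by apply: eq_clint => x; rewrite cjD cmDl scalerDr.
Qed.

Lemma ipDr f g g' : ctempered f -> ctempered g -> ctempered g' ->
  ip f (fun x => g x + g' x) = ip f g + ip f g'.
Proof.
move=> hf hg hg'; rewrite !ipE -clintD; try exact: ip_tame.
by apply: eq_clint => x; rewrite cmDr scalerDr.
Qed.

Lemma ip_cj f g : ctempered f -> ctempered g -> ip f g = cj (ip g f).
Proof.
move=> hf hg; rewrite !ipE -clint_cj; last exact: ip_tame.
by apply: eq_clint => x; rewrite cjZ conjc_real cjM cjK.
Qed.

Lemma ipZr k f g : ctempered f -> ctempered g -> ip f (fun x => k *: g x) = k *: ip f g.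
Proof.
move=> hf hg; rewrite !ipE -clintZ; last exact: ip_tame.
by apply: eq_clint => x; rewrite cmZr !scalerA mulrC.
Qed.

Lemma ipZl k f g : ctempered f -> ctempered g -> ip (fun x => k *: f x) g = conjc k *: ip f g.
Proof.
move=> hf hg; rewrite !ipE -clintZ; last exact: ip_tame.
by apply: eq_clint => x; rewrite cjZ cmZl !scalerA mulrC.
Qed.

Lemma ip_cml f g i : ip (fun x => cm (ce i) (f x)) g = ip f (fun x => - cm (ce i) (g x)).
Proof. by rewrite !ipE; apply: eq_clint => x; rewrite cjM cj_basis -cmA cmNl cmNr. Qed.

Lemma ip_real p q c e : tempered p -> tempered q ->
  ip (fun x => (p x)%:K *: c) (fun x => (q x)%:K *: e) =
  (Rv (fun x => p x * q x * wg x))%:K *: cm (cj c) e.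
Proof.
move=> hp hq; have t := tempered_wgauss_tame hRp hk (temperedM hp hq).
rewrite ipE -(clint_cst _ t).
apply: eq_clint => x; rewrite cjZ conjc_real cmZl cmZr !scalerA -!rcM.
by rewrite mulrC.
Qed.

(* [dd_quot] leaves [q a] free on the hyperplane of [a]; [pol_dunkl_sum] uses the values of
   [dq a] there. *)
Record dunkl_data (i : 'I_d) (p p' : V -> R) (q : V -> V -> R) : Prop := DunklData {
  dd_p : tempered p;
  dd_p' : tempered p';
  dd_q : forall a, tempered (q a);
  dd_der : forall x, is_derive x (unitv R i) p (p' x);
  dd_quot : forall a x, p x - p (refl a x) = dotv a x * q a x }.

Definition dunkl_val (i : 'I_d) p' (q : V -> V -> R) x : R :=
  p' x + \sum_(a <- Rp) kappa a * a 0 i * q a x.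

(** A function paired with its Dunkl derivative, both as finite sums of real functions times
    Clifford constants. In this form the real identity [Rv_dunkl_antisymmetric] applies to each pair
    of terms. *)
Inductive dunkl_sum i : (V -> Cl) -> (V -> Cl) -> Prop :=
| dunkl_sum_one p p' q c : dunkl_data i p p' q ->
    dunkl_sum i (fun x => (p x)%:K *: c) (fun x => (dunkl_val i p' q x)%:K *: c)
| dunkl_sum_add f g tf tg : dunkl_sum i f tf -> dunkl_sum i g tg ->
    dunkl_sum i (fun x => f x + g x) (fun x => tf x + tg x).

Lemma eq_dunkl_sum i f g tf tg : f =1 g -> tf =1 tg -> dunkl_sum i f tf -> dunkl_sum i g tg.
Proof. by move=> /funext -> /funext ->. Qed.

Lemma refl0 (x : V) : refl 0 x = x.
Proof. by rewrite /refl scaler0 subr0. Qed.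

Lemma dunkl_data_cst i r : dunkl_data i (fun=> r) (fun=> 0) (fun _ _ => 0).
Proof.
split; try exact: tempered_cst; first by move=> a; exact: tempered_cst.
  by move=> x; exact: is_derive_cst.
by move=> a x; rewrite subrr mulr0.
Qed.

Lemma dunkl_data_coord i j p p' q : dunkl_data i p p' q ->
  dunkl_data i (fun x => x 0 j * p x) (fun x => (i == j)%:R * p x + x 0 j * p' x)
    (fun a x => x 0 j * q a x + 2 / dotv a a * a 0 j * p (refl a x)).
Proof.
move=> [tp tp' tq dp qp]; split.
- by apply: temperedM => //; exact: tempered_coord.
- apply: temperedD; first by apply: temperedM => //; exact: tempered_cst.
  by apply: temperedM => //; exact: tempered_coord.
- move=> a; apply: temperedD; first by apply: temperedM => //; exact: tempered_coord.
  apply: temperedM; first exact: tempered_cst.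
  (* [dunkl_data] quantifies over all vectors a, including 0, for which [refl] is the identity. *)
  have [->|a0] := eqVneq a 0; last exact: tempered_refl.
  by apply: eq_tempered tp => x; rewrite refl0.
- move=> x; apply: (is_derive_eq (is_deriveMr (is_derive_coord j x (unitv R i)) (dp x))).
  by rewrite mxE eqxx /= eq_sym.
move=> a x; rewrite refl_coord.
have := qp a x; move=> /(canRL (subrK _)) ->; ring.
Qed.

Lemma dunkl_sum_coord i j f tf : dunkl_sum i f tf ->
  dunkl_sum i (fun x => (x 0 j)%:K *: f x) (fun x => (x 0 j)%:K *: tf x +
    ((i == j)%:R%:K *: f x +
    \sum_(a <- Rp) (kappa a * (2 / dotv a a) * (a 0 i * a 0 j))%:K *: f (refl a x))).
Proof.
elim=> {f tf} [p p' q c /(dunkl_data_coord j) dd|f g tf tg _ hf _ hg].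
  apply: eq_dunkl_sum (dunkl_sum_one c dd) => x; first by rewrite rcM scalerA.
  rewrite !scalerA -!rcM.
  under eq_bigr do rewrite scalerA -rcM.
  rewrite -scaler_suml -!scalerDl -rc_sum -!rcD; apply: clZ_eq => //; congr (_%:K).
  rewrite /dunkl_val mulrDr mulr_sumr [RHS]addrCA -!addrA; congr (_ + (_ + _)).
  rewrite -big_split; apply: eq_bigr => a _ /=; ring.
apply: eq_dunkl_sum (dunkl_sum_add hf hg) => x; first by rewrite scalerDr.
rewrite !scalerDr addrACA; apply: clD_eq; first by [].
rewrite addrACA -big_split; apply: clD_eq; first by [].
by apply: eq_bigr => a _; rewrite scalerDr.
Qed.

(** [dunkl_op] and the derivative carried by [dunkl_sum] obey the same rule under multiplication by
    a coordinate. The quotients built along the induction are tempered by construction, so the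
    growth of [dq] itself is never estimated. *)
Lemma pol_dunkl_sum i f : pol f -> dunkl_sum i f (dunkl_op Rp kappa i f).
Proof.
elim=> {f} [n f hf|f g hf Hf hg Hg]; last first.
  apply: eq_dunkl_sum (dunkl_sum_add Hf Hg) => // x.
  by rewrite (dunklD _ _ _ _ (pol_smooth hf) (pol_smooth hg)).
have H c : dunkl_sum i (fun=> c) (dunkl_op Rp kappa i (fun=> c)).
  apply: eq_dunkl_sum (dunkl_sum_one c (dunkl_data_cst i 1)) => x; first exact: scale1r.
  rewrite dunkl_cst /dunkl_val add0r big1 ?scale0r // => a _; by rewrite mulr0.
elim: hf => {n f} [n|c|n f g hf Hf hg Hg|n j f hf Hf] //.
  apply: eq_dunkl_sum (dunkl_sum_add Hf Hg) => // x.
  by rewrite (dunklD _ _ _ _ (hpol_smooth hf) (hpol_smooth hg)).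
apply: eq_dunkl_sum (dunkl_sum_coord j Hf) => // x.
by rewrite (dunkl_coord _ _ _ _ _ (hpol_smooth hf)).
Qed.

Lemma dunkl_val_tempered i p' q : tempered p' -> (forall a, tempered (q a)) ->
  tempered (dunkl_val i p' q).
Proof.
move=> hp hq; apply: temperedD => //; apply: tempered_sum => a.
by apply: temperedM => //; exact: tempered_cst.
Qed.

Lemma dunkl_sum_ctempered i f tf : dunkl_sum i f tf -> ctempered f /\ ctempered tf.
Proof.
elim=> {f tf} [p p' q c [tp tp' tq _ _]|f g tf tg _ [hf htf] _ [hg htg]].
  split; apply: ctemperedM; try exact: ctempered_cst; first by [].
  exact: dunkl_val_tempered.
by split; exact: ctemperedD.
Qed.

(** Biadditivity reduces to one real function times a constant on each side; the right side is the
    derivative of the Gaussian. *)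
Lemma ip_dunkl i f g : pol f -> pol g ->
  ip (dunkl_op Rp kappa i f) g + ip f (dunkl_op Rp kappa i g) = 2 *: ip f (fun x => (x 0 i)%:K *: g x).
Proof.
move=> /(pol_dunkl_sum i) hf /(pol_dunkl_sum i) hg.
have tx u : ctempered u -> ctempered (fun x => (x 0 i)%:K *: u x).
  by move=> hu; apply: ctemperedM => //; exact: tempered_coord.
elim: hf => {f} [p p' q c dp|f1 f2 tf1 tf2 h1 H1 h2 H2]; last first.
  have [[a1 b1] [a2 b2]] := (dunkl_sum_ctempered h1, dunkl_sum_ctempered h2).
  have [hg1 hg2] := dunkl_sum_ctempered hg.
  rewrite (ipDl b1 b2 hg1) (ipDl a1 a2 hg2) (ipDl a1 a2 (tx _ hg1)).
  exact: lin_add_eq H1 H2.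
elim: hg => {g} [p2 p2' q2 c2 dp2|g1 g2 tg1 tg2 h1 H1 h2 H2]; last first.
  have [[a1 b1] [a2 b2]] := (dunkl_sum_ctempered h1, dunkl_sum_ctempered h2).
  have [hf1 hf2] := dunkl_sum_ctempered (dunkl_sum_one c dp).
  rewrite (_ : (fun x => _ *: (g1 x + g2 x)) = fun x => (x 0 i)%:K *: g1 x + (x 0 i)%:K *: g2 x).
    rewrite (ipDr hf1 b1 b2) (ipDr hf2 a1 a2) (ipDr hf1 (tx _ a1) (tx _ a2)).
    exact: lin_add_eq H1 H2.
  by apply/funext => x; rewrite scalerDr.
case: dp => tp tp' tq d1 e1; case: dp2 => tp2 tp2' tq2 d2 e2.
have tv := dunkl_val_tempered i tp' tq; have tv2 := dunkl_val_tempered i tp2' tq2.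
have -> : (fun x : V => (x 0 i)%:K *: ((p2 x)%:K *: c2)) = fun x : V => (x 0 i * p2 x)%:K *: c2.
  by apply/funext => x; rewrite scalerA -rcM.
have tx2 : tempered (fun x : V => x 0 i * p2 x) by apply: temperedM => //; exact: tempered_coord.
rewrite !ip_real // -scalerDl scalerA -(rc_nat 2) -rcM -rcD; apply: clZ_eq => //; congr (_%:K).
have wt F : tempered F -> tame (fun x => F x * wg x) by exact: tempered_wgauss_tame hRp hk _.
have t1 := wt _ (temperedM tv tp2); have t2 := wt _ (temperedM tp tv2).
have t3 := wt _ (temperedM tp tx2).
apply/eqP; rewrite -subr_eq0 -RvD // -RvZ // -RvB; [|exact: tameD|exact: tameZ].
apply/eqP; rewrite -[RHS](Rv_dunkl_antisymmetric hRs hRp hk tp tp2 tp' tp2' tq tq2 d1 d2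
  (fun a x _ => e1 a x) (fun a x _ => e2 a x)).
by apply: eq_Rv => x; rewrite /dunkl_val; ring.
Qed.

Lemma ip_sumr (I : Type) (r : seq I) f (F : I -> V -> Cl) :
  ctempered f -> (forall i, ctempered (F i)) ->
  ip f (fun x => \sum_(i <- r) F i x) = \sum_(i <- r) ip f (F i).
Proof.
move=> hf hF; rewrite ipE; under [RHS]eq_bigr do rewrite ipE.
rewrite -clint_sum => [|i]; last exact: ip_tame.
by apply: eq_clint => x; rewrite cm_sumr scaler_sumr.
Qed.

Lemma ip_suml (I : Type) (r : seq I) g (F : I -> V -> Cl) :
  ctempered g -> (forall i, ctempered (F i)) ->
  ip (fun x => \sum_(i <- r) F i x) g = \sum_(i <- r) ip (F i) g.
Proof.
move=> hf hF; rewrite ipE; under [RHS]eq_bigr do rewrite ipE.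
rewrite -clint_sum => [|i]; last exact: ip_tame.
by apply: eq_clint => x; rewrite cj_sum cm_suml scaler_sumr.
Qed.

Local Notation Dir := (dirac_op Rp kappa).
Local Notation Dp := (raising_op Rp kappa).

Lemma ctempered_Z k f : ctempered f -> ctempered (fun x => k *: f x).
Proof.
move=> /(ctempered_cml (k *: cl1 R d)); apply: eq_ctempered => x.
by rewrite cmZl cm1l.
Qed.

Lemma ipBZr k f g h : ctempered f -> ctempered g -> ctempered h ->
  ip f (fun x => g x - k *: h x) = ip f g - k *: ip f h.
Proof.
move=> tf tg th; have tk := ctempered_Z (- k) th.
rewrite -scaleNr -(ipZr _ tf th) -(ipDr tf tg tk).
by congr ip; apply/funext => x; rewrite scaleNr.
Qed.

Lemma pol_cml (f : V -> Cl) c : pol f -> pol (fun x => cm c (f x)).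
Proof.
elim=> {f} [n f hf|f g _ hf _ hg]; first exact: pol_hom (hpol_cml c hf).
by apply: eq_pol (pol_add hf hg) => x; rewrite cmDr.
Qed.

Lemma dunkl_cml_pol i c f x : pol f -> dunkl_op Rp kappa i (fun x => cm c (f x)) x = cm c (dunkl_op Rp kappa i f x).
Proof.
move=> hf; elim: hf x => {f} [n f hf|f g hf Hf hg Hg] x; first exact: dunkl_cml hf.
have -> : (fun x => cm c (f x + g x)) = fun x => cm c (f x) + cm c (g x).
  by apply/funext => y; rewrite cmDr.
rewrite (dunklD _ _ _ _ (pol_smooth hf) (pol_smooth hg)) cmDr -Hf -Hg.
by rewrite (dunklD _ _ _ _ (pol_smooth (pol_cml c hf)) (pol_smooth (pol_cml c hg))).
Qed.

(** The sign from conjugating e_i cancels the sign of the integration by parts, so e_i T_i keeps its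
    sign when it moves to the other side. *)
Lemma ip_ce_dunkl i f g : pol f -> pol g ->
  ip (fun x => cm (ce i) (dunkl_op Rp kappa i f x)) g =
  ip f (fun x => cm (ce i) (dunkl_op Rp kappa i g x)) - 2 *: ip f (fun x => (x 0 i)%:K *: cm (ce i) (g x)).
Proof.
move=> hf hg; rewrite ip_cml.
have tT h : pol h -> ctempered (dunkl_op Rp kappa i h).
  by move=> /(pol_dunkl_sum i)/dunkl_sum_ctempered[].
have tx (u : V -> Cl) : ctempered u -> ctempered (fun x => (x 0 i)%:K *: u x).
  by move=> hu; apply: ctemperedM => //; exact: tempered_coord.
have tf := pol_ctempered hf.
have -> : (fun x => - cm (ce i) (g x)) = fun x => cm (- ce i) (g x).
  by apply/funext => x; rewrite cmNl.
have := ip_dunkl i hf (pol_cml (- ce i) hg).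
have -> : dunkl_op Rp kappa i (fun x => cm (- ce i) (g x)) = fun x => (-1) *: cm (ce i) (dunkl_op Rp kappa i g x).
  by apply/funext => x; rewrite dunkl_cml_pol // cmNl scaleN1r.
have -> : (fun x : V => (x 0 i)%:K *: cm (- ce i) (g x)) =
          fun x : V => (-1) *: ((x 0 i)%:K *: cm (ce i) (g x)).
  by apply/funext => x; rewrite cmNl scalerN scaleN1r.
rewrite (ipZr _ tf (ctempered_cml _ (tT _ hg))).
rewrite (ipZr _ tf (tx _ (ctempered_cml _ (pol_ctempered hg)))).
exact: lin_antisym.
Qed.

Lemma ip_dirac f g : pol f -> pol g -> ip (Dir f) g = ip f (Dp g).
Proof.
move=> hf hg; have [tf tg] := (pol_ctempered hf, pol_ctempered hg).
have tT i h : pol h -> ctempered (dunkl_op Rp kappa i h).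
  by move=> /(pol_dunkl_sum i)/dunkl_sum_ctempered[].
have te i h : pol h -> ctempered (fun x => cm (ce i) (dunkl_op Rp kappa i h x)).
  by move=> hh; apply: ctempered_cml; exact: tT.
have txe i : ctempered (fun x => (x 0 i)%:K *: cm (ce i) (g x)).
  by apply: ctemperedM; [exact: tempered_coord|exact: ctempered_cml].
have eD h : Dir h = fun x => \sum_i cm (ce i) (dunkl_op Rp kappa i h x).
  by apply/funext => x; rewrite diracE.
have hX := pol_ctempered (pol_mulx hg); have hD := pol_ctempered (pol_dirac Rp kappa hg).
rewrite (ipBZr _ tf hD hX).
have -> : ip f (mulx g) = \sum_i ip f (fun x => (x 0 i)%:K *: cm (ce i) (g x)).
  by rewrite -(ip_sumr _ tf txe); congr ip; apply/funext => x; exact: mulxE.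
rewrite !eD (ip_suml _ tg (fun i => te i f hf)) (ip_sumr _ tf (fun i => te i g hg)).
rewrite scaler_sumr -sumrB; apply: eq_bigr => i _.
exact: ip_ce_dunkl.
Qed.

Lemma ip_raising f g : pol f -> pol g -> ip (Dp f) g = ip f (Dir g).
Proof.
move=> hf hg; have [tf tg] := (pol_ctempered hf, pol_ctempered hg).
have tD h : pol h -> ctempered (Dir h) by move=> hh; apply: pol_ctempered; exact: pol_dirac.
have tP h : pol h -> ctempered (Dp h) by move=> hh; apply: pol_ctempered; exact: pol_raising.
by rewrite (ip_cj (tP _ hf) tg) (ip_cj tf (tD _ hg)) (ip_dirac hg hf).
Qed.

End weighted.

End integrals.

(** * Orthogonality *)

Lemma lin_scale_inj (K : fieldType) (M : lmodType K) (k l : K) (v : M) :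
  k != l -> - k *: v = - l *: v -> v = 0.
Proof.
move=> kl /eqP; rewrite -subr_eq0 -scalerBl scaler_eq0 opprK addrC subr_eq0 eq_sym.
by rewrite (negbTE kl) => /eqP.
Qed.

Section orthogonality.
Context {R : realType} {d : nat}.
Local Notation V := 'rV[R]_d.
Local Notation Cl := (Cl R d).
Local Notation "r %:K" := ((r%:C)%C) (at level 2, format "r %:K").
Variables (Rs Rp : seq V) (kappa : V -> R).
Hypothesis hRs : root_system Rs.
Hypothesis hRp : positive_subsystem Rs Rp.
Hypothesis hk : multiplicity Rs kappa.
Hypothesis d2 : (2 <= d)%N.
Hypothesis gk0 : 0 < gamma_k Rp kappa.
Local Notation ip := (ip Rp kappa).
Local Notation Dir := (dirac_op Rp kappa).
Local Notation Dp := (raising_op Rp kappa).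
Local Notation mu := (mu Rp kappa).
Local Notation harm := (harm Rp kappa).

Lemma cj0 : cj (0 : Cl) = 0.
Proof. by rewrite -cjE; apply/ffunP => A; rewrite !ffunE rmorph0 mulr0. Qed.

Lemma Rp_neq0 a : a \in Rp -> a != 0.
Proof. by move=> /(positive_root hRp) /(root_neq0 hRs). Qed.

(** It keeps the arguments mu / 2 + n of the Gamma function above 1, where [Gamma_rec] holds. *)
Lemma mu_gt2 : 2 < mu.
Proof.
have : (2 : R) <= d%:R by rewrite ler_nat.
by rewrite /Defs.mu; move: gk0; lra.
Qed.

Lemma harm_pol n P : harm n P -> pol P.
Proof. by case=> /pol_hom. Qed.

Lemma harm_raising n P : harm n P -> Dp P = fun x => (-2) *: mulx P x.
Proof. by move=> [_ DP]; apply/funext => x; rewrite /raising_op DP sub0r scaleNr. Qed.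

Lemma harm_dirac_mulx n P : harm n P -> Dir (mulx P) = fun x => (- (2 * n%:R + mu)%:K) *: P x.
Proof.
move=> [hP DP]; apply/funext => x; rewrite (dirac_mulx _ Rp_neq0 _ hP).
by rewrite {1}/mulx DP cm0r oppr0 sub0r scaleNr.
Qed.

(* Both [(2 m + mu) (P, Q)] and [(2 n + mu) (P, Q)] equal [2 (x P, x Q)]. *)
Lemma ip_harm_neq n m P Q : n != m -> harm n P -> harm m Q -> ip P Q = 0.
Proof.
move=> nm hP hQ; have [pP pQ] := (harm_pol hP, harm_pol hQ).
have [tP tQ] := (pol_ctempered pP, pol_ctempered pQ).
have [tX tY] := (pol_ctempered (pol_mulx pP), pol_ctempered (pol_mulx pQ)).
have e1 := ip_raising hRs hRp hk pP (pol_mulx pQ).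
rewrite (harm_raising hP) (harm_dirac_mulx hQ) (ipZl hRp hk _ tX tY) (ipZr hRp hk _ tP tQ) in e1.
have e2 := ip_dirac hRs hRp hk (pol_mulx pP) pQ.
rewrite (harm_raising hQ) (harm_dirac_mulx hP) (ipZl hRp hk _ tP tQ) (ipZr hRp hk _ tX tY) in e2.
have c2 : conjc (-2) = -2 :> R[i] by rewrite rmorphN rmorph_nat.
rewrite c2 in e1; rewrite -rcN conjc_real rcN in e2.
apply: lin_scale_inj (etrans e2 e1); apply: contraNneq nm => /complexI H.
have : n%:R = m%:R :> R by lra.
by move/eqP; rewrite eqr_nat.
Qed.

(** One D_+ moves across as D and lowers the power on the other side. For t = 0 the factor [cH] is
    0, so [t.-1] does no harm. *)
Lemma ip_iter_raising_step n m s t P Q : harm n P -> harm m Q ->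
  ip (iter s.+1 Dp P) (iter t Dp Q) = (cH Rp kappa m t)%:K *: ip (iter s Dp P) (iter t.-1 Dp Q).
Proof.
move=> hP hQ; have [pP pQ] := (harm_pol hP, harm_pol hQ).
have [ps pt] := (pol_iter_raising Rp kappa s pP, pol_iter_raising Rp kappa t pQ).
rewrite [LHS](ip_raising hRs hRp hk ps pt).
have -> : Dir (iter t Dp Q) = fun x => (cH Rp kappa m t)%:K *: iter t.-1 Dp Q x.
  by apply/funext => x; rewrite (dirac_iter_raising Rp_neq0 _ _ hQ).
by rewrite (ipZr hRp hk _ (pol_ctempered ps) (pol_ctempered (pol_iter_raising Rp kappa t.-1 pQ))).
Qed.

Definition cHprod m s : R := \prod_(k < s) cH Rp kappa m k.+1.

Lemma ip_iter_raising_eq n m s P Q : harm n P -> harm m Q ->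
  ip (iter s Dp P) (iter s Dp Q) = (cHprod m s)%:K *: ip P Q.
Proof.
move=> hP hQ; elim: s => [|s IH]; first by rewrite /cHprod big_ord0 scale1r.
rewrite (ip_iter_raising_step _ _ hP hQ) IH scalerA -rcM /cHprod big_ord_recr /=.
by rewrite mulrC.
Qed.

(** By conjugation the left power may be taken larger. Each step removes one D_+ from both sides,
    until D meets Q itself and gives 0; the degrees n and m do not enter. *)
Lemma ip_iter_raising_neq n m s t P Q : s != t -> harm n P -> harm m Q ->
  ip (iter s Dp P) (iter t Dp Q) = 0.
Proof.
have lt s' t' n' m' P' Q' : (t' < s')%N -> harm n' P' -> harm m' Q' ->
    ip (iter s' Dp P') (iter t' Dp Q') = 0.
  move=> + hP hQ; elim: s' t' => // s' IH [|t'] ts.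
    by rewrite (ip_iter_raising_step _ _ hP hQ) scale0r.
  by rewrite (ip_iter_raising_step _ _ hP hQ) IH // scaler0.
move=> st hP hQ; move: st; rewrite neq_ltn => /orP[st|ts]; last exact: lt ts hP hQ.
have [pP pQ] := (harm_pol hP, harm_pol hQ).
rewrite (ip_cj hRp hk) ?(lt _ _ _ _ _ _ st hQ hP).
- exact: cj0.
- by apply: pol_ctempered; exact: pol_iter_raising.
- by apply: pol_ctempered; exact: pol_iter_raising.
Qed.

Lemma Gamma_rec (s : R) : 1 < s -> Gamma (s + 1) = s * Gamma s.
Proof.
move=> s1; rewrite !GammaE Gammae_rec // fineM // ge0_fin_numE ?Gammae_ge0 //.
by apply: Gammae_fin; exact: ltW.
Qed.

Lemma Gamma_gt0 (s : R) : 1 <= s -> 0 < Gamma s.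
Proof. by move=> s1; rewrite GammaE fine_gt0 // Gammae_gt0 // Gammae_fin. Qed.

(** The value of [gamma_smn] at s = 0, which is also the ratio between the inner products on the
    whole space and on the sphere. *)
Definition gamma0 n : R := pi `^ (d%:R / 2) * Gamma (mu / 2 + n%:R) / Gamma (d%:R / 2).

Lemma cH_even n k : cH Rp kappa n k.*2 = 4 * k%:R.
Proof. by elim: k => [|k IH]; rewrite ?mulr0 // doubleS /= IH -natr1; ring. Qed.

Lemma cH_odd n k : cH Rp kappa n k.*2.+1 = 4 * (k%:R + mu / 2 + n%:R).
Proof.
elim: k => [|k IH]; first by rewrite /=; field.
by rewrite doubleS [LHS]/= -[X in X + _]/(cH Rp kappa n k.*2.+1) IH -natr1; ring.
Qed.

(** Consecutive values differ by the factor [cH]. From 2 j to 2 j + 1 the argument of Gamma grows by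
    1 and the factorial stays; from 2 k + 1 to 2 k + 2 the factorial gains k + 1 and the argument of
    Gamma stays. Each step brings another factor 4. *)
Lemma gamma_smnE s n : gamma_smn Rp kappa s n = cHprod n s * gamma0 n.
Proof.
have mu2 := mu_gt2.
suff H k : gamma_smn Rp kappa k.*2 n = cHprod n k.*2 * gamma0 n /\
           gamma_smn Rp kappa k.*2.+1 n = cHprod n k.*2.+1 * gamma0 n.
  by rewrite -(odd_double_half s); have [H1 H2] := H s./2; case: (odd s).
have odd_step j : gamma_smn Rp kappa j.*2.+1 n = cH Rp kappa n j.*2.+1 * gamma_smn Rp kappa j.*2 n.
  rewrite cH_odd /gamma_smn /= odd_double /= doubleK exprS.
  have -> : (j.*2.+1%:R + mu + 1) / 2 + n%:R = (j.*2%:R + mu) / 2 + n%:R + 1 :> R.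
    by rewrite -natr1; field.
  rewrite Gamma_rec; last first.
    have := ler0n R n; have := ler0n R j.*2; lra.
  have -> : (j.*2%:R + mu) / 2 + n%:R = j%:R + mu / 2 + n%:R by rewrite -muln2 natrM; field.
  by ring.
elim: k => [|k [_ IH2]].
  have H0 : gamma_smn Rp kappa 0 n = cHprod n 0 * gamma0 n.
    by rewrite /gamma_smn /cHprod big_ord0 /= expr0 fact0 !mul1r add0r.
  by split=> //; rewrite odd_step H0 mulrA; congr (_ * _); rewrite /cHprod big_ord_recr mulrC.
have even_step : gamma_smn Rp kappa k.+1.*2 n = cH Rp kappa n k.+1.*2 * gamma_smn Rp kappa k.*2.+1 n.
  rewrite cH_even /gamma_smn odd_double /= odd_double /= doubleK.
  rewrite factS natrM doubleS !exprS.
  have -> : (k.*2.+2%:R + mu) / 2 + n%:R = (k.*2.+1%:R + mu + 1) / 2 + n%:R :> R.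
    by rewrite -!natr1; field.
  by ring.
have E : gamma_smn Rp kappa k.+1.*2 n = cHprod n k.+1.*2 * gamma0 n.
  by rewrite even_step IH2 doubleS mulrA; congr (_ * _); rewrite /cHprod [RHS]big_ord_recr mulrC.
by split=> //; rewrite odd_step E mulrA; congr (_ * _); rewrite /cHprod [RHS]big_ord_recr mulrC.
Qed.

Lemma cHprod_gt0 n s : 0 < cHprod n s.
Proof.
apply: prodr_gt0 => k _; have mu2 := mu_gt2; have n0 := ler0n R n.
suff H j : (0 < j)%N -> 0 < cH Rp kappa n j by exact: H.
rewrite -(odd_double_half j); case: (odd j); rewrite ?add1n ?add0n => j0.
  rewrite cH_odd; have := ler0n R j./2; lra.
by rewrite cH_even pmulr_rgt0 // ltr0n -double_gt0.
Qed.

Lemma gamma0_gt0 n : 0 < gamma0 n.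
Proof.
have mu2 := mu_gt2; have n0 := ler0n R n; have dd : (2 : R) <= d%:R by rewrite ler_nat.
rewrite /gamma0 divr_gt0 ?mulr_gt0 ?powR_gt0 ?pi_gt0 ?Gamma_gt0 //; lra.
Qed.

Lemma gamma_smn_gt0 s n : 0 < gamma_smn Rp kappa s n.
Proof. by rewrite gamma_smnE mulr_gt0 ?cHprod_gt0 ?gamma0_gt0. Qed.

Lemma h_kZ (c : R) (x : V) : 0 < c ->
  h_k Rp kappa (c *: x) = c `^ gamma_k Rp kappa * h_k Rp kappa x.
Proof.
move=> c0; rewrite /h_k /gamma_k.
elim: {1 2 3}Rp => [|a s IH]; first by rewrite !big_nil powRr0 mulr1.
rewrite !big_cons IH dotvZr normrM (gtr0_norm c0) powRM ?(ltW c0) //.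
rewrite powRD ?(gt_eqF c0) ?implybT //; ring.
Qed.

Lemma hpolZ n f (c : R) (x : V) : hpol n f -> f (c *: x) = (c ^+ n)%:K *: (f x : Cl).
Proof.
elim=> {n f} [n|b|n f g _ Hf _ Hg|n j f _ Hf].
- by rewrite scaler0.
- by rewrite expr0 scale1r.
- by rewrite scalerDr Hf Hg.
by rewrite Hf mxE !scalerA -!rcM; apply: clZ_eq => //; rewrite exprS mulrAC.
Qed.

Section sphere.
Variables (n : nat) (f g : V -> Cl).
Hypotheses (hf : hpol n f) (hg : hpol n g).

Let F x : Cl := cm (cj (f x)) (g x).
(** The degree of [h_k ^+ 2] times [F]. It is positive even for n = 0, since [gamma_k] is, as
    [polar] requires. *)
Let p : R := 2 * gamma_k Rp kappa + (n + n)%:R.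

Let F_tempered : ctempered F.
Proof.
have tf := pol_ctempered (pol_hom hf).
exact: ctempered_cm (ctempered_cj tf) (pol_ctempered (pol_hom hg)).
Qed.

Let FZ c x : F (c *: x) = (c ^+ (n + n))%:K *: F x.
Proof.
rewrite /F (hpolZ c x hf) (hpolZ c x hg) cjZ conjc_real cmZl cmZr scalerA -rcM.
by rewrite exprD.
Qed.

Let p0 : 0 < p.
Proof. by rewrite ltr_wpDr // mulr_gt0. Qed.

Let hZ (u : V -> R) : (forall c x, u (c *: x) = c ^+ (n + n) * u x) ->
  forall c x, 0 < c -> h_k Rp kappa (c *: x) ^+ 2 * u (c *: x) =
    c `^ p * (h_k Rp kappa x ^+ 2 * u x).
Proof.
move=> uZ c x c0; rewrite h_kZ // uZ /p powRD ?(gt_eqF c0) ?implybT //.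
rewrite powR_mulrn ?(ltW c0) // [2 * _]mulrC powRrM powR_mulrn ?powR_ge0 //; ring.
Qed.

Let h_tempered (u : V -> R) : tempered u -> tempered (fun x => h_k Rp kappa x ^+ 2 * u x).
Proof.
move=> tu; apply: temperedM => //.
apply: (eq_tempered (wprod0 Rp kappa)); exact: (tempered_wprod hRp hk).
Qed.

Definition ball_fun (u : V -> R) x : R :=
  radial (fun x => h_k Rp kappa x ^+ 2 * u x) x * (norm2 x <= 1)%R%:R.

Let pd2 : (p + d%:R) / 2 = mu / 2 + n%:R.
Proof. by rewrite /p /Defs.mu natrD; field. Qed.

Let Rv_weight (u : V -> R) : tempered u -> (forall c x, u (c *: x) = c ^+ (n + n) * u x) ->
  Rv (fun x => wgauss Rp kappa x * u x) =
  Gamma (mu / 2 + n%:R) * (d%:R / 2) * Rv (ball_fun u).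
Proof.
move=> tu uZ; rewrite -pd2 -(polar d2 (h_tempered tu) p0 (hZ uZ)).
by apply: eq_Rv => x; rewrite /wgauss wprod0; ring.
Qed.

Let ballF (x : V) : Cl := if 0 < norm2 x <= 1 then
   ((h_k Rp kappa ((Num.sqrt (norm2 x))^-1 *: x) ^+ 2)%:K) *: F ((Num.sqrt (norm2 x))^-1 *: x)
   else 0.

Let ballF_Re A x : complex.Re (ballF x A) = ball_fun (fun x => complex.Re (F x A)) x.
Proof.
rewrite /ballF /ball_fun /radial; case: (0 < norm2 x) => /=; last by rewrite cl_coef0 !mul0r.
case: (norm2 x <= 1); last by rewrite cl_coef0 mulr0.
by rewrite cl_coefZ ReZ mulr1 mul1r.
Qed.

Let ballF_Im A x : complex.Im (ballF x A) = ball_fun (fun x => complex.Im (F x A)) x.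
Proof.
rewrite /ballF /ball_fun /radial; case: (0 < norm2 x) => /=; last by rewrite cl_coef0 !mul0r.
case: (norm2 x <= 1); last by rewrite cl_coef0 mulr0.
by rewrite cl_coefZ ImZ mulr1 mul1r.
Qed.

Let ballF_tame : cltame ballF.
Proof.
move=> A; have [t1 t2] := F_tempered A; split.
  by apply: (eq_tame (fun x => esym (ballF_Re A x))); exact: tame_ball (h_tempered t1).
by apply: (eq_tame (fun x => esym (ballF_Im A x))); exact: tame_ball (h_tempered t2).
Qed.

(** Polar coordinates apply to the real and imaginary part of each coefficient. Their factor
    Gamma(mu / 2 + n) d / 2 is [gamma0 n] divided by the area of the sphere and multiplied by the d
    of the cone formula. *)
Lemma ip_sph_ip : ip f g = (gamma0 n)%:K *: sph_ip Rp kappa f g.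
Proof.
have dd : (2 : R) <= d%:R by rewrite ler_nat.
have Gd : 0 < Gamma (d%:R / 2 : R) by apply: Gamma_gt0; lra.
have pid : 0 < pi `^ (d%:R / 2) :> R by rewrite powR_gt0 // pi_gt0.
have -> : sph_ip Rp kappa f g = ((sphere_area R d)^-1)%:K *: (d%:R%:K *: clint ballF).
  by rewrite -(cl_int_tame ballF_tame) /sph_ip /sph_int cmE cjE.
rewrite !scalerA -!rcM.
have -> : gamma0 n / sphere_area R d * d%:R = Gamma (mu / 2 + n%:R) * (d%:R / 2).
  rewrite /gamma0 /sphere_area; field; do ?[apply/andP; split]; exact: lt0r_neq0.
rewrite ipE; apply/ffunP => A; rewrite cl_coefZ !clintE.
have [t1 t2] := F_tempered A.
have z1 c x : complex.Re (F (c *: x) A) = c ^+ (n + n) * complex.Re (F x A).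
  by rewrite FZ cl_coefZ ReZ.
have z2 c x : complex.Im (F (c *: x) A) = c ^+ (n + n) * complex.Im (F x A).
  by rewrite FZ cl_coefZ ImZ.
apply/eqP; rewrite eq_complex ReZ ImZ /cint /=; apply/andP; split; apply/eqP.
  rewrite (eq_Rv (ballF_Re A)) -(Rv_weight t1 z1).
  by apply: eq_Rv => x; rewrite cl_coefZ ReZ.
rewrite (eq_Rv (ballF_Im A)) -(Rv_weight t2 z2).
by apply: eq_Rv => x; rewrite cl_coefZ ImZ.
Qed.

End sphere.

End orthogonality.

(** * Completeness *)

Section hermite_basis.
Context {R : realType} {d : nat}.
Local Notation V := 'rV[R]_d.
Local Notation Cl := (Cl R d).
Local Notation "r %:K" := ((r%:C)%C) (at level 2, format "r %:K").
Local Notation Re := (@complex.Re R).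
Local Notation Im := (@complex.Im R).
Variables (Rs Rp : seq V) (kappa : V -> R).
Hypothesis hRs : root_system Rs.
Hypothesis hRp : positive_subsystem Rs Rp.
Hypothesis hk : multiplicity Rs kappa.
Hypothesis d2 : (2 <= d)%N.
Hypothesis gk0 : 0 < gamma_k Rp kappa.
Local Notation wg := (wgauss Rp kappa).
Local Notation Dp := (raising_op Rp kappa).
Local Notation harm := (harm Rp kappa).

Lemma wgauss_ge0 x : 0 <= wg x.
Proof. by rewrite /wgauss wprod0 mulr_ge0 ?sqr_ge0 ?expR_ge0. Qed.

Lemma vmeas_wgauss : vmeas wg.
Proof.
have [+ _] := tempered_wgauss_tame hRp hk (tempered_cst (1 : R)).
by rewrite (_ : (fun x => _) = wg) //; apply/funext => x; rewrite mul1r.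
Qed.

Lemma wgauss_expR_tame F : tempered F -> tame (fun x => F x * expR (norm2 x / 4) * wg x).
Proof.
move=> tF; have tw := temperedM tF (tempered_wprod hRp hk (lexx 0)).
(* The weight has rate 1 and the factor exp(|x|^2 / 4) takes 1/4 of it, which leaves 3/4. *)
have c8 : 8^-1 <= (3 / 4 : R) by lra.
apply: eq_tame (tempered_tame c8 tw) => x.
rewrite -mulrA; set W := wprod _ _ _ _; rewrite /wgauss -/W -!mulrA; congr (_ * _).
by rewrite [RHS]mulrCA; congr (_ * _); rewrite -expRD; congr expR; field.
Qed.

Lemma rpoly_pol p f : rpoly p -> pol f -> pol (fun x : V => (p x)%:K *: (f x : Cl)).
Proof.
move=> hp; elim: hp f => {p} [c|j|p q _ hp _ hq|p q _ hp _ hq] f hf.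
- exact: pol_Z.
- elim: hf => {f} [n f hf|f g _ hf _ hg]; first exact: pol_hom (hpol_coord j hf).
  by apply: eq_pol (pol_add hf hg) => x; rewrite scalerDr.
- by apply: eq_pol (pol_add (hp _ hf) (hq _ hf)) => x; rewrite rcD scalerDl.
by apply: eq_pol (hp _ (hq _ hf)) => x; rewrite rcM scalerA.
Qed.

Definition clmeas (f : V -> Cl) := forall A,
  vmeas (fun x => Re (f x A)) /\ vmeas (fun x => Im (f x A)).

Lemma ctempered_clmeas f : ctempered f -> clmeas f.
Proof. by move=> hf A; have [[m1 _] [m2 _]] := hf A. Qed.

Lemma wnorm2_ge0 u : (0 <= wnorm2 wg u)%E.
Proof. by apply: integral_ge0 => t _; rewrite lee_fin mulr_ge0 ?wgauss_ge0 ?sqr_ge0. Qed.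

(** The norm splits over the real components of the coefficients, so density for real functions is
    enough. *)
Lemma L2norm2E f : clmeas f ->
  L2norm2 Rp kappa f =
  (\sum_A (wnorm2 wg (fun x => Re (f x A)) + wnorm2 wg (fun x => Im (f x A))))%E.
Proof.
move=> mf.
have mE u : vmeas u -> vemeas (fun x => (wg x * u x ^+ 2)%:E).
  by move=> mu; apply: vmeasE; apply: vmeasM; [exact: vmeas_wgauss|exact: vmeasX].
have E x : ((weight Rp kappa x * clnorm2 (f x))%:E =
   \sum_A ((wg x * Re (f x A) ^+ 2)%:E + (wg x * Im (f x A) ^+ 2)%:E))%E.
  rewrite weightE /clnorm2 mulr_sumr -sumEFin; apply: eq_bigr => A _.
  by rewrite mulrDr EFinD.
have p0 u x : (0 <= (wg x * u ^+ 2)%:E)%E by rewrite lee_fin mulr_ge0 ?wgauss_ge0 ?sqr_ge0.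
have mA A : vemeas (fun x => ((wg x * Re (f x A) ^+ 2)%:E + (wg x * Im (f x A) ^+ 2)%:E)%E).
  by have [m1 m2] := mf A; apply: emeasurable_funD; [exact: (mE _ m1)|exact: (mE _ m2)].
rewrite /L2norm2 (_ : (fun x => _) = fun x =>
   (\sum_A ((wg x * Re (f x A) ^+ 2)%:E + (wg x * Im (f x A) ^+ 2)%:E))%E); last first.
  by apply/funext => x; exact: E.
rewrite ge0_intRdE; last 2 first.
- by apply: emeasurable_sum => A; exact: mA.
- by move=> x; apply: sume_ge0 => A _; rewrite adde_ge0.
rewrite /vint ge0_integral_sum //; last first.
- by move=> A t _; rewrite adde_ge0.
apply: eq_bigr => A _; have [m1 m2] := mf A.
have e1 := mE _ m1; have e2 := mE _ m2.
by rewrite ge0_integralD.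
Qed.

Lemma ctempered_inL2 f : ctempered f -> inL2 Rp kappa f.
Proof.
move=> hf; have mf := ctempered_clmeas hf; split; first exact: mf.
have fin u : tempered u -> (wnorm2 wg u < +oo)%E.
  move=> /(temperedX 2) tu; have t := tempered_wgauss_tame hRp hk tu.
  rewrite /wnorm2 (_ : (fun x => _) = fun x => (u x ^+ 2 * wg x)%:E) ?vint_tame ?ltry //.
  by apply/funext => x; rewrite mulrC.
rewrite L2norm2E //; apply: lte_sum_pinfty => A _; have [t1 t2] := hf A.
by rewrite lte_add_pinfty ?fin.
Qed.

Lemma pol_dense f e : inL2 Rp kappa f -> 0 < e ->
  exists2 p, pol p & (L2norm2 Rp kappa (fun x => f x - p x)%R < e%:E)%E.
Proof.
move=> [mf ff] e0; have {}mf : clmeas f by exact: mf.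
rewrite L2norm2E // in ff.
have fin A : (wnorm2 wg (fun x => Re (f x A)) < +oo)%E /\ (wnorm2 wg (fun x => Im (f x A)) < +oo)%E.
  have le u : (u <= wnorm2 wg (fun x => Re (f x A)) + wnorm2 wg (fun x => Im (f x A)))%E ->
     (u < +oo)%E.
    move=> ule; apply: le_lt_trans ff; apply: (le_trans ule).
    by rewrite [leRHS](bigD1 A) //= leeDl //; apply: sume_ge0 => B _; rewrite adde_ge0 ?wnorm2_ge0.
  by split; apply: le; rewrite ?leeDl ?leeDr ?wnorm2_ge0.
(* There are M coefficients with two real parts each; errors below e / (4 M) add up to at most e /
   2. *)
pose M : R := #|{set 'I_d}|%:R.
have M0 : 0 < M by rewrite ltr0n; apply/card_gt0P; exists finset.set0.
have eM : 0 < e / M / 4 by rewrite !divr_gt0.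
have dense u : vmeas u -> (wnorm2 wg u < +oo)%E ->
    exists p, rpoly p /\ (wnorm2 wg (fun x => u x - p x)%R < (e / M / 4)%:E)%E.
  move=> mu fu; have [_ /(_ _ eM)[p]] :=
    poly_dense wgauss_ge0 vmeas_wgauss wgauss_expR_tame mu fu.
  by exists p.
have /choice[p hp] A := dense _ (mf A).1 (fin A).1.
have /choice[q hq] A := dense _ (mf A).2 (fin A).2.
pose F x : Cl := \sum_A ((p A x)%:K *: clE A + (q A x)%:K *: ('i%C *: clE A)).
have FA x A : F x A = (p A x +i* q A x)%C.
  rewrite /F sum_ffunE (bigD1 A) //= big1 ?addr0; last first.
    by move=> B BA; rewrite !cl_coefD !cl_coefZ !clE_ eq_sym (negbTE BA) !mulr0 addr0.
  by rewrite !cl_coefD !cl_coefZ !clE_ eqxx !mulr1 [RHS]complexE mulrC.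
have pF : pol F.
  rewrite /F; elim: (index_enum _) => [|A r IH].
    by apply: eq_pol (pol_hom (hpol_zero 0)) => x; rewrite big_nil.
  apply: (@eq_pol _ _ (fun x => ((p A x)%:K *: clE A + (q A x)%:K *: ('i%C *: clE A)) +
    \sum_(A <- r) ((p A x)%:K *: clE A + (q A x)%:K *: ('i%C *: clE A)))).
    by move=> x; rewrite big_cons.
  apply: pol_add IH; apply: pol_add; apply: rpoly_pol.
  - exact: (hp A).1.
  - exact: pol_hom (hpol_cst _).
  - exact: (hq A).1.
  - exact: pol_hom (hpol_cst _).
exists F => //; rewrite L2norm2E; last first.
  move=> A; have [m1 m2] := mf A; have [t1 t2] := ctempered_clmeas (pol_ctempered pF) A.
  split.
    rewrite (_ : (fun x => _) = fun x => Re (f x A) - Re (F x A)); first exact: vmeasB.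
    by apply/funext => x; rewrite cl_coefD cl_coefN raddfB.
  rewrite (_ : (fun x => _) = fun x => Im (f x A) - Im (F x A)); first exact: vmeasB.
  by apply/funext => x; rewrite cl_coefD cl_coefN raddfB.
have small A : (wnorm2 wg (fun x => Re ((f x - F x)%R A)) + wnorm2 wg (fun x => Im ((f x - F x)%R A))
     <= (e / M / 2)%:E)%E.
  have -> : (fun x => Re ((f x - F x) A)) = fun x => Re (f x A) - p A x.
    by apply/funext => x; rewrite cl_coefD cl_coefN raddfB FA.
  have -> : (fun x => Im ((f x - F x) A)) = fun x => Im (f x A) - q A x.
    by apply/funext => x; rewrite cl_coefD cl_coefN raddfB FA.
  have -> : (e / M / 2)%:E = ((e / M / 4)%:E + (e / M / 4)%:E)%E by rewrite -EFinD; congr EFin; lra.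
  by apply: leeD; apply: ltW; [exact: (hp A).2|exact: (hq A).2].
apply: le_lt_trans (lee_sum _ (fun A _ => small A)) _.
rewrite sumEFin lte_fin sumr_const (@eq_card _ _ {set 'I_d}) // -[ltLHS]mulr_natl -/M.
have -> : M * (e / M / 2) = e / 2 by field; exact: lt0r_neq0.
lra.
Qed.

Variable P : nat -> nat -> V -> Cl.
Let N n := 'C(n + d - 2, n).
Hypothesis harmP : forall n j, (j < N n)%N -> harm n (P n j).
Hypothesis orthP : forall n i j, (i < N n)%N -> (j < N n)%N ->
  sph_ip Rp kappa (P n i) (P n j) = if i == j then cl1 R d else 0.
Hypothesis spanP : forall n Q, harm n Q -> exists a : nat -> Cl,
  forall x, Q x = \sum_(j < N n) cm (P n j x) (a j).

Let valid (k : nat * nat * nat) := (k.2 < N k.1.2)%N.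
Let H (k : nat * nat * nat) : V -> Cl := iter k.1.1 Dp (P k.1.2 k.2).
Let nrm (k : nat * nat * nat) : R := Num.sqrt (gamma_smn Rp kappa k.1.1 k.1.2).
Let Phi k x : Cl := ((nrm k)^-1)%:K *: H k x.

Let H_pol k : valid k -> pol (H k).
Proof. by move=> vk; apply: pol_iter_raising; exact: harm_pol (harmP vk). Qed.

Let nrm_gt0 k : 0 < nrm k.
Proof. by rewrite sqrtr_gt0; exact: gamma_smn_gt0. Qed.

Lemma ip_hermite k l : valid k -> valid l ->
  ip Rp kappa (H k) (H l) =
  if k == l then (gamma_smn Rp kappa k.1.1 k.1.2)%:K *: cl1 R d else 0.
Proof.
case: k => [[s n] j]; case: l => [[t m] i]; rewrite /valid /H /= => vk vl.
have [hP hQ] := (harmP vk, harmP vl).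
rewrite !xpair_eqE; have [st|st] := eqVneq s t; last first.
  exact (ip_iter_raising_neq hRs hRp hk st hP hQ).
rewrite -st (ip_iter_raising_eq hRs hRp hk _ hP hQ).
have [nm|nm] := eqVneq n m; last first.
  by rewrite (ip_harm_neq hRs hRp hk nm hP hQ) scaler0.
rewrite /= -nm in vl hQ *; rewrite (ip_sph_ip hRp hk d2 gk0 hP.1 hQ.1) orthP //.
case: (j == i); last by rewrite !scaler0.
by rewrite scalerA -rcM gamma_smnE.
Qed.

Lemma ip_hermite_normalized k l : valid k -> valid l ->
  ip Rp kappa (Phi k) (Phi l) = if k == l then cl1 R d else 0.
Proof.
move=> vk vl; have [tk tl] := (pol_ctempered (H_pol vk), pol_ctempered (H_pol vl)).
rewrite (ipZl hRp hk _ tk (ctempered_Z _ tl)) (ipZr hRp hk _ tk tl) conjc_real ip_hermite //.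
case: eqVneq => [<-|_]; last by rewrite !scaler0.
have -> : gamma_smn Rp kappa k.1.1 k.1.2 = nrm k ^+ 2.
  by rewrite sqr_sqrtr // ltW //; exact: gamma_smn_gt0.
rewrite !scalerA -!rcM (_ : _ * _ = 1) ?scale1r //.
by have n0 := lt0r_neq0 (nrm_gt0 k); field.
Qed.

Definition in_span (f : V -> Cl) := exists (S : seq (nat * nat * nat)) (a : nat * nat * nat -> Cl),
  [/\ uniq S, all valid S & forall x, f x = \sum_(k <- S) cm (Phi k x) (a k)].

(** Coefficients are extended by 0 to the union of the two index lists; an index occurring in both
    collects the sum. *)
Lemma in_span_add f g : in_span f -> in_span g -> in_span (fun x => f x + g x).
Proof.
move=> [S [a [uS vS Ef]]] [S' [a' [uS' vS' Eg]]].
have ext (S0 S1 : seq (nat * nat * nat)) (F : nat * nat * nat -> Cl) :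
    uniq S0 -> uniq S1 -> {subset S0 <= S1} ->
    \sum_(k <- S0) F k = \sum_(k <- S1) if k \in S0 then F k else 0.
  move=> u0 u1 s01; rewrite -big_mkcond -big_filter; apply: perm_big.
  apply: uniq_perm; rewrite ?filter_uniq // => k.
  by rewrite mem_filter; case: (boolP (k \in S0)) => // /s01 ->.
pose U := undup (S ++ S').
exists U, (fun k => (if k \in S then a k else 0) + (if k \in S' then a' k else 0)); split.
- exact: undup_uniq.
- by apply/allP => k; rewrite mem_undup mem_cat => /orP[]; apply/allP.
move=> x; rewrite Ef Eg (ext S U) ?undup_uniq //; last first.
  by move=> k kS; rewrite mem_undup mem_cat kS.
rewrite (ext S' U) ?undup_uniq //; last first.
  by move=> k kS; rewrite mem_undup mem_cat kS orbT.
rewrite -big_split; apply: eq_bigr => k _; rewrite cmDr; apply: clD_eq.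
  by case: (k \in S); rewrite ?cm0r.
by case: (k \in S'); rewrite ?cm0r.
Qed.

Lemma iter_raisingD s f g : pol f -> pol g ->
  iter s Dp (fun x => f x + g x) = fun x => iter s Dp f x + iter s Dp g x.
Proof.
move=> hf hg; elim: s => //= s ->; apply/funext => x.
by rewrite raisingD //; exact: pol_iter_raising.
Qed.

Lemma iter_raising_sum (I : Type) (r : seq I) s (F : I -> V -> Cl) (a : I -> Cl) :
  (forall i, pol (F i)) -> iter s Dp (fun x => \sum_(i <- r) cm (F i x) (a i)) =
  fun x => \sum_(i <- r) cm (iter s Dp (F i) x) (a i).
Proof.
move=> hF; suff [_ ->] : pol (fun x => \sum_(i <- r) cm (F i x) (a i)) /\
  iter s Dp (fun x => \sum_(i <- r) cm (F i x) (a i)) =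
  fun x => \sum_(i <- r) cm (iter s Dp (F i) x) (a i) by [].
have p0 : pol (fun _ : V => 0 : Cl) by exact: pol_hom (hpol_zero 0).
elim: r => [|i r [pr IH]].
  have -> : (fun x => \sum_(i <- [::]) cm (F i x) (a i)) = fun=> 0.
    by apply/funext => x; rewrite big_nil.
  split=> //; have := iter_raisingZ Rp kappa s 0 p0.
  have -> : (fun _ : V => 0 *: (0 : Cl)) = fun=> 0 by apply/funext => x; rewrite scale0r.
  by move=> ->; apply/funext => x; rewrite scale0r big_nil.
have pc := pol_cmr (a i) (hF i).
have -> : (fun x => \sum_(j <- i :: r) cm (F j x) (a j)) =
    fun x => cm (F i x) (a i) + \sum_(j <- r) cm (F j x) (a j).
  by apply/funext => x; rewrite big_cons.
split; first exact: pol_add.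
rewrite (iter_raisingD _ pc pr) IH (iter_raising_cmr _ _ _ _ (hF i)); apply/funext => x.
by rewrite big_cons.
Qed.

Lemma hspan_in_span f : hspan Rp kappa f -> in_span f.
Proof.
elim=> {f} [n s Q hQ|f g _ Hf _ Hg]; last exact: in_span_add.
have [a Ea] := spanP hQ.
pose S := [seq (s, n, nat_of_ord j) | j : 'I_(N n)].
(* The coefficient undoes the normalization in [Phi]; s and n are fixed, and j runs over the basis
   of M_n. *)
exists S, (fun k => (nrm k)%:K *: a k.2); split.
- by rewrite map_inj_uniq ?enum_uniq // => i j [] /val_inj.
- by apply/allP => k /mapP[j _ ->]; rewrite /valid /=.
move=> x; rewrite big_map big_enum /=.
have EQ : Q = fun x => \sum_(j < N n) cm (P n j x) (a j) by apply/funext.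
have -> : iter s Dp Q x = \sum_(j < N n) cm (iter s Dp (P n j) x) (a j).
  by rewrite EQ iter_raising_sum // => i; exact: harm_pol (harmP (ltn_ord i)).
apply: eq_bigr => j _; rewrite /Phi cmZl cmZr scalerA -rcM mulVf ?scale1r //.
exact: lt0r_neq0.
Qed.

Lemma mu_gt0 : 0 < mu Rp kappa.
Proof. exact: lt_trans (mu_gt2 d2 gk0). Qed.

Lemma pol_in_span f : pol f -> in_span f.
Proof.
move=> hf; apply: hspan_in_span; apply: pol_hspan hf; last exact: mu_gt0.
exact: Rp_neq0 hRs hRp.
Qed.

Lemma Phi_ctempered k : valid k -> ctempered (Phi k).
Proof. by move=> vk; apply: pol_ctempered; apply: pol_Z; exact: H_pol. Qed.

End hermite_basis.

(** For completeness, g is first approximated by a polynomial in each coefficient; that polynomial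
    is then exactly a finite right combination of the normalized family, so no further error
    arises. *)
Theorem theorem3p4 (R : realType) (d : nat)
  (Rs Rp : seq 'rV[R]_d) (kappa : 'rV[R]_d -> R)
  (P : nat -> nat -> 'rV[R]_d -> Cl R d) :
  (2 <= d)%N ->
  root_system Rs ->
  positive_subsystem Rs Rp ->
  multiplicity Rs kappa ->
  0 < gamma_k Rp kappa ->
  (* for each n, {P n j : j < binom(n+d-2, n)} is an orthonormal basis of M_n *)
  (forall n : nat,
     [/\ (forall j, (j < 'C(n + d - 2, n))%N -> Mn Rp kappa n (P n j)),
         (forall i j, (i < 'C(n + d - 2, n))%N -> (j < 'C(n + d - 2, n))%N ->
            sph_ip Rp kappa (P n i) (P n j) = if i == j then cl1 R d else 0) &
         (forall Q, Mn Rp kappa n Q -> exists a : nat -> Cl R d,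
            forall x, Q x = \sum_(j < 'C(n + d - 2, n)) clmul (P n j x) (a j))]) ->
  let valid (k : nat * nat * nat) := (k.2 < 'C(k.1.2 + d - 2, k.1.2))%N in
  let Phi (k : nat * nat * nat) : 'rV[R]_d -> Cl R d := fun x =>
    (((Num.sqrt (gamma_smn Rp kappa k.1.1 k.1.2))^-1)%:C)%C
      *: Hfun Rp kappa k.1.1 (P k.1.2 k.2) x in
  [/\ (* gamma_{s,mu,n} = (H, H)_H *)
      (forall s n j, (j < 'C(n + d - 2, n))%N ->
         ipH Rp kappa (Hfun Rp kappa s (P n j)) (Hfun Rp kappa s (P n j))
         = (((gamma_smn Rp kappa s n)%:C)%C *: cl1 R d)),
      (* the normalized family lies in L^2(R^d; e^{x^2}) *)
      (forall k, valid k -> inL2 Rp kappa (Phi k)),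
      (* orthonormality *)
      (forall k l, valid k -> valid l ->
         ipH Rp kappa (Phi k) (Phi l) = if k == l then cl1 R d else 0) &
      (* completeness: the right span is dense *)
      (forall g, inL2 Rp kappa g -> forall eps : R, 0 < eps ->
         exists (S : seq (nat * nat * nat)) (a : nat * nat * nat -> Cl R d),
           all valid S /\
           (L2norm2 Rp kappa (fun x => (g x - \sum_(k <- S) clmul (Phi k x) (a k))%R)
              < eps%:E)%E)].
Proof.
move=> d2 hRs hRp hk gk0 hP valid Phi.
have harmP n j : (j < 'C(n + d - 2, n))%N -> harm Rp kappa n (P n j).
  by move=> jn; apply/harm_Mn; have [+ _ _] := hP n; apply.
have orthP n : forall i j, (i < 'C(n + d - 2, n))%N -> (j < 'C(n + d - 2, n))%N ->
    sph_ip Rp kappa (P n i) (P n j) = if i == j then cl1 R d else 0.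
  by have [_ + _] := hP n; apply.
have spanP n Q : harm Rp kappa n Q -> exists a : nat -> Cl R d,
    forall x, Q x = \sum_(j < 'C(n + d - 2, n)) cm (P n j x) (a j).
  move=> /harm_Mn hQ; have [_ _ /(_ Q hQ)[a Ea]] := hP n; exists a => x.
  by rewrite Ea cmE.
have PhiE k : Phi k = fun x => (((Num.sqrt (gamma_smn Rp kappa k.1.1 k.1.2))^-1)%:C)%C *:
    iter k.1.1 (raising_op Rp kappa) (P k.1.2 k.2) x.
  by rewrite /Phi /Hfun DplusE.
have tPhi k : valid k -> ctempered (Phi k).
  by rewrite PhiE; exact: Phi_ctempered.
split.
- move=> s n j jn; have vk : valid (s, n, j) by [].
  have tH : ctempered (iter s (raising_op Rp kappa) (P n j)).
    by apply: pol_ctempered; apply: pol_iter_raising; exact: harm_pol (harmP n j jn).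
  rewrite /Hfun DplusE (ipHE hRp hk tH tH).
  by rewrite (ip_hermite hRs hRp hk d2 gk0 harmP orthP vk vk) eqxx.
- by move=> k /tPhi; exact: ctempered_inL2 hRp hk _.
- move=> k l vk vl; rewrite (ipHE hRp hk (tPhi k vk) (tPhi l vl)) !PhiE.
  exact: (ip_hermite_normalized hRs hRp hk d2 gk0 harmP orthP vk vl).
move=> g hg eps eps0; have [f pf small] := pol_dense hRp hk hg eps0.
have [S [a [_ vS Ef]]] := pol_in_span hRs hRp d2 gk0 harmP spanP pf.
exists S, a; split=> //; rewrite cmE.
have {}Ef x : \sum_(k <- S) cm (Phi k x) (a k) = f x.
  by rewrite Ef; apply: eq_bigr => k _; rewrite PhiE.
by under eq_fun do rewrite Ef.
Qed.
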